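(* $$\bigcap_{a\in H^{\infty}\setminus\{0\}}\mathfrak{M}(\overline{a})=\mathscr{F},$$ where $\mathscr{F}$ is the set of $\psi\in H^\infty$ whose Fourier coefficients satisfy, for some $c>0$ (depending on $\psi$), $$\widehat{\psi}(n)=O(e^{-c\sqrt{n}}),\quad n\geq 0.$$
   Context: Let $\mathbb{D}=\{|z|<1\}$, $\mathbb{T}=\partial\mathbb{D}$, let $\mathscr{O}(\mathbb{D})$ be the set of analytic functions on $\mathbb{D}$, $H^2$ the Hardy space of $\mathbb{D}$ (identified with a closed subspace of $L^2=L^2(\mathbb{T},d\theta/2\pi)$ via radial boundary values), and $H^\infty$ the bounded analytic functions on $\mathbb{D}$. For $a\in H^\infty$, the co-analytic Toeplitz operator $T_{\overline a}:H^2\to H^2$ is $T_{\overline a}f=P_+(\overline a f)$, where $P_+$ is the orthogonal projection of $L^2$ onto $H^2$. The range space is $\mathscr{M}(\overline a):=T_{\overline a}H^2$, and its set of multipliers into itself is $$\mathfrak{M}(\overline{a}):=\{\phi\in\mathscr{O}(\mathbb{D}):\ \forall f\in\mathscr{M}(\overline{a}),\ \phi f\in\mathscr{M}(\overline{a})\}.$$ The Fourier coefficients of $\psi\in H^\infty$ are $\widehat\psi(n)=\int_0^{2\pi}\psi(e^{i\theta})e^{-in\theta}\frac{d\theta}{2\pi}$. *)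

(* Defs.v *)
From HB Require Import structures.
From mathcomp Require Import all_boot all_order all_algebra.
From mathcomp Require Import complex.
From mathcomp Require Import all_classical all_reals all_analysis.
Import Order.TTheory GRing.Theory Num.Theory.
Import numFieldNormedType.Exports.

Set Implicit Arguments.
Unset Strict Implicit.
Unset Printing Implicit Defensive.

Local Open Scope classical_set_scope.
Local Open Scope complex_scope.
Local Open Scope ring_scope.

(* A function on the unit disc is a total function on the complex plane, of
   type [R[i]^o -> R[i]^o] ([R[i]^o] is R[i] seen as a normed space over
   itself).  Every notion below depends only on its values on the disc. *)

Definition disc (R : realType) : set R[i] := [set z | `|z| < 1].

(* [derivable] is over the scalar field R[i]: complex differentiability. *)
Definition analytic_disc (R : realType) (f : R[i]^o -> R[i]^o) : Prop :=
  forall z, disc z -> derivable f z 1.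

(* e^{it} *)
Definition cis (R : realType) (t : R) : R[i] := cos t +i* sin t.

(* The integral of a complex function of the angle t over the circle, with
   respect to dt / 2pi. *)
Definition circle_int (R : realType) (u : R -> R[i]) : R[i] :=
  ((2 * pi)^-1 * \int[lebesgue_measure]_(t in `[0, 2 * pi]) complex.Re (u t))
  +i*
  ((2 * pi)^-1 * \int[lebesgue_measure]_(t in `[0, 2 * pi]) complex.Im (u t)).

Definition L2_inner (R : realType) (u v : R -> R[i]) : R[i] :=
  circle_int (fun t => u t * (v t)^*%C).

(* The radial boundary function.  The limit exists at almost every t for f in
   H^2; elsewhere [lim] takes an irrelevant default value. *)
Definition boundary (R : realType) (f : R[i]^o -> R[i]^o) (t : R) : R[i] :=
  lim (f (r%:C * cis t) @[r --> (1 : R)^'-]).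

Definition mean_square (R : realType) (f : R[i]^o -> R[i]^o) (r : R) : \bar R :=
  (((2 * pi)^-1)%:E *
   \int[lebesgue_measure]_(t in `[0%R, (2 * pi)%R])
      (complex.Re `|f (r%:C * cis t)| ^+ 2)%:E)%E.

Definition hardy2 (R : realType) : set (R[i]^o -> R[i]^o) :=
  [set f | analytic_disc f /\
           (ereal_sup [set mean_square f r | r in `[0%R, 1%R[] < +oo)%E].

Definition hardy_infty (R : realType) : set (R[i]^o -> R[i]^o) :=
  [set f | analytic_disc f /\
           exists M : R, forall z, disc z -> `|f z| <= M%:C].

(* [is_szego_proj u g]: g is the orthogonal projection P_+ u of u in L^2 onto
   H^2, i.e. the element of H^2 with u - g orthogonal to H^2. *)
Definition is_szego_proj (R : realType) (u : R -> R[i])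
    (g : R[i]^o -> R[i]^o) : Prop :=
  hardy2 g /\
  forall h, hardy2 h ->
    L2_inner (fun t => u t - boundary g t) (boundary h) = 0.

(* [is_coanalytic_toeplitz a f g]: T_{conj a} f = g. *)
Definition is_coanalytic_toeplitz (R : realType)
    (a f g : R[i]^o -> R[i]^o) : Prop :=
  is_szego_proj (fun t => (boundary a t)^*%C * boundary f t) g.

Definition range_space (R : realType) (a : R[i]^o -> R[i]^o) :
    set (R[i]^o -> R[i]^o) :=
  [set g | exists2 f, hardy2 f & is_coanalytic_toeplitz a f g].

Definition multipliers (R : realType) (a : R[i]^o -> R[i]^o) :
    set (R[i]^o -> R[i]^o) :=
  [set phi | analytic_disc phi /\
     forall f, range_space a f -> range_space a (fun z => phi z * f z)].

Definition fourier_coef (R : realType) (psi : R[i]^o -> R[i]^o) (n : int) :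
    R[i] :=
  circle_int (fun t => boundary psi t * cis (- (n%:~R * t))).

Definition root_exp_class (R : realType) : set (R[i]^o -> R[i]^o) :=
  [set psi | hardy_infty psi /\
     exists2 c : R, 0 < c & exists K : R, forall n : nat,
       `|fourier_coef psi n| <= (K * expR (- (c * Num.sqrt n%:R)))%:C].

(* H^infty minus the zero function of the disc. *)
Definition hardy_infty_nonzero (R : realType) : set (R[i]^o -> R[i]^o) :=
  [set a | hardy_infty a /\ exists2 z, disc z & a z != 0].

(* Main.v *)
(* Proof idea.  Everything is carried by Taylor coefficients: f is in H^2 iff
   they are square summable, boundary functions are limits almost everywhere
   of a subsequence of partial sums, and T_{conj a} f = g means
   <f, a p> = <g, p> for all p in H^2.

   Sufficiency.  For a nonzero bounded a, truncations of - ln |a|^2 on the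
   circle have a bounded mean, because of the weighted point estimate
   |f(z)|^2 (1 - |z|^2) exp(P[u](z)) <= mean of e^u |f|^2 at a point where a
   does not vanish.  Applied to u = - (tail of the truncations), the same
   estimate gives |p_n|^2 <= C e^{eps sqrt n} |a p|^2 for every eps > 0.  If
   G = T_{conj a} h, then <z^k G, p> = <h, a S*^k p> with S* the backward
   shift, and |a S*^k p| = |a p - a (p_0 + ... + p_{k-1} z^{k-1})|, so
   |<z^k G, p>| grows like e^{eps sqrt k} |a p|.  Summing against the
   coefficients of psi yields |<psi G, p>| <= C |a p|, and the Riesz
   representation puts psi G in the range of T_{conj a}.

   Necessity.  If a(0) <> 0 then 1 is in the range, so phi = T_{conj a} f and
   <phi, p> = <f, a p>.  Take p close to exp(q) with
   q = eps (1 + eta z) / (1 - eta z): its coefficients grow like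
   e^{c sqrt n} |eta|^n, and averaging over the argument of eta shows that
   |<phi, p>| is at least |p_n phi_n| for some choice of it.  If the
   coefficients of phi do not decay like e^{-c sqrt n}, choose
   eps = 2^{-k-1}, p_k and q_k with |<phi, p_k>| > k, and a = exp(- sum q_k).
   Then a p_k is bounded uniformly in k, a contradiction. *)

Require Import Defs.
From HB Require Import structures.
From mathcomp Require Import all_boot all_order all_algebra.
From mathcomp Require Import complex.
From mathcomp Require Import all_classical all_reals all_analysis.
From mathcomp Require Import measurable_realfun ring lra.
Import Order.TTheory GRing.Theory Num.Theory.
Import numFieldNormedType.Exports.

Set Implicit Arguments.
Unset Strict Implicit.
Unset Printing Implicit Defensive.

Local Open Scope classical_set_scope.
Local Open Scope complex_scope.
Local Open Scope ring_scope.

(** * Complex numbers, limits and power series *)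

(** The square root comes from one optimization. Since the truncations of - ln |a|^2 increase with
    bounded means, their tails have arbitrarily small mean delta, and the weighted estimate reads
    |p(z)|^2 (1 - |z|^2) <= C e^{2 delta / (1 - |z|)} |a p|^2. Cauchy's estimate for |p_n|^2 on the
    radius 1 - s costs a further e^{4ns}, and s of order n^{-1/2} balances the two exponents. In the
    converse the obstacle is the order of choices: f depends on a, and a on every p_k. It disappears
    because <phi, p> does not involve a, so the p_k and q_k are chosen from phi alone. Taking |eta|
    < 1 puts the pole outside the closed disc, so that each p_k is bounded. H^2 is defined by means
    over circles but P_+ by radial limits. The bridge is Fatou's theorem at Lebesgue points of a
    boundary function. Taylor expansions come from the same Poisson integrals, once Cauchy's
    theorem, in the coordinate log z, has shown that the moments of f on circles scale with the
    radius. *)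

Section ComplexNumbers.
Variable R : realType.
Implicit Types (z w : R[i]) (x y : R).

(* The modulus as an element of [R]: the norm [`|z|] of MathComp lies in R[i]. *)
Definition cabs z : R := complex.Re `|z|.

Lemma cabsE z : `|z| = (cabs z)%:C.
Proof. by rewrite /cabs normc_def. Qed.

Lemma cabs_sqrt z : cabs z = Num.sqrt (complex.Re z ^+ 2 + complex.Im z ^+ 2).
Proof. by rewrite /cabs normc_def. Qed.

Lemma cabs_ge0 z : 0 <= cabs z.
Proof. by rewrite cabs_sqrt sqrtr_ge0. Qed.

Lemma cabs_sqr z : cabs z ^+ 2 = complex.Re z ^+ 2 + complex.Im z ^+ 2.
Proof. by rewrite cabs_sqrt sqr_sqrtr // addr_ge0 // sqr_ge0. Qed.

Lemma cabsM z w : cabs (z * w) = cabs z * cabs w.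
Proof. by apply: complexI; rewrite rmorphM -!cabsE normrM. Qed.

Lemma cabsD z w : cabs (z + w) <= cabs z + cabs w.
Proof. by rewrite -lecR rmorphD -!cabsE ler_normD. Qed.

Lemma cabsN z : cabs (- z) = cabs z.
Proof. by rewrite /cabs normrN. Qed.

Lemma cabsB z w : cabs (z - w) = cabs (w - z).
Proof. by rewrite -cabsN opprB. Qed.

Lemma cabs_real x : cabs x%:C = `|x|.
Proof. by rewrite cabs_sqrt /= expr0n addr0 sqrtr_sqr. Qed.

Lemma cabs0 : cabs 0 = 0.
Proof. by rewrite /cabs normr0. Qed.

Lemma cabs1 : cabs 1 = 1.
Proof. by rewrite /cabs normr1. Qed.

Lemma cabsX z n : cabs (z ^+ n) = cabs z ^+ n.
Proof. by elim: n => [|n IH]; rewrite ?expr0 ?cabs1 // !exprS cabsM IH. Qed.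

Lemma cabs_eq0 z : (cabs z == 0) = (z == 0).
Proof. by rewrite -(inj_eq (@complexI R)) -cabsE normr_eq0. Qed.

Lemma cabsV z : cabs z^-1 = (cabs z)^-1.
Proof. by apply: complexI; rewrite fmorphV -!cabsE normfV. Qed.

Lemma cabs_conj z : cabs (z^*)%C = cabs z.
Proof. by rewrite !cabs_sqrt; case: z => a b /=; rewrite sqrrN. Qed.

Lemma Re_le_cabs z : `|complex.Re z| <= cabs z.
Proof.
rewrite -(@ler_pXn2r _ 2) ?nnegrE ?cabs_ge0 // cabs_sqr real_normK ?num_real //.
by rewrite lerDl sqr_ge0.
Qed.

Lemma Im_le_cabs z : `|complex.Im z| <= cabs z.
Proof.
rewrite -(@ler_pXn2r _ 2) ?nnegrE ?cabs_ge0 // cabs_sqr real_normK ?num_real //.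
by rewrite lerDr sqr_ge0.
Qed.

Lemma cabs_le_ReIm z : cabs z <= `|complex.Re z| + `|complex.Im z|.
Proof.
rewrite -(@ler_pXn2r _ 2) ?nnegrE ?cabs_ge0 ?addr_ge0 // cabs_sqr sqrrD.
by rewrite !real_normK ?num_real // lerD2r lerDl mulrn_wge0 // mulr_ge0.
Qed.

Lemma cabs_sum (I : Type) (r : seq I) (P : pred I) (F : I -> R[i]) :
  cabs (\sum_(i <- r | P i) F i) <= \sum_(i <- r | P i) cabs (F i).
Proof.
elim/big_ind2 : _ => [|u a v b ua vb|//]; first by rewrite cabs0.
exact: le_trans (cabsD _ _) (lerD ua vb).
Qed.

Lemma discE z : disc z <-> cabs z < 1.
Proof. by rewrite /disc /= cabsE -[1]/(1%:C) ltcR. Qed.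

Lemma ReD z w : complex.Re (z + w) = complex.Re z + complex.Re w.
Proof. by case: z w => [a b] [c d]. Qed.

Lemma ImD z w : complex.Im (z + w) = complex.Im z + complex.Im w.
Proof. by case: z w => [a b] [c d]. Qed.

Lemma ReN z : complex.Re (- z) = - complex.Re z.
Proof. by case: z. Qed.

Lemma ImN z : complex.Im (- z) = - complex.Im z.
Proof. by case: z. Qed.

Lemma ReM z w : complex.Re (z * w) =
  complex.Re z * complex.Re w - complex.Im z * complex.Im w.
Proof. by case: z w => [a b] [c d]. Qed.

Lemma ImM z w : complex.Im (z * w) =
  complex.Re z * complex.Im w + complex.Im z * complex.Re w.
Proof. by case: z w => [a b] [c d]. Qed.

Lemma Re_conj z : complex.Re (z^*)%C = complex.Re z.
Proof. by case: z. Qed.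

Lemma Im_conj z : complex.Im (z^*)%C = - complex.Im z.
Proof. by case: z. Qed.

Lemma complex_ext z w :
  complex.Re z = complex.Re w -> complex.Im z = complex.Im w -> z = w.
Proof. by case: z w => [a b] [c d] /= -> ->. Qed.

Lemma mul_conj_cabs z : z * (z^*)%C = (cabs z ^+ 2)%:C.
Proof.
apply: complex_ext; rewrite ?ReM ?ImM Re_conj Im_conj /= ?cabs_sqr; ring.
Qed.

Lemma cisD x y : cis (x + y) = cis x * cis y.
Proof.
apply: complex_ext; rewrite ?ReM ?ImM /= ?cosD ?sinD; ring.
Qed.

Lemma cis0 : cis (0 : R) = 1.
Proof. by rewrite /cis cos0 sin0. Qed.

Lemma cabs_cis x : cabs (cis x) = 1.
Proof. by rewrite cabs_sqrt /= cos2Dsin2 sqrtr1. Qed.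

Lemma cisN x : cis (- x) = (cis x)^*%C.
Proof. by apply: complex_ext; rewrite ?Re_conj ?Im_conj /= ?cosN ?sinN. Qed.

Lemma cis_conj_mul x : cis x * (cis x)^*%C = 1.
Proof. by rewrite -cisN -cisD subrr cis0. Qed.

Lemma cis_exp n x : cis x ^+ n = cis (n%:R * x).
Proof.
elim: n => [|n IH]; first by rewrite mul0r cis0.
by rewrite exprS IH -cisD -natr1 mulrDl mul1r addrC.
Qed.

Lemma cis_2pi : cis (2 * pi : R) = 1.
Proof. by rewrite /cis mulr_natl cos2pi sin2pi. Qed.

End ComplexNumbers.

(** * Limits of complex functions in terms of the real modulus *)

Section ComplexLimits.
Variable R : realType.
Context {T : Type} {F : set_system T} {FF : ProperFilter F}.
Implicit Types (f g : T -> R[i]) (l : R[i]).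

Lemma ccvgP f l :
  (f @ F --> (l : R[i]^o)) <-> (forall e : R, 0 < e -> \forall t \near F, cabs (l - f t) < e).
Proof.
split=> [/(@cvgrPdist_lt _ (R[i]^o : normedModType R[i])) H e e0|H].
  have : 0 < e%:C by rewrite ltcR.
  by move=> /H; apply: filterS => t; rewrite cabsE ltcR.
apply/(@cvgrPdist_lt _ (R[i]^o : normedModType R[i])) => e; rewrite ltcE /= => /andP[/eqP ie e0].
(* The order of [R[i]] compares only numbers with equal imaginary parts, so a positive [e] is
   real. *)
have -> : e = (complex.Re e)%:C by apply: complex_ext.
by apply: filterS (H _ e0) => t; rewrite cabsE ltcR.
Qed.

Lemma ccvg_ReIm f l : (f @ F --> (l : R[i]^o)) <->
  ((complex.Re (f t) @[t --> F] --> complex.Re l) /\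
   (complex.Im (f t) @[t --> F] --> complex.Im l)).
Proof.
rewrite ccvgP; split=> [H|[/cvgrPdist_lt Hr /cvgrPdist_lt Hi] e e0].
  split; apply/cvgrPdist_lt => e e0; apply: filterS (H _ e0) => t.
    by apply: le_lt_trans; rewrite -ReN -ReD Re_le_cabs.
  by apply: le_lt_trans; rewrite -ImN -ImD Im_le_cabs.
have e2 : 0 < e / 2 by rewrite divr_gt0.
apply: filterS2 (Hr _ e2) (Hi _ e2) => t h1 h2.
apply: le_lt_trans (cabs_le_ReIm _) _.
rewrite ReD ReN ImD ImN; lra.
Qed.

Lemma ccvg_cabs f l : (f @ F --> (l : R[i]^o)) -> cabs (f t) @[t --> F] --> cabs l.
Proof.
move=> /ccvgP H; apply/cvgrPdist_lt => e e0; apply: filterS (H _ e0) => t.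
apply: le_lt_trans; rewrite ler_norml; apply/andP; split.
  have := cabsD (f t - l) l; rewrite subrK -cabsB; lra.
have := cabsD (l - f t) (f t); rewrite subrK; lra.
Qed.

Lemma ccvg_conj f l : (f @ F --> (l : R[i]^o)) ->
  (fun t => (f t)^*%C : R[i]^o) @ F --> ((l^*)%C : R[i]^o).
Proof.
move=> /ccvgP H; apply/ccvgP => e e0; apply: filterS (H _ e0) => t.
by rewrite -rmorphB /= cabs_conj.
Qed.

End ComplexLimits.

(** * Complex derivatives *)

Section ComplexDerivative.
Variable R : realType.
Implicit Types (f g : R[i] -> R[i]) (z d : R[i]).

(* The derivative with real moduli; equivalent to [derivable] over R[i]. *)
Definition cdiff f z d := forall e : R, 0 < e -> exists2 r : R, 0 < r &
  forall h, cabs h < r -> cabs (f (z + h) - f z - d * h) <= e * cabs h.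

Lemma cdiff_derivable f z d : cdiff f z d -> derivable (f : R[i]^o -> R[i]^o) z 1.
Proof.
move=> H; apply/cvg_ex; exists (d : R[i]^o); apply/ccvgP => e e0.
have e2 : 0 < e / 2 by rewrite divr_gt0.
have [r r0 hr] := H _ e2.
apply/nbhs_ballP; exists (r%:C); first by rewrite /= ltcR.
move=> h; rewrite /ball /= sub0r normrN cabsE ltcR => hh h0.
have ch : 0 < cabs h by rewrite lt_def cabs_eq0 h0 cabs_ge0.
have -> : d - h^-1 *: (f (h *: (1 : R[i]^o) + z) - f z) =
   - (h^-1 * (f (z + h) - f z - d * h)).
  rewrite /GRing.scale /= mulr1 (addrC h z); field; exact: h0.
rewrite cabsN cabsM cabsV mulrC ltr_pdivrMr //.
apply: le_lt_trans (hr _ hh) _; rewrite ltr_pM2r //; lra.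
Qed.

Lemma derivable_cdiff f z : derivable (f : R[i]^o -> R[i]^o) z 1 -> exists d, cdiff f z d.
Proof.
move=> /cvg_ex [/= d] /ccvgP H; exists d => e e0.
have /nbhs_ballP [r0 /= r00 hr] := H _ e0.
have rr : r0 = (complex.Re r0)%:C.
  by move: r00; rewrite ltcE => /andP[/eqP/= ir _]; apply: complex_ext.
exists (complex.Re r0) => [|h hh]; first by move: r00; rewrite rr ltcR.
have [->|h0] := eqVneq h 0; first by rewrite addr0 subrr mulr0 subr0 cabs0 mulr0.
have := hr h _ h0; rewrite /ball /= sub0r normrN cabsE rr ltcR => /(_ hh).
have ch : 0 < cabs h by rewrite lt_def cabs_eq0 h0 cabs_ge0.
have -> : d - h^-1 *: (f (h *: (1 : R[i]^o) + z) - f z) =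
   - (h^-1 * (f (z + h) - f z - d * h)).
  rewrite /GRing.scale /= mulr1 (addrC h z); field; exact: h0.
by rewrite cabsN cabsM cabsV mulrC ltr_pdivrMr // => /ltW.
Qed.

Lemma cdiff_cst (c : R[i]) z : cdiff (fun=> c) z 0.
Proof.
move=> e e0; exists 1 => // h _.
by rewrite subrr sub0r mul0r oppr0 cabs0 mulr_ge0 ?cabs_ge0 // ltW.
Qed.

Lemma cdiff_id z : cdiff id z 1.
Proof.
move=> e e0; exists 1 => // h _.
have -> : id (z + h) - id z - 1 * h = 0 by rewrite /=; ring.
by rewrite cabs0 mulr_ge0 ?cabs_ge0 // ltW.
Qed.

Lemma cdiff_lip f z d : cdiff f z d -> exists2 r : R, 0 < r &
  forall h, cabs h < r -> cabs (f (z + h) - f z) <= (cabs d + 1) * cabs h.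
Proof.
move=> /(_ _ ltr01) [r r0 hr]; exists r => // h /hr hh.
have := cabsD (f (z + h) - f z - d * h) (d * h); rewrite subrK cabsM; lra.
Qed.

Lemma cdiff_continuous f z d : cdiff f z d ->
  forall e : R, 0 < e -> exists2 r : R, 0 < r &
  forall w, cabs (w - z) < r -> cabs (f w - f z) < e.
Proof.
move=> /cdiff_lip [r r0 hr] e e0.
have d0 : 0 < cabs d + 1 by rewrite ltr_wpDl ?cabs_ge0.
exists (Num.min r (e / (cabs d + 1))); first by rewrite lt_min r0 divr_gt0.
move=> w; rewrite lt_min => /andP[/hr]; rewrite (addrC z) subrK => h1.
rewrite ltr_pdivlMr // => h2; apply: le_lt_trans h1 _; lra.
Qed.

Lemma cdiffD f g z d d' : cdiff f z d -> cdiff g z d' ->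
  cdiff (fun x => f x + g x) z (d + d').
Proof.
move=> H1 H2 e e0; have e2 : 0 < e / 2 by rewrite divr_gt0.
have [r1 r10 h1] := H1 _ e2; have [r2 r20 h2] := H2 _ e2.
exists (Num.min r1 r2); first by rewrite lt_min r10.
move=> h; rewrite lt_min => /andP[/h1 b1 /h2 b2].
have -> : f (z + h) + g (z + h) - (f z + g z) - (d + d') * h =
  (f (z + h) - f z - d * h) + (g (z + h) - g z - d' * h) by ring.
by apply: le_trans (cabsD _ _) _; lra.
Qed.

Lemma cdiffM f g z d d' : cdiff f z d -> cdiff g z d' ->
  cdiff (fun x => f x * g x) z (d * g z + f z * d').
Proof.
move=> H1 H2 e e0.
have [r3 r30 h3] := cdiff_lip H1; have [r4 r40 h4] := cdiff_lip H2.
(* Chosen so that the three error terms below add up to (e / K) |h| (K - 1). *)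
pose K := cabs (f z) + cabs (g z) + (cabs d + 1) * (cabs d' + 1) + 1.
have K0 : 0 < K.
  by rewrite /K ltr_wpDl // !addr_ge0 ?cabs_ge0 // mulr_ge0 // addr_ge0 ?cabs_ge0.
have e2 : 0 < e / K by rewrite divr_gt0.
have [r1 r10 h1] := H1 _ e2; have [r2 r20 h2] := H2 _ e2.
exists (Num.min (Num.min r1 r2) (Num.min (Num.min r3 r4) (e / K))).
  by rewrite !lt_min r10 r20 r30 r40.
move=> h; rewrite !lt_min => /andP[/andP[/h1 b1 /h2 b2] /andP[/andP[/h3 b3 /h4 b4] b5]].
have -> : f (z + h) * g (z + h) - f z * g z - (d * g z + f z * d') * h =
  (f (z + h) - f z) * (g (z + h) - g z) + g z * (f (z + h) - f z - d * h)
  + f z * (g (z + h) - g z - d' * h) by ring.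
have c0 := cabs_ge0 h.
apply: le_trans (cabsD _ _) _; apply: le_trans (lerD (cabsD _ _) (lexx _)) _.
rewrite !cabsM.
apply: (@le_trans _ _ ((cabs d + 1) * cabs h * ((cabs d' + 1) * (e / K))
   + cabs (g z) * (e / K * cabs h) + cabs (f z) * (e / K * cabs h))).
  apply: lerD; first apply: lerD.
  - apply: ler_pM; rewrite ?cabs_ge0 //; apply: le_trans b4 _.
    by rewrite ler_wpM2l ?addr_ge0 ?cabs_ge0 // ltW.
  - by rewrite ler_wpM2l ?cabs_ge0.
  - by rewrite ler_wpM2l ?cabs_ge0.
have -> : (cabs d + 1) * cabs h * ((cabs d' + 1) * (e / K))
   + cabs (g z) * (e / K * cabs h) + cabs (f z) * (e / K * cabs h) =
   (e / K * cabs h) * (K - 1) by rewrite /K; ring.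
apply: (@le_trans _ _ (e / K * cabs h * K)).
  by rewrite ler_wpM2l ?gerBl ?ler01 // (mulr_ge0 (ltW e2) c0).
by rewrite mulrAC divfK // gt_eqF.
Qed.

Lemma cdiff_comp f g z d d' : cdiff g z d' -> cdiff f (g z) d ->
  cdiff (fun x => f (g x)) z (d * d').
Proof.
move=> H2 H1 e e0.
have [r4 r40 h4] := cdiff_lip H2.
(* As for products, the two errors add up to (e / K) |h| (K - 1). *)
pose K := cabs d + cabs d' + 2.
have K0 : 0 < K by rewrite /K ltr_wpDl // !addr_ge0 ?cabs_ge0.
have e2 : 0 < e / K by rewrite divr_gt0.
have [r1 r10 h1] := H1 _ e2; have [r2 r20 h2] := H2 _ e2.
exists (Num.min r2 (Num.min r4 (r1 / K))); first by rewrite !lt_min r20 r40 divr_gt0.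
move=> h; rewrite !lt_min => /andP[/h2 b2 /andP[/h4 b4]]; rewrite ltr_pdivlMr // => b5.
have c0 := cabs_ge0 h; have cd := cabs_ge0 d; have cd' := cabs_ge0 d'.
have gs : cabs (g (z + h) - g z) < r1.
  apply: le_lt_trans b4 _; apply: le_lt_trans b5; rewrite mulrC ler_wpM2l // /K; lra.
have := h1 _ gs; rewrite (addrC (g z)) subrK => b1.
have -> : f (g (z + h)) - f (g z) - d * d' * h =
  (f (g (z + h)) - f (g z) - d * (g (z + h) - g z)) +
  d * (g (z + h) - g z - d' * h) by ring.
apply: le_trans (cabsD _ _) _; rewrite cabsM.
apply: (@le_trans _ _ (e / K * ((cabs d' + 1) * cabs h) + cabs d * (e / K * cabs h))).
  apply: lerD; last by rewrite ler_wpM2l.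
  by apply: le_trans b1 _; rewrite ler_wpM2l // ltW.
have -> : e / K * ((cabs d' + 1) * cabs h) + cabs d * (e / K * cabs h) =
  e / K * cabs h * (K - 1) by rewrite /K; ring.
apply: (@le_trans _ _ (e / K * cabs h * K)).
  by rewrite ler_wpM2l ?gerBl ?ler01 // (mulr_ge0 (ltW e2) c0).
by rewrite mulrAC divfK // gt_eqF.
Qed.

Lemma cdiff_ext (f g : R[i] -> R[i]) z d : (exists2 r : R, 0 < r &
   forall w, cabs (w - z) < r -> f w = g w) -> cdiff f z d -> cdiff g z d.
Proof.
move=> [r r0 fg] H e /H [s s0 hs]; exists (Num.min r s); first by rewrite lt_min r0.
move=> h; rewrite lt_min => /andP[hr /hs].
by rewrite !fg // ?subrr ?cabs0 // addrAC subrr add0r.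
Qed.

End ComplexDerivative.

(** * The complex exponential *)

Section ComplexExponential.
Variable R : realType.
Implicit Types (z w : R[i]) (x y : R).

Definition cexp z : R[i] := (expR (complex.Re z))%:C * cis (complex.Im z).

Lemma cexpD z w : cexp (z + w) = cexp z * cexp w.
Proof. rewrite /cexp ReD ImD expRD cisD rmorphM /=; ring. Qed.

Lemma cexp0 : cexp 0 = 1.
Proof. by rewrite /cexp /= expR0 cis0 mulr1. Qed.

Lemma cabs_cexp z : cabs (cexp z) = expR (complex.Re z).
Proof. by rewrite /cexp cabsM cabs_cis mulr1 cabs_real gtr0_norm ?expR_gt0. Qed.

Lemma cexp_neq0 z : cexp z != 0.
Proof. by rewrite -cabs_eq0 cabs_cexp gt_eqF ?expR_gt0. Qed.

Lemma real_derive_bound (f : R -> R) (d : R) : is_derive (0 : R) (1 : R) f d ->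
  forall e : R, 0 < e -> exists2 r : R, 0 < r &
  forall h, `|h| < r -> `|f h - f 0 - d * h| <= e * `|h|.
Proof.
move=> [/cvg_ex [/= d' dd'] D] e e0.
have d'E : d' = d by rewrite -D /derive; apply/esym; apply: cvg_lim.
rewrite {}d'E in dd'.
move/cvgrPdist_lt: dd' => /(_ _ e0) /nbhs_ballP [r /= r0 hr].
exists r => // h hh; have [->|h0] := eqVneq h 0.
  by rewrite subrr mulr0 subr0 normr0 mulr0.
have := hr h _ h0; rewrite /ball /= sub0r normrN => /(_ hh).
have ch : 0 < `|h| by rewrite normr_gt0.
have -> : d - h^-1 *: (f (h *: (1 : R) + 0) - f 0) = - (h^-1 * (f h - f 0 - d * h)).
  rewrite /GRing.scale /= mulr1 addr0; field; exact: h0.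
by rewrite normrN normrM normfV mulrC ltr_pdivrMr // => /ltW.
Qed.

Lemma cdiff_cexp0 : cdiff cexp 0 1.
Proof.
move=> e e0; have [s s0 [s6 s1]] : exists2 s : R, 0 < s & 6 * s <= e /\ s <= 1.
  exists (Num.min (e / 6) 1); first by rewrite lt_min divr_gt0 //=.
  have : Num.min (e / 6) 1 <= e / 6 by rewrite ge_min lexx.
  have : Num.min (e / 6) 1 <= 1 by rewrite ge_min lexx orbT.
  by split; lra.
have [r1 r10 h1] := @real_derive_bound expR (expR 0) (is_derive_expR 0) _ s0.
have [r2 r20 h2] := @real_derive_bound cos (- sin 0) (is_derive_cos 0) _ s0.
have [r3 r30 h3] := @real_derive_bound sin (cos 0) (is_derive_sin 0) _ s0.
exists (Num.min (Num.min r1 r2) (Num.min r3 s)).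
  by rewrite !lt_min r10 r20 r30 s0.
move=> h; rewrite !lt_min => /andP[/andP[c1 c2] /andP[c3 c4]].
have [x [y hE]] : exists x y, h = x +i* y by case: (h) => x y; exists x, y.
have xh : `|x| <= cabs h by have := Re_le_cabs h; rewrite hE.
have yh : `|y| <= cabs h by have := Im_le_cabs h; rewrite hE.
have := h1 _ (le_lt_trans xh c1); rewrite expR0 mul1r => b1.
have := h2 _ (le_lt_trans yh c2); rewrite sin0 cos0 oppr0 mul0r subr0 => b2.
have := h3 _ (le_lt_trans yh c3); rewrite sin0 cos0 mul1r subr0 => b3.
have c0 := cabs_ge0 h.
rewrite add0r cexp0 mul1r.
pose C := cis y - 1 - y *i.
have CE : cabs C <= 2 * s * cabs h.
  apply: le_trans (cabs_le_ReIm _) _; rewrite /C /= !(subr0, oppr0).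
  have : s * `|y| <= s * cabs h by rewrite ler_pM2l.
  lra.
(* With h = x + iy, the three summands cost s, 3s and 2s times |h|, which explains the requirement
   6s <= e. *)
have -> : cexp h - 1 - h = (expR x - 1 - x)%:C * cis y + x%:C * (C + y *i) + C.
  rewrite hE /cexp /C; apply: complex_ext; rewrite ?(ReD, ImD, ReN, ImN, ReM, ImM) /=; ring.
apply: le_trans (cabsD _ _) _; apply: le_trans (lerD (cabsD _ _) (lexx _)) _.
rewrite !cabsM cabs_cis mulr1 !cabs_real.
have y1 : cabs (y *i) = `|y|.
  by rewrite cabs_sqrt /= expr0n add0r sqrtr_sqr.
have C2 : cabs (C + y *i) <= 3 * cabs h.
  apply: le_trans (cabsD _ _) _; rewrite y1.
  have : s * cabs h <= cabs h by rewrite ler_piMl.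
  lra.
have x2 : `|x| * cabs (C + y *i) <= s * (3 * cabs h).
  apply: ler_pM; rewrite ?cabs_ge0 //; exact: le_trans xh (ltW c4).
have x3 : s * `|x| <= s * cabs h by rewrite ler_pM2l.
have : 6 * s * cabs h <= e * cabs h by rewrite ler_wpM2r.
lra.
Qed.

Lemma cdiff_cexp z : cdiff cexp z (cexp z).
Proof.
have H : cdiff (fun w => cexp z * cexp (w + (- z))) z (0 * cexp (z + (- z)) + cexp z * (1 * (1 + 0))).
  apply: (@cdiffM _ (fun=> cexp z)); first exact: cdiff_cst.
  apply: (@cdiff_comp _ cexp (fun w => w + (- z))).
    by apply: (@cdiffD _ id (fun=> - z)); [exact: cdiff_id|exact: cdiff_cst].
  by rewrite subrr; exact: cdiff_cexp0.
move: H; rewrite mul0r add0r addr0 !mulr1; apply: cdiff_ext.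
by exists 1 => // w _; rewrite -cexpD addrC subrK.
Qed.

End ComplexExponential.

(** * Complex series and power series in the disc *)

Section ComplexSeries.
Variable R : realType.
Implicit Types (u c : nat -> R[i]) (z w : R[i]) (x K : R).

Definition csum u : R[i] :=
  limn (series (fun k => complex.Re (u k))) +i*
  limn (series (fun k => complex.Im (u k))).

Definition psum u n : R[i] := \sum_(k < n) u k.

Lemma psumS u n : psum u n.+1 = psum u n + u n.
Proof. by rewrite /psum big_ord_recr. Qed.

Lemma Re_psum u n : complex.Re (psum u n) = series (fun k => complex.Re (u k)) n.
Proof.
rewrite /series /= big_mkord /psum.
by elim: n => [|n IH]; rewrite ?big_ord0 // !big_ord_recr ReD IH.
Qed.

Lemma Im_psum u n : complex.Im (psum u n) = series (fun k => complex.Im (u k)) n.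
Proof.
rewrite /series /= big_mkord /psum.
by elim: n => [|n IH]; rewrite ?big_ord0 // !big_ord_recr ImD IH.
Qed.

Lemma csum_cvg u : cvgn (series (fun k => cabs (u k))) ->
  (psum u n : R[i]^o) @[n --> \oo] --> (csum u : R[i]^o).
Proof.
move=> H; apply/ccvg_ReIm; split.
  under eq_fun do rewrite Re_psum.
  apply: (@normed_cvg _ R^o); apply: series_le_cvg H => n.
  - exact: normr_ge0.
  - exact: cabs_ge0.
  - exact: Re_le_cabs.
under eq_fun do rewrite Im_psum.
apply: (@normed_cvg _ R^o); apply: series_le_cvg H => n.
- exact: normr_ge0.
- exact: cabs_ge0.
- exact: Im_le_cabs.
Qed.

Lemma csum_unique u (l : R[i]) :
  (psum u n : R[i]^o) @[n --> \oo] --> (l : R[i]^o) -> csum u = l.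
Proof.
move=> /ccvg_ReIm [hr hi]; apply: complex_ext => /=.
  by rewrite -(funext (Re_psum u)); apply: cvg_lim.
by rewrite -(funext (Im_psum u)); apply: cvg_lim.
Qed.

Lemma ccvg_bound (v : nat -> R[i]) (l a : R[i]) (n0 : nat) (B : R) :
  (v n : R[i]^o) @[n --> \oo] --> (l : R[i]^o) ->
  (forall n, (n0 <= n)%N -> cabs (v n - a) <= B) -> cabs (l - a) <= B.
Proof.
move=> /ccvgP vl H; apply/ler_addgt0Pr => e e0.
have [N _ hN] := vl _ e0.
have h1 := hN (maxn N n0) (leq_maxl _ _); have h2 := H _ (leq_maxr N n0).
have := cabsD (l - v (maxn N n0)) (v (maxn N n0) - a); rewrite addrA subrK.
move: h1 => /= h1; lra.
Qed.

Lemma psum_diff u n m : (n <= m)%N ->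
  cabs (psum u m - psum u n) <= \sum_(n <= k < m) cabs (u k).
Proof.
elim: m => [|m IH] nm.
  by move: nm; rewrite leqn0 => /eqP ->; rewrite subrr cabs0 big_geq.
move: nm; rewrite leq_eqVlt => /orP[/eqP <-|]; first by rewrite subrr cabs0 big_geq.
rewrite ltnS => nm; rewrite psumS big_nat_recr //= addrAC.
exact: le_trans (cabsD _ _) (lerD (IH nm) (lexx _)).
Qed.

Lemma bernoulli (y : R) n : 0 <= y -> y <= 1 -> 1 - n%:R * (1 - y) <= y ^+ n.
Proof.
move=> y0 y1; elim: n => [|n IH]; first by rewrite mul0r subr0 expr0.
have := ler_wpM2l y0 IH; rewrite -exprS; apply: le_trans.
have : 0 <= n%:R * (1 - y) ^+ 2 by rewrite mulr_ge0 // sqr_ge0.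
rewrite -natr1; lra.
Qed.

Lemma geo_sum_le (x : R) n m : 0 <= x -> x < 1 ->
  \sum_(n <= k < m) x ^+ k <= x ^+ n / (1 - x).
Proof.
move=> x0 x1; have y0 : 0 < 1 - x by lra.
rewrite ler_pdivlMr //; have [mn|nm] := leqP m n.
  by rewrite big_geq // mul0r exprn_ge0.
apply: (@le_trans _ _ (x ^+ n - x ^+ m)); last by rewrite gerBl exprn_ge0.
rewrite le_eqVlt; apply/orP; left; apply/eqP.
elim: m nm => // m IH; rewrite ltnS leq_eqVlt => /orP[/eqP <-|nm].
  by rewrite big_nat1 exprS; ring.
by rewrite big_nat_recr ?(ltnW nm) //= mulrDl IH // exprS; ring.
Qed.

(** The convergence criterion for power series in the disc. Unlike plain summability it comes with
    explicit tails, see [geo_tail]. *)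
Definition geo_dominated u K x := [/\ 0 <= x, x < 1 & forall k, cabs (u k) <= K * x ^+ k].

Lemma geo_dominated_ge0 u K x : geo_dominated u K x -> 0 <= K.
Proof. by case=> _ _ /(_ 0%N); rewrite expr0 mulr1; apply: le_trans; exact: cabs_ge0. Qed.

Lemma geo_cvg u K x : geo_dominated u K x ->
  (psum u n : R[i]^o) @[n --> \oo] --> (csum u : R[i]^o).
Proof.
move=> [x0 x1 H]; apply: csum_cvg; apply: series_le_cvg (_ : cvgn (series (geometric K x))).
- by move=> n; exact: cabs_ge0.
- by move=> n; apply: le_trans (H n); exact: cabs_ge0.
- exact: H.
- by apply: is_cvg_geometric_series; rewrite ger0_norm.
Qed.

Lemma geo_tail u K x n : geo_dominated u K x ->
  cabs (csum u - psum u n) <= K * (x ^+ n / (1 - x)).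
Proof.
move=> uKx; have K0 := geo_dominated_ge0 uKx; have := geo_cvg uKx.
case: uKx => x0 x1 H cv; apply: (@ccvg_bound _ _ _ n _ cv) => m nm.
apply: le_trans (psum_diff _ nm) _.
apply: (@le_trans _ _ (\sum_(n <= k < m) K * x ^+ k)).
  by apply: ler_sum_nat => k _; exact: H.
by rewrite -mulr_sumr ler_wpM2l // geo_sum_le.
Qed.

Lemma geo_csum_le u K x : geo_dominated u K x -> cabs (csum u) <= K / (1 - x).
Proof.
by move=> /(geo_tail 0); rewrite /psum big_ord0 subr0 expr0 mul1r.
Qed.

Definition pser c z := csum (fun k => c k * z ^+ k).

Definition cbounded c K := forall n, cabs (c n) <= K.

Lemma pser_geo c K z : cbounded c K -> cabs z < 1 ->
  geo_dominated (fun k => c k * z ^+ k) K (cabs z).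
Proof.
move=> cK z1; split=> // [|k]; first exact: cabs_ge0.
by rewrite cabsM cabsX ler_wpM2r // exprn_ge0 // cabs_ge0.
Qed.

Lemma geo_small K (x : R) : 0 <= x -> x < 1 -> 0 <= K ->
  forall e : R, 0 < e -> exists N : nat, forall n, (N <= n)%N -> K * x ^+ n < e.
Proof.
move=> x0 x1 K0 e e0; have hx : `|x| < 1 by rewrite ger0_norm.
have /cvgrPdist_lt H := cvg_expr hx.
have e1 : 0 < e / (K + 1) by rewrite divr_gt0 // ltr_wpDl.
have [N _ hN] := H _ e1; exists N => n Nn; have := hN _ Nn => /=.
rewrite sub0r normrN ger0_norm ?exprn_ge0 // ltr_pdivlMr ?ltr_wpDl // => h.
by apply: le_lt_trans h; rewrite mulrC ler_wpM2l ?exprn_ge0 // lerDl.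
Qed.

(* The quotient [(pser c w - pser c z) / (w - z)] is again a power series in w
   with bounded coefficients, so differentiability needs no bound on [n c_n]. *)
Definition quot_coef c z j := csum (fun m => c (j.+1 + m)%N * z ^+ m).

Lemma quot_bounded c K z : cbounded c K -> cabs z < 1 ->
  cbounded (quot_coef c z) (K / (1 - cabs z)).
Proof.
move=> cK z1 j; apply: geo_csum_le.
by apply: (@pser_geo (fun m => c (j.+1 + m)%N)) => // m.
Qed.

Lemma csum_recl u K x : geo_dominated u K x -> csum u = u 0%N + csum (fun k => u k.+1).
Proof.
move=> uKx; apply: csum_unique; have [x0 x1 H] := uKx.
have uS : geo_dominated (fun k => u k.+1) (K * x) x.
  by split=> // k; rewrite -mulrA -exprS.
have := geo_cvg uS => /ccvgP h; apply/ccvgP => e /h [N _ hN].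
exists N.+1 => //= -[//|n]; rewrite /= ltnS => /hN /=.
by rewrite /psum big_ord_recl opprD addrACA subrr add0r.
Qed.

Lemma quot_rec c K z j : cbounded c K -> cabs z < 1 ->
  quot_coef c z j = c j.+1 + z * quot_coef c z j.+1.
Proof.
move=> cK z1.
have cj i : geo_dominated (fun m => c (i.+1 + m)%N * z ^+ m) K (cabs z).
  by apply: (@pser_geo (fun m => c (i.+1 + m)%N)) => // m.
rewrite {1}/quot_coef (csum_recl (cj j)) addn0 expr0 mulr1; congr (_ + _).
apply: csum_unique; apply/ccvgP => e e0.
have /ccvgP h := geo_cvg (cj j.+1).
have [N _ hN] := h _ e0; exists N => // n /hN /=.
have -> : psum (fun k => c (j.+1 + k.+1)%N * z ^+ k.+1) n =
   z * psum (fun m => c (j.+2 + m)%N * z ^+ m) n.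
  by rewrite /psum mulr_sumr; apply: eq_bigr => k _; rewrite addnS exprS; ring.
rewrite -mulrBr cabsM; apply: le_lt_trans.
by rewrite ler_piMl ?cabs_ge0 // ltW.
Qed.

Lemma pser_quot c K z w : cbounded c K -> cabs z < 1 -> cabs w < 1 ->
  pser c w = pser c z + (w - z) * pser (quot_coef c z) w.
Proof.
move=> cK z1 w1.
have K0 : 0 <= K by apply: le_trans (cK 0%N); exact: cabs_ge0.
pose b := quot_coef c z.
have cz : pser c z = c 0%N + z * b 0%N.
  rewrite /pser (csum_recl (pser_geo cK z1)) expr0 mulr1; congr (_ + _).
  apply: csum_unique; apply/ccvgP => e e0.
  have := geo_cvg (@pser_geo (fun m => c (1 + m)%N) K z (fun m => cK _) z1).
  move=> /ccvgP /(_ _ e0) [N _ hN]; exists N => // n /hN /=.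
  have -> : psum (fun k => c k.+1 * z ^+ k.+1) n = z * psum (fun m => c (1 + m)%N * z ^+ m) n.
    by rewrite /psum mulr_sumr; apply: eq_bigr => k _; rewrite add1n exprS; ring.
  rewrite -mulrBr cabsM; apply: le_lt_trans.
  by rewrite ler_piMl ?cabs_ge0 // ltW.
have bK := quot_bounded cK z1.
(* The identity is exact at every order; its last term tends to 0 because the coefficients [b] are
   bounded. *)
have fin n : psum (fun k => c k * w ^+ k) n.+1 = pser c z +
    (w - z) * psum (fun k => b k * w ^+ k) n - z * b n * w ^+ n.
  elim: n => [|n IH]; first by rewrite /psum big_ord_recr !big_ord0 cz expr0 /=; ring.
  rewrite psumS IH psumS exprS.
  have -> : b n = c n.+1 + z * b n.+1 by exact: quot_rec cK z1.
  ring.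
apply: csum_unique; apply/ccvgP => e e0.
have e2 : 0 < e / 4 by rewrite divr_gt0.
have := geo_cvg (pser_geo bK w1) => /ccvgP /(_ _ e2) [N1 _ h1].
have [N2 h2] := geo_small (cabs_ge0 w) w1 (le_trans (cabs_ge0 _) (bK 0%N)) e2.
exists (maxn N1 N2).+1 => // -[//|n]; rewrite /= ltnS geq_max => /andP[/h1 /= b1 /h2 b2].
rewrite fin.
have -> : pser c z + (w - z) * pser b w - (pser c z + (w - z) * psum (fun k => b k * w ^+ k) n - z * b n * w ^+ n)
  = (w - z) * (pser b w - psum (fun k => b k * w ^+ k) n) + z * b n * w ^+ n by ring.
apply: le_lt_trans (cabsD _ _) _; rewrite !cabsM cabsX.
have wz : cabs (w - z) <= 2 by apply: le_trans (cabsD _ _) _; rewrite cabsN; lra.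
have t1 : cabs (w - z) * cabs (pser b w - psum (fun k => b k * w ^+ k) n) <= 2 * (e / 4).
  by apply: ler_pM; rewrite ?cabs_ge0 // ltW.
have t2 : cabs z * cabs (b n) * cabs w ^+ n <= e / 4.
  apply: le_trans (ltW b2); rewrite ler_wpM2r ?exprn_ge0 ?cabs_ge0 //.
  apply: le_trans (bK n); rewrite ler_piMl ?cabs_ge0 // ltW //.
lra.
Qed.

(** Dividing twice by the increment gives an expansion to second order, whose error is h^2 times the
    second quotient. The latter is at most [B] on the disc of radius [x], halfway between |z| and
    1. *)
Lemma pser_cdiff c K z : cbounded c K -> cabs z < 1 ->
  cdiff (pser c) z (pser (quot_coef c z) z).
Proof.
move=> cK z1 e e0; set b := quot_coef c z.
have bK := quot_bounded cK z1.
pose x := (1 + cabs z) / 2.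
have z0 := cabs_ge0 z.
have x1 : x < 1 by rewrite /x; lra.
pose B := K / (1 - cabs z) / (1 - cabs z) / (1 - x).
have K0 : 0 <= K by apply: le_trans (cK 0%N); exact: cabs_ge0.
have B0 : 0 <= B by rewrite /B !divr_ge0 // subr_ge0 ltW.
have B1 : 0 < B + 1 by lra.
exists (Num.min (x - cabs z) (e / (B + 1))).
  by rewrite lt_min divr_gt0 // andbT /x; lra.
move=> h; rewrite lt_min ltr_pdivlMr // => /andP[h1 h2].
have wx : cabs (z + h) <= x by apply: le_trans (cabsD _ _) _; lra.
have w1 : cabs (z + h) < 1 by exact: le_lt_trans wx x1.
have zh : z + h - z = h by rewrite addrC addKr.
rewrite (pser_quot cK z1 w1) (pser_quot bK z1 w1) zh.
have -> : pser c z + h * (pser b z + h * pser (quot_coef b z) (z + h)) -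
   pser c z - pser b z * h = h * (h * pser (quot_coef b z) (z + h)) by ring.
rewrite 2!cabsM mulrC ler_wpM2r ?cabs_ge0 //.
apply: (@le_trans _ _ (cabs h * (B + 1))); last exact: ltW.
rewrite ler_wpM2l ?cabs_ge0 //; apply: (@le_trans _ _ B); last by lra.
apply: le_trans (geo_csum_le (pser_geo (quot_bounded bK z1) w1)) _.
rewrite /B ler_wpM2l ?divr_ge0 // ?subr_ge0 ?(ltW z1) //.
by rewrite lef_pV2 ?posrE; lra.
Qed.

End ComplexSeries.

(** * Integration over the circle *)

Section NullSets.
Context d (T : measurableType d) (R : realType).
Variable mu : {measure set T -> \bar R}.
Local Open Scope ereal_scope.
Import HBNNSimple.

(* No measurability of [f]: the radial boundary function of an H^2 function is
   only known to agree almost everywhere with a measurable function. *)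
Lemma ge0_integral_off_null (D N : set T) (f : T -> \bar R) :
  measurable N -> mu N = 0 -> (forall x, D x -> 0 <= f x) ->
  \int[mu]_(x in D) f x = \int[mu]_(x in D `\` N) f x.
Proof.
move=> mN N0 f0; apply/eqP; rewrite eq_le; apply/andP; split.
  rewrite ge0_integralE // [leRHS]ge0_integralE; last by move=> x [/f0].
  apply: ge_ereal_sup => _ [h /= hf <-]; apply: ereal_sup_ubound => /=.
  have mNc : measurable (~` N) by exact: measurableC.
  exists (proj_nnsfun h mNc) => [x|].
    rewrite -mrestrict; have := hf x; rewrite /patch in_setC in_setD.
    by case: (x \in N); rewrite /= ?andbF ?andbT.
  rewrite -(integralT_nnsfun mu h) (@ge0_negligible_integral _ _ _ mu setT N) //.
  - by rewrite setTD integral_nnsfun // -mrestrict.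
  - by apply/measurable_EFinP; exact: measurable_funTS.
  - by move=> x _; rewrite lee_fin fun_ge0.
rewrite ge0_integralE; last by move=> x [/f0].
rewrite [leRHS]ge0_integralE //.
apply: ge_ereal_sup => _ [h /= hf <-]; apply: ereal_sup_ubound => /=.
exists h => // x; apply: le_trans (hf x) _; rewrite /patch in_setD.
case: ifPn => [/andP[xD _]|_]; first by rewrite xD.
by case: ifPn => // /set_mem /f0.
Qed.

(** Positive and negative parts are compared separately, each after removal of the null set. *)
Lemma integral_ae_any (D : set T) (f g : T -> \bar R) :
  {ae mu, forall x, D x -> f x = g x} ->
  \int[mu]_(x in D) f x = \int[mu]_(x in D) g x.
Proof.
move=> [N [mN N0 sub]].
have fg x : (D `\` N) x -> f x = g x.
  move=> [Dx Nx]; apply: contrapT => fgx; apply: Nx; apply: sub => /=.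
  by move=> /(_ Dx).
rewrite integralE [RHS]integralE; congr (_ - _).
  rewrite (ge0_integral_off_null mN) // [RHS](ge0_integral_off_null mN) //.
  by apply: eq_integral => x /set_mem /fg; rewrite !funeposE => ->.
rewrite (ge0_integral_off_null mN) // [RHS](ge0_integral_off_null mN) //.
by apply: eq_integral => x /set_mem /fg; rewrite !funenegE => ->.
Qed.

End NullSets.

(** * Means of real functions over a period *)

Section CircleAverage.
Variable R : realType.
Implicit Types (v w g : R -> R) (k M : R).

Local Notation mu := (@lebesgue_measure R).

Definition period : set (measurableTypeR R) := `[0, 2 * pi]%classic.
Local Notation D := period.

Definition cavg v : R := (2 * pi)^-1 * \int[mu]_(t in D) v t.

Definition rint v := mu.-integrable D (EFin \o v).

Definition aeD (P : R -> Prop) := {ae mu, forall t, D t -> P t}.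

Lemma twopi_gt0 : 0 < 2 * pi :> R.
Proof. by rewrite mulr_gt0 // pi_gt0. Qed.

Lemma mD : measurable D.
Proof. exact: measurable_itv. Qed.

Lemma muD : mu D = (2 * pi)%:E.
Proof. by rewrite /D lebesgue_measure_itv /= lte_fin twopi_gt0 oppr0 adde0. Qed.

#[global] Instance ae_lebesgue_filter : Filter (almost_everywhere mu).
Proof. exact: (ae_filter_ringOfSetsType mu). Qed.

Lemma aeD_and (P Q : R -> Prop) : aeD P -> aeD Q -> aeD (fun t => P t /\ Q t).
Proof. by rewrite /aeD => H1 H2; apply: filterS2 H1 H2 => t h1 h2 Dt; split; auto. Qed.

Lemma aeD_all (P : R -> Prop) : (forall t, D t -> P t) -> aeD P.
Proof. by rewrite /aeD => H; apply: nearW => t; exact: H. Qed.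

Lemma aeD_mono (P Q : R -> Prop) : (forall t, D t -> P t -> Q t) -> aeD P -> aeD Q.
Proof. by rewrite /aeD => H H1; apply: filterS H1 => t h1 Dt; apply: H => //; exact: h1. Qed.

Lemma rint_meas v : rint v -> measurable_fun D v.
Proof. by move=> /measurable_int /measurable_EFinP. Qed.

Lemma rint_bounded v M : measurable_fun D v -> (forall t, D t -> `|v t| <= M) -> rint v.
Proof.
move=> mv vM; apply: measurable_bounded_integrable => //; first exact: mD.
  by rewrite [X in (X < _)%E](_ : _ = (2 * pi)%:E) ?ltry // -muD.
exists M; split => [|x Mx t Dt]; first exact: num_real.
exact: le_trans (vM t Dt) (ltW Mx).
Qed.

Lemma rint_le v w : measurable_fun D v -> rint w ->
  (forall t, D t -> `|v t| <= w t) -> rint v.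
Proof.
move=> mv iw vw; apply: le_integrable iw => //; first exact: mD.
  by apply/measurable_EFinP.
move=> t Dt /=; rewrite lee_fin; apply: le_trans (vw t Dt) _; exact: ler_norm.
Qed.

Lemma rint_cst k : rint (fun=> k).
Proof. by apply: (@rint_bounded _ `|k|). Qed.

Lemma rintD v w : rint v -> rint w -> rint (fun t => v t + w t).
Proof.
move=> iv iw; have := integrableD mD iv iw; apply: eq_integrable; first exact: mD.
by move=> t _ /=; rewrite EFinD.
Qed.

Lemma rintZ k v : rint v -> rint (fun t => k * v t).
Proof.
move=> iv; have := integrableZl mD k iv; apply: eq_integrable; first exact: mD.
by move=> t _ /=; rewrite EFinM.
Qed.

Lemma rintN v : rint v -> rint (fun t => - v t).
Proof.
move=> iv; have := integrableN iv; apply: eq_integrable; first exact: mD.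
by move=> t _ /=; rewrite EFinN.
Qed.

Lemma rintB v w : rint v -> rint w -> rint (fun t => v t - w t).
Proof. by move=> iv iw; apply: rintD iv _; exact: rintN. Qed.

Lemma rint_abs v : rint v -> rint (fun t => `|v t|).
Proof. by move=> iv; exact: integrable_norm. Qed.

Lemma cavg_eq v w : (forall t, D t -> v t = w t) -> cavg v = cavg w.
Proof.
by move=> vw; congr (_ * _); apply: eq_Rintegral => t /set_mem; exact: vw.
Qed.

Lemma cavg_ae v w : aeD (fun t => v t = w t) -> cavg v = cavg w.
Proof.
rewrite /aeD => vw; congr (_ * fine _); apply: integral_ae_any.
by apply: filterS vw => t h Dt; rewrite h.
Qed.

Lemma cavgD v w : rint v -> rint w -> cavg (fun t => v t + w t) = cavg v + cavg w.
Proof. by move=> iv iw; rewrite /cavg RintegralD ?mulrDr //; exact: mD. Qed.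

Lemma cavgZ k v : rint v -> cavg (fun t => k * v t) = k * cavg v.
Proof. by move=> iv; rewrite /cavg (RintegralZl k mD iv) mulrCA. Qed.

Lemma cavgN v : rint v -> cavg (fun t => - v t) = - cavg v.
Proof.
move=> iv; rewrite -mulN1r -cavgZ //; apply: cavg_eq => t _; by rewrite mulN1r.
Qed.

Lemma cavgB v w : rint v -> rint w -> cavg (fun t => v t - w t) = cavg v - cavg w.
Proof. by move=> iv iw; rewrite -cavgN // -cavgD //; exact: rintN. Qed.

Lemma cavg_cst k : cavg (fun=> k) = k.
Proof.
rewrite /cavg Rintegral_cst; last exact: mD.
have -> : fine (mu D) = 2 * pi by rewrite [X in fine X]muD.
by rewrite mulrCA mulVf ?mulr1 // gt_eqF // twopi_gt0.
Qed.

Lemma cavg_le v w : rint v -> rint w -> (forall t, D t -> v t <= w t) -> cavg v <= cavg w.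
Proof.
move=> iv iw vw; rewrite /cavg ler_wpM2l ?invr_ge0 ?(ltW twopi_gt0) //.
by apply: le_Rintegral => //; exact: mD.
Qed.

Lemma cavg_ge0 v : (forall t, D t -> 0 <= v t) -> 0 <= cavg v.
Proof.
move=> v0; rewrite /cavg mulr_ge0 ?invr_ge0 ?(ltW twopi_gt0) //.
exact: Rintegral_ge0.
Qed.

(** Replacing [w] by its maximum with [v] leaves its mean unchanged and makes the inequality hold
    everywhere. *)
Lemma cavg_le_ae v w : rint v -> rint w -> aeD (fun t => v t <= w t) -> cavg v <= cavg w.
Proof.
move=> iv iw vw.
have iM : rint (fun t => Num.max (v t) (w t)).
  apply: (@rint_le _ (fun t => `|v t| + `|w t|)).
  - by apply: measurable_maxr; exact: rint_meas.
  - by apply: rintD; exact: rint_abs.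
  - by move=> t _; rewrite maxEle; case: ifP => _; rewrite ?lerDl ?lerDr.
have -> : cavg w = cavg (fun t => Num.max (v t) (w t)).
  by apply: cavg_ae; apply: aeD_mono vw => t _ /max_idPr.
by apply: cavg_le => // t _; rewrite le_max lexx.
Qed.

Lemma cavg_norm_le v : rint v -> `|cavg v| <= cavg (fun t => `|v t|).
Proof.
move=> iv; rewrite /cavg normrM gtr0_norm ?invr_gt0 ?twopi_gt0 //.
rewrite ler_wpM2l ?invr_ge0 ?(ltW twopi_gt0) //.
by apply: le_normr_Rintegral => //; exact: mD.
Qed.

Lemma cavgE_ereal v : rint v ->
  (((2 * pi)^-1)%:E * \int[mu]_(t in D) (v t)%:E)%E = (cavg v)%:E.
Proof.
move=> iv; rewrite /cavg /Rintegral EFinM fineK //.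
by apply: integrable_fin_num => //; exact: mD.
Qed.

Lemma cavg_dct (f : nat -> R -> R) v g : (forall n, measurable_fun D (f n)) ->
  measurable_fun D v -> aeD (fun t => f n t @[n --> \oo] --> v t) -> rint g ->
  aeD (fun t => forall n, `|f n t| <= g t) ->
  rint v /\ (cavg (f n) @[n --> \oo] --> cavg v).
Proof.
rewrite /aeD => mf mv fv ig fg.
have [] := @dominated_convergence _ _ R mu D mD (fun n => EFin \o f n) (EFin \o v) (EFin \o g).
- by move=> n; apply/measurable_EFinP.
- by apply/measurable_EFinP.
- by apply: filterS fv => t h Dt; apply: cvg_EFin; [exact: nearW|exact: h].
- exact: ig.
- by apply: filterS fg => t h n Dt; rewrite /= lee_fin; exact: h.
move=> iv _ cv; split => //.
apply: cvgMr; apply: fine_cvg; move: cv.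
by rewrite /Rintegral fineK //; apply: integrable_fin_num => //; exact: mD.
Qed.

Lemma cavg_fatou (f : nat -> R -> R) v (C : R) : (forall n, rint (f n)) ->
  (forall n t, D t -> 0 <= f n t) -> measurable_fun D v -> (forall t, D t -> 0 <= v t) ->
  aeD (fun t => f n t @[n --> \oo] --> v t) -> (forall n, cavg (f n) <= C) ->
  rint v /\ cavg v <= C.
Proof.
rewrite /aeD => fi f0 mv v0 fv fC.
have p0 := twopi_gt0.
have step : (\int[mu]_(t in D) (v t)%:E <= ((2 * pi) * C)%:E)%E.
  have := @fatou _ _ R mu D mD (fun n => EFin \o f n).
  move=> /(_ (fun n => measurable_int _ (fi n))) /(_ (fun n t Dt => f0 n t Dt)).
  rewrite (@integral_ae_any _ _ _ mu D _ (EFin \o v)); last first.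
    apply: filterS fv => t h Dt.
    have hc : EFin (f n t) @[n --> \oo] --> EFin (v t).
      by apply: cvg_EFin; [exact: nearW|exact: h].
    exact: (cvg_limn_einf_sup hc).1.
  move=> /le_trans; apply.
  rewrite limn_einf_lim; apply: lime_le.
    exact: is_cvg_einfs.
  apply: nearW => n; apply: le_trans (ereal_inf_lbound _) _.
    by exists n => //=.
  have := cavgE_ereal (fi n); have := fC n; rewrite -lee_fin => h1 h2.
  by rewrite EFinM -lee_pdivrMl // h2.
have iv : rint v.
  apply/integrableP; split; first by apply/measurable_EFinP.
  apply: le_lt_trans (ltry (2 * pi * C)); apply: le_trans step.
  rewrite le_eqVlt; apply/orP; left; apply/eqP.
  by apply: eq_integral => t /set_mem Dt /=; rewrite ger0_norm // v0.
split => //; rewrite -lee_fin -cavgE_ereal //.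
by rewrite lee_pdivrMl // -EFinM.
Qed.

Lemma measurable_continuous v : continuous v -> measurable_fun D v.
Proof. by move=> cv; apply: measurable_funTS; exact: continuous_measurable_fun. Qed.

Lemma rint_continuous v : continuous v -> rint v.
Proof.
move=> cv; apply: continuous_compact_integrable; first exact: segment_compact.
by apply: continuous_subspaceT.
Qed.

End CircleAverage.

(** * Means of complex functions and orthogonality of the characters *)

Section CircleIntegral.
Variable R : realType.
Implicit Types (u w : R -> R[i]) (c z : R[i]) (v g : R -> R).

Local Notation mu := (@lebesgue_measure R).
Local Notation D := (@period R).

Definition cmeas u := measurable_fun D (fun t => complex.Re (u t)) /\
  measurable_fun D (fun t => complex.Im (u t)).

Definition cint u := rint (fun t => complex.Re (u t)) /\ rint (fun t => complex.Im (u t)).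

Lemma circle_intE u : circle_int u =
  cavg (fun t => complex.Re (u t)) +i* cavg (fun t => complex.Im (u t)).
Proof. by []. Qed.

Lemma cint_meas u : cint u -> cmeas u.
Proof. by case=> h1 h2; split; exact: rint_meas. Qed.

Lemma cmeas_cst c : cmeas (fun=> c).
Proof. by split; exact: measurable_cst. Qed.

Lemma cmeasD u w : cmeas u -> cmeas w -> cmeas (fun t => u t + w t).
Proof.
move=> [u1 u2] [w1 w2]; split.
  by under eq_fun do rewrite ReD; exact: measurable_funD.
by under eq_fun do rewrite ImD; exact: measurable_funD.
Qed.

Lemma cmeasM u w : cmeas u -> cmeas w -> cmeas (fun t => u t * w t).
Proof.
move=> [u1 u2] [w1 w2]; split.
  by under eq_fun do rewrite ReM; apply: measurable_funB; exact: measurable_funM.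
by under eq_fun do rewrite ImM; apply: measurable_funD; exact: measurable_funM.
Qed.

Lemma cmeas_conj u : cmeas u -> cmeas (fun t => (u t)^*%C).
Proof.
move=> [u1 u2]; split; first by under eq_fun do rewrite Re_conj.
under eq_fun do rewrite Im_conj.
by rewrite (_ : (fun t => - _) = -%R \o (fun t => complex.Im (u t))) //; apply: measurableT_comp.
Qed.

Lemma cmeas_real v : measurable_fun D v -> cmeas (fun t => (v t)%:C).
Proof. by move=> mv; split => //; exact: measurable_cst. Qed.

Lemma cmeas_cabs2 u : cmeas u -> measurable_fun D (fun t => cabs (u t) ^+ 2).
Proof.
move=> [u1 u2]; under eq_fun do rewrite cabs_sqr.
by apply: measurable_funD; exact: measurable_funX.
Qed.

Lemma cmeas_cabs u : cmeas u -> measurable_fun D (fun t => cabs (u t)).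
Proof.
move=> [u1 u2]; under eq_fun do rewrite cabs_sqrt.
apply: (@measurableT_comp _ _ _ _ _ _ (@Num.sqrt R)).
  by apply: continuous_measurable_fun; exact: sqrt_continuous.
by apply: measurable_funD; exact: measurable_funX.
Qed.

Lemma cmeas_cont u : continuous (fun t => complex.Re (u t)) ->
  continuous (fun t => complex.Im (u t)) -> cmeas u.
Proof. by move=> h1 h2; split; exact: measurable_continuous. Qed.

Lemma cint_dom u g : cmeas u -> rint g -> (forall t, D t -> cabs (u t) <= g t) -> cint u.
Proof.
move=> [u1 u2] ig ug; split; apply: rint_le ig _ => // t Dt.
  exact: le_trans (Re_le_cabs _) (ug t Dt).
exact: le_trans (Im_le_cabs _) (ug t Dt).
Qed.

Lemma cint_bounded u (M : R) : cmeas u -> (forall t, D t -> cabs (u t) <= M) -> cint u.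
Proof. by move=> mu_ uM; apply: cint_dom (rint_cst M) _. Qed.

Lemma cint_cabs u : cint u -> rint (fun t => cabs (u t)).
Proof.
move=> iu; have [i1 i2] := iu.
apply: (@rint_le _ _ (fun t => `|complex.Re (u t)| + `|complex.Im (u t)|)).
- by apply: cmeas_cabs; exact: cint_meas.
- by apply: rintD; exact: rint_abs.
- by move=> t _; rewrite ger0_norm ?cabs_ge0 // cabs_le_ReIm.
Qed.

Lemma cintD u w : cint u -> cint w -> cint (fun t => u t + w t).
Proof.
move=> [u1 u2] [w1 w2]; split.
  by under eq_fun do rewrite ReD; exact: rintD.
by under eq_fun do rewrite ImD; exact: rintD.
Qed.

Lemma cintZ c u : cint u -> cint (fun t => c * u t).
Proof.
move=> [u1 u2]; split.
  by under eq_fun do rewrite ReM; apply: rintB; exact: rintZ.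
by under eq_fun do rewrite ImM; apply: rintD; exact: rintZ.
Qed.

Lemma cint_cst c : cint (fun=> c).
Proof. by split; exact: rint_cst. Qed.

Lemma cint_sum (I : Type) (s : seq I) (F : I -> R -> R[i]) :
  (forall i, cint (F i)) -> cint (fun t => \sum_(i <- s) F i t).
Proof.
move=> H; elim: s => [|i s IH].
  by under eq_fun do rewrite big_nil; exact: cint_cst.
by under eq_fun do rewrite big_cons; exact: cintD.
Qed.

Lemma circle_int_eq u w : (forall t, D t -> u t = w t) -> circle_int u = circle_int w.
Proof.
by move=> uw; rewrite !circle_intE; congr (_ +i* _); apply: cavg_eq => t /uw ->.
Qed.

Lemma circle_int_ae u w : aeD (fun t => u t = w t) -> circle_int u = circle_int w.
Proof.
move=> uw; rewrite !circle_intE; congr (_ +i* _); apply: cavg_ae;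
by apply: aeD_mono uw => t _ ->.
Qed.

Lemma circle_intD u w : cint u -> cint w ->
  circle_int (fun t => u t + w t) = circle_int u + circle_int w.
Proof.
move=> [u1 u2] [w1 w2]; apply: complex_ext; rewrite ?ReD ?ImD !circle_intE /=.
  by under eq_fun do rewrite ReD; rewrite cavgD.
by under eq_fun do rewrite ImD; rewrite cavgD.
Qed.

Lemma circle_intZ c u : cint u -> circle_int (fun t => c * u t) = c * circle_int u.
Proof.
move=> [u1 u2]; apply: complex_ext; rewrite ?ReM ?ImM !circle_intE /=.
  by under eq_fun do rewrite ReM; rewrite cavgB ?cavgZ //; exact: rintZ.
by under eq_fun do rewrite ImM; rewrite cavgD ?cavgZ //; exact: rintZ.
Qed.

Lemma circle_intB u w : cint u -> cint w ->
  circle_int (fun t => u t - w t) = circle_int u - circle_int w.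
Proof.
move=> iu iw; rewrite -mulN1r -circle_intZ // -circle_intD //; last exact: cintZ.
by apply: circle_int_eq => t _; rewrite mulN1r.
Qed.

Lemma circle_int_conj u : cint u -> circle_int (fun t => (u t)^*%C) = ((circle_int u)^*)%C.
Proof.
move=> [u1 u2]; apply: complex_ext; rewrite ?Re_conj ?Im_conj !circle_intE /=.
  by under eq_fun do rewrite Re_conj.
by under eq_fun do rewrite Im_conj; rewrite cavgN.
Qed.

Lemma circle_int_cst c : circle_int (fun=> c) = c.
Proof. by rewrite circle_intE !cavg_cst; case: c. Qed.

Lemma circle_int_sum (I : Type) (s : seq I) (F : I -> R -> R[i]) :
  (forall i, cint (F i)) ->
  circle_int (fun t => \sum_(i <- s) F i t) = \sum_(i <- s) circle_int (F i).
Proof.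
move=> H; elim: s => [|i s IH].
  by under eq_fun do rewrite big_nil; rewrite big_nil circle_int_cst.
under eq_fun do rewrite big_cons.
by rewrite big_cons -IH circle_intD //; exact: cint_sum.
Qed.

(* Rotating [u] by a unimodular constant makes its mean real and nonnegative. *)
Lemma circle_int_le u : cint u -> cabs (circle_int u) <= cavg (fun t => cabs (u t)).
Proof.
move=> iu; set I := circle_int u.
have [I0|I0] := eqVneq (cabs I) 0.
  by rewrite I0; apply: cavg_ge0 => t _; exact: cabs_ge0.
have Ip : 0 < cabs I by rewrite lt_def I0 cabs_ge0.
rewrite -(ler_pM2l Ip).
have -> : cabs I * cabs I = complex.Re (circle_int (fun t => (I^*)%C * u t)).
  by rewrite circle_intZ // -/I (mulrC (I^*)%C) mul_conj_cabs /= expr2.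
have iI := cintZ (I^*)%C iu.
rewrite -cavgZ; last exact: cint_cabs.
apply: cavg_le; [exact: iI.1|by apply: rintZ; exact: cint_cabs|] => t _.
apply: le_trans (ler_norm _) _; apply: le_trans (Re_le_cabs _) _.
by rewrite cabsM cabs_conj.
Qed.

Lemma circle_int_bound u (M : R) : cint u -> (forall t, D t -> cabs (u t) <= M) ->
  cabs (circle_int u) <= M.
Proof.
move=> iu uM; apply: le_trans (circle_int_le iu) _; rewrite -(cavg_cst M).
by apply: cavg_le => //; [exact: cint_cabs|exact: rint_cst].
Qed.

Lemma circle_int_dct (f : nat -> R -> R[i]) u g : (forall n, cmeas (f n)) ->
  cmeas u -> aeD (fun t => (f n t : R[i]^o) @[n --> \oo] --> (u t : R[i]^o)) -> rint g ->
  aeD (fun t => forall n, cabs (f n t) <= g t) ->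
  cint u /\ ((circle_int (f n) : R[i]^o) @[n --> \oo] --> (circle_int u : R[i]^o)).
Proof.
move=> mf [mu1 mu2] fu ig fg.
have [] := @cavg_dct R (fun n t => complex.Re (f n t)) (fun t => complex.Re (u t)) g.
- by move=> n; have [] := mf n.
- exact: mu1.
- by apply: aeD_mono fu => t _ /ccvg_ReIm [].
- exact: ig.
- by apply: aeD_mono fg => t _ h n; exact: le_trans (Re_le_cabs _) (h n).
move=> i1 c1.
have [] := @cavg_dct R (fun n t => complex.Im (f n t)) (fun t => complex.Im (u t)) g.
- by move=> n; have [] := mf n.
- exact: mu2.
- by apply: aeD_mono fu => t _ /ccvg_ReIm [].
- exact: ig.
- by apply: aeD_mono fg => t _ h n; exact: le_trans (Im_le_cabs _) (h n).
move=> i2 c2; split; first by [].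
by apply/ccvg_ReIm; split.
Qed.

Lemma cis_cont (k : R) : continuous (fun t => complex.Re (cis (k * t))) /\
  continuous (fun t => complex.Im (cis (k * t))).
Proof.
have ck : continuous (fun t : R => k * t) by move=> t; exact: mulrl_continuous.
split=> t /=.
  by apply: (@continuous_comp _ _ _ (fun t => k * t) cos); [exact: ck|exact: continuous_cos].
by apply: (@continuous_comp _ _ _ (fun t => k * t) sin); [exact: ck|exact: continuous_sin].
Qed.

Lemma cmeas_cis (k : R) : cmeas (fun t => cis (k * t)).
Proof. by have [h1 h2] := cis_cont k; exact: cmeas_cont. Qed.

Lemma cint_cis (k : R) : cint (fun t => cis (k * t)).
Proof.
by apply: (@cint_bounded _ 1); [exact: cmeas_cis|move=> t _; rewrite cabs_cis].
Qed.

Lemma cis_2pi_nat n : cis (n%:R * (2 * pi)) = 1 :> R[i].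
Proof. by rewrite -cis_exp cis_2pi expr1n. Qed.

Lemma circle_int_cis_nat n : (0 < n)%N -> circle_int (fun t : R => cis (n%:R * t)) = 0.
Proof.
move=> n0; have nR : (n%:R : R) != 0 by rewrite pnatr_eq0 -lt0n.
have p0 := twopi_gt0 R.
have [c1 c2] := cis_cont n%:R.
have dk (t : R) : is_derive t (1 : R) (fun t : R => n%:R * t) n%:R.
  have := @is_deriveZ R R^o R^o (id : R -> R) n%:R t 1 1 (is_derive_id t 1).
  by rewrite /GRing.scale /= mulr1.
have E2 : cis (n%:R * (2 * pi)) = 1 :> R[i] := cis_2pi_nat n.
have cs : cos (n%:R * (2 * pi)) = 1 :> R by case: E2.
have sn : sin (n%:R * (2 * pi)) = 0 :> R by case: E2.
have ftc (f F : R -> R) : continuous f ->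
    (forall t : R, is_derive t (1 : R) F (f t)) -> F (2 * pi) = F 0 ->
    \int[mu]_(t in D) f t = 0.
  move=> cf dF FF; rewrite /Rintegral (@continuous_FTC2 _ f F) //.
  - by rewrite FF -EFinD subrr.
  - exact: continuous_subspaceT.
  - have cF : continuous F.
      by move=> t; apply: differentiable_continuous; apply/derivable1_diffP; have [] := dF t.
    by split; [move=> t _; have [] := dF t | exact: cvg_at_right_filter (cF _)
      | exact: cvg_at_left_filter (cF _)].
  - by move=> t _; rewrite derive1E derive_val.
have r1 : \int[mu]_(t in D) complex.Re (cis (n%:R * t)) = 0.
  apply: (ftc _ (fun t => n%:R^-1 * sin (n%:R * t)) c1); last by rewrite sn !mulr0 sin0 mulr0.
  move=> t.
  have h : is_derive t (1 : R) (fun t => sin (n%:R * t)) (cos (n%:R * t) * n%:R).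
    by apply: (@is_derive1_comp _ sin (fun t => n%:R * t)).
  have := @is_deriveZ R R^o R^o (fun t : R => sin (n%:R * t)) n%:R^-1 t 1 _ h.
  by rewrite /GRing.scale /= mulrCA mulVf // mulr1.
have r2 : \int[mu]_(t in D) complex.Im (cis (n%:R * t)) = 0.
  apply: (ftc _ (fun t => - n%:R^-1 * cos (n%:R * t)) c2); last by rewrite cs mulr0 cos0 //.
  move=> t.
  have h : is_derive t (1 : R) (fun t => cos (n%:R * t)) (- sin (n%:R * t) * n%:R).
    by apply: (@is_derive1_comp _ cos (fun t => n%:R * t)).
  have := @is_deriveZ R R^o R^o (fun t : R => cos (n%:R * t)) (- n%:R^-1) t 1 _ h.
  have -> : - n%:R^-1 *: (- sin (n%:R * t) * n%:R) = sin (n%:R * t) :> R^o.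
    by rewrite /GRing.scale /=; field.
  by [].
by rewrite circle_intE /cavg r1 r2 mulr0.
Qed.

Lemma circle_int_cis2 (m n : nat) :
  circle_int (fun t : R => cis (m%:R * t) * (cis (n%:R * t))^*%C) = (m == n)%:R.
Proof.
have [mn|nm] := leqP n m; last first.
  rewrite (ltn_eqF nm) -[RHS]conjc0 -(@circle_int_cis_nat (n - m)) ?subn_gt0 //.
  rewrite -circle_int_conj; last exact: cint_cis.
  apply: circle_int_eq => t _; rewrite -!cisN -cisD natrB ?(ltnW nm) //.
  congr (cis _); ring.
rewrite (_ : circle_int _ = circle_int (fun t : R => cis ((m - n)%:R * t))); last first.
  apply: circle_int_eq => t _; rewrite -!cisN -cisD natrB //.
  congr (cis _); ring.
have [->|mn'] := eqVneq m n; last by rewrite circle_int_cis_nat // subn_gt0 ltn_neqAle eq_sym mn'.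
by rewrite subnn; under eq_fun do rewrite mul0r cis0; rewrite circle_int_cst.
Qed.

End CircleIntegral.

Section Conjugation.
Variable R : realType.
Implicit Types z w : R[i].

Lemma conjM z w : ((z * w)^*)%C = (z^*)%C * (w^*)%C.
Proof. exact: rmorphM. Qed.

Lemma conjD z w : ((z + w)^*)%C = (z^*)%C + (w^*)%C.
Proof. exact: rmorphD. Qed.

Lemma conjB z w : ((z - w)^*)%C = (z^*)%C - (w^*)%C.
Proof. exact: rmorphB. Qed.

Lemma conjX z n : ((z ^+ n)^*)%C = (z^*)%C ^+ n.
Proof. exact: rmorphXn. Qed.

Lemma conjV z : ((z^-1)^*)%C = (z^*)%C^-1.
Proof. exact: fmorphV. Qed.

End Conjugation.

(** * Poisson integrals *)

Section PoissonKernel.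
Variable R : realType.
Implicit Types (u w : R -> R[i]) (c z : R[i]) (v g : R -> R).

Local Notation mu := (@lebesgue_measure R).
Local Notation D := (@period R).

(** The Poisson kernel (1 - |z|^2) / |e^{it} - z|^2, with e^{it} taken out of the denominator. *)
Definition pker z (t : R) : R := (1 - cabs z ^+ 2) / cabs (1 - z * (cis t)^*%C) ^+ 2.

Lemma pker_den_ge z t : 1 - cabs z <= cabs (1 - z * (cis t)^*%C).
Proof.
have := cabsD (1 - z * (cis t)^*%C) (z * (cis t)^*%C).
by rewrite subrK cabs1 cabsM cabs_conj cabs_cis; lra.
Qed.

Lemma pker_den_le z t : cabs (1 - z * (cis t)^*%C) <= 1 + cabs z.
Proof.
apply: le_trans (cabsD _ _) _.
by rewrite cabsN cabs1 cabsM cabs_conj cabs_cis mulr1.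
Qed.

Lemma pker_den_gt0 z t : cabs z < 1 -> 0 < cabs (1 - z * (cis t)^*%C).
Proof. by move=> z1; apply: lt_le_trans (pker_den_ge z t); lra. Qed.

Lemma pker_ge z t : cabs z < 1 -> (1 - cabs z) / (1 + cabs z) <= pker z t.
Proof.
move=> z1; have z0 := cabs_ge0 z; have d0 := pker_den_gt0 t z1.
rewrite /pker ler_pdivlMr ?exprn_gt0 // mulrAC ler_pdivrMr; last by lra.
have := pker_den_le z t => h.
have : cabs (1 - z * (cis t)^*%C) ^+ 2 <= (1 + cabs z) ^+ 2.
  by rewrite ler_pXn2r // nnegrE; lra.
move=> h2; apply: (@le_trans _ _ ((1 - cabs z) * (1 + cabs z) ^+ 2)).
  by rewrite ler_wpM2l //; lra.
by rewrite le_eqVlt; apply/orP; left; apply/eqP; ring.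
Qed.

Lemma pker_ge0 z t : cabs z < 1 -> 0 <= pker z t.
Proof.
move=> z1; apply: le_trans (pker_ge t z1); have := cabs_ge0 z => z0.
by rewrite divr_ge0; lra.
Qed.

Lemma pker_le z t : cabs z < 1 -> pker z t <= 2 / (1 - cabs z).
Proof.
move=> z1; have z0 := cabs_ge0 z; have d0 := pker_den_gt0 t z1.
have y0 : 0 < 1 - cabs z by lra.
rewrite /pker ler_pdivrMr ?exprn_gt0 // mulrAC ler_pdivlMr //.
have h2 : (1 - cabs z) ^+ 2 <= cabs (1 - z * (cis t)^*%C) ^+ 2.
  by rewrite ler_pXn2r ?nnegrE ?pker_den_ge //; lra.
apply: (@le_trans _ _ (2 * (1 - cabs z) ^+ 2)); last by rewrite ler_pM2l.
rewrite (_ : (1 - cabs z ^+ 2) * (1 - cabs z) = (1 + cabs z) * (1 - cabs z) ^+ 2); last by ring.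
by rewrite ler_wpM2r ?sqr_ge0 //; lra.
Qed.

Lemma cmeas_zcis z : cmeas (fun t => z * (cis t)^*%C).
Proof.
apply: cmeasM; first exact: cmeas_cst.
by apply: cmeas_conj; have := cmeas_cis (1 : R); under eq_fun do rewrite mul1r.
Qed.

(** General term of the expansion of the kernel as 1 + sum of w^n + conj(w)^n, where w = z
    e^{-it}. *)
Definition pterm z (t : R) n : R[i] :=
  if n is 0 then 1 else (z * (cis t)^*%C) ^+ n + ((z * (cis t)^*%C) ^+ n)^*%C.

(** Kernel and partial sums both have closed forms, and their difference is exactly w^{N+1} / (1 -
    w) plus its conjugate. *)
Lemma pker_psum z t N : cabs z < 1 ->
  cabs ((pker z t)%:C - psum (pterm z t) N.+1) <= 2 * (cabs z ^+ N.+1 / (1 - cabs z)).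
Proof.
move=> z1; set w := z * (cis t)^*%C.
have cw : cabs w = cabs z by rewrite /w cabsM cabs_conj cabs_cis mulr1.
have w0 : 1 - w != 0 by rewrite -cabs_eq0 gt_eqF // pker_den_gt0.
have w0' : 1 - (w^*)%C != 0.
  by rewrite -(rmorph1 (@conjc R)) -rmorphB conjc_eq0.
have J (x : R[i]) : (x / (1 - w))^*%C = (x^*)%C / (1 - (w^*)%C).
  by rewrite conjM conjV conjB conjc1.
have J1 m : (w ^+ m)^*%C = (w^*)%C ^+ m by exact: conjX.
have J2 m : (w * (1 - w ^+ m))^*%C = (w^*)%C * (1 - (w^*)%C ^+ m).
  by rewrite conjM conjB conjc1 conjX.
have ps : psum (pterm z t) N.+1 = 1 + w * (1 - w ^+ N) / (1 - w) + (w * (1 - w ^+ N) / (1 - w))^*%C.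
  elim: N => [|N IH].
    by rewrite /psum big_ord_recr big_ord0 /= expr0 subrr mulr0 mul0r conjc0 !addr0 add0r.
  rewrite psumS IH /pterm -/w !J !J2 !J1 !exprS; field; by rewrite w0' w0.
have pk : (pker z t)%:C = 1 + w / (1 - w) + (w / (1 - w))^*%C.
  rewrite /pker -/w rmorphM /= fmorphV /= -mul_conj_cabs rmorphB /= -cw -mul_conj_cabs.
  rewrite !J conjB conjc1 rmorph1; field; by rewrite w0' w0.
rewrite ps pk.
have -> : 1 + w / (1 - w) + (w / (1 - w))^*%C -
  (1 + w * (1 - w ^+ N) / (1 - w) + (w * (1 - w ^+ N) / (1 - w))^*%C) =
  w ^+ N.+1 / (1 - w) + (w ^+ N.+1 / (1 - w))^*%C.
  by rewrite !J !J2 !J1 !exprS; field; rewrite w0' w0.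
apply: le_trans (cabsD _ _) _; rewrite cabs_conj.
have : cabs (w ^+ N.+1 / (1 - w)) <= cabs z ^+ N.+1 / (1 - cabs z).
  rewrite cabsM cabsX cw cabsV ler_wpM2l ?exprn_ge0 ?cabs_ge0 //.
  rewrite lef_pV2 ?posrE ?pker_den_gt0 ?pker_den_ge //; lra.
lra.
Qed.

Lemma measurable_pker z : measurable_fun D (pker z).
Proof.
have mden : measurable_fun D (fun t => cabs (1 - z * (cis t)^*%C) ^+ 2).
  apply: cmeas_cabs2; apply: cmeasD; first exact: cmeas_cst.
  by have := cmeas_zcis (- z); under eq_fun do rewrite mulNr.
apply: measurable_funM; first exact: measurable_cst.
(* The inverse is a real power here, and real powers are measurable. *)
rewrite (_ : (fun _ => _) = (fun a : R => a `^ (-1)) \o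
    (fun t => cabs (1 - z * (cis t)^*%C) ^+ 2)).
  apply: (@measurableT_comp _ _ _ _ _ _ (fun a : R => a `^ (-1))); last exact: mden.
  exact: measurable_powR.
by apply/funext => t /=; rewrite powR_inv1 ?sqr_ge0.
Qed.

(** The Fourier coefficients of index n and, in [fcm], of index -n. *)
Definition fcp u n := circle_int (fun t => u t * (cis (n%:R * t))^*%C).
Definition fcm u n := circle_int (fun t => u t * cis (n%:R * t)).

Lemma cint_mulb u w (M : R) : cint u -> cmeas w -> (forall t, cabs (w t) <= M) ->
  cint (fun t => u t * w t).
Proof.
move=> iu mw wM; apply: (@cint_dom _ _ (fun t => M * cabs (u t))).
- by apply: cmeasM => //; exact: cint_meas.
- by apply: rintZ; exact: cint_cabs.
- by move=> t _; rewrite cabsM mulrC ler_wpM2r // cabs_ge0.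
Qed.

Lemma cint_fcp u n : cint u -> cint (fun t => u t * (cis (n%:R * t))^*%C).
Proof.
move=> iu; apply: (@cint_mulb _ _ 1) => //; first by apply: cmeas_conj; exact: cmeas_cis.
by move=> t; rewrite cabs_conj cabs_cis.
Qed.

Lemma cint_fcm u n : cint u -> cint (fun t => u t * cis (n%:R * t)).
Proof.
move=> iu; apply: (@cint_mulb _ _ 1) => //; first exact: cmeas_cis.
by move=> t; rewrite cabs_cis.
Qed.

Lemma cint_pker u z : cabs z < 1 -> cint u -> cint (fun t => (pker z t)%:C * u t).
Proof.
move=> z1 iu.
have := @cint_mulb u (fun t => (pker z t)%:C) (2 / (1 - cabs z)) iu.
move=> /(_ (cmeas_real (measurable_pker z))) H.
under eq_fun do rewrite mulrC; apply: H => t.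
by rewrite cabs_real ger0_norm ?pker_ge0 // pker_le.
Qed.

(** The integral of [pterm] against [u]. Index 0 is separate because there the two exponentials
    coincide and must be counted once. *)
Definition pois_term u z n : R[i] :=
  if n is 0 then circle_int u else fcp u n * z ^+ n + fcm u n * (z^*)%C ^+ n.

Lemma cis_exp_conj n (t : R) : ((cis t)^*)%C ^+ n = ((cis (n%:R * t))^*)%C.
Proof. by rewrite -rmorphXn /= cis_exp. Qed.

Lemma pterm_int u z n : cint u ->
  cint (fun t => pterm z t n * u t) /\
  circle_int (fun t => pterm z t n * u t) = pois_term u z n.
Proof.
move=> iu; case: n => [|n].
  rewrite /pterm; split.
    by under eq_fun do rewrite mul1r.
  by apply: circle_int_eq => t _; rewrite mul1r.
have E t : pterm z t n.+1 * u t = z ^+ n.+1 * (u t * (cis (n.+1%:R * t))^*%C) +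
    (z^*)%C ^+ n.+1 * (u t * cis (n.+1%:R * t)).
  rewrite /pterm !exprMn rmorphM /= cis_exp_conj conjcK !rmorphXn /=; ring.
have i1 := cintZ (z ^+ n.+1) (cint_fcp n.+1 iu).
have i2 := cintZ ((z^*)%C ^+ n.+1) (cint_fcm n.+1 iu).
split; first by under eq_fun do rewrite E; exact: cintD.
rewrite (circle_int_eq (w := fun t => _ + _) (fun t _ => E t)) circle_intD //.
rewrite !circle_intZ //; [|exact: cint_fcm|exact: cint_fcp].
by rewrite /pois_term /fcp /fcm; ring.
Qed.

(** The expansion of the kernel converges uniformly in t, so it may be integrated against [u] term
    by term. *)
Lemma poisson_series u z : cabs z < 1 -> cint u ->
  (psum (pois_term u z) n : R[i]^o) @[n --> \oo] -->
  (circle_int (fun t => (pker z t)%:C * u t) : R[i]^o).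
Proof.
move=> z1 iu; apply/ccvgP => e e0.
pose A := cavg (fun t => cabs (u t)).
have A0 : 0 <= A by apply: cavg_ge0 => t _; exact: cabs_ge0.
have y0 : 0 < 1 - cabs z by lra.
have K0 : 0 <= 2 / (1 - cabs z) * A by rewrite mulr_ge0 // divr_ge0 // ltW.
have [N hN] := geo_small (cabs_ge0 z) z1 K0 e0.
exists N.+1 => // -[//|n] /=; rewrite ltnS => /leqW /hN; apply: le_lt_trans.
have E : (fun t => psum (pterm z t) n.+1 * u t) = (fun t => \sum_(i < n.+1) pterm z t i * u t).
  by apply/funext => t; rewrite /psum mulr_suml.
have -> : psum (pois_term u z) n.+1 = circle_int (fun t => psum (pterm z t) n.+1 * u t).
  rewrite E circle_int_sum; last by move=> i; exact: (pterm_int z i iu).1.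
  by apply: eq_bigr => i _; rewrite (pterm_int z i iu).2.
have ip := cint_pker z1 iu.
have is_ : cint (fun t => psum (pterm z t) n.+1 * u t).
  by rewrite E; apply: cint_sum => i; exact: (pterm_int z i iu).1.
rewrite -circle_intB //.
have id : cint (fun t => (pker z t)%:C * u t - psum (pterm z t) n.+1 * u t).
  have := cintD ip (cintZ (-1) is_); by under eq_fun do rewrite mulN1r.
apply: le_trans (circle_int_le id) _.
have -> : 2 / (1 - cabs z) * A * cabs z ^+ n.+1 =
   2 * (cabs z ^+ n.+1 / (1 - cabs z)) * A by ring.
rewrite -cavgZ; last exact: cint_cabs.
apply: cavg_le; [exact: cint_cabs|by apply: rintZ; exact: cint_cabs|] => t _.
by rewrite -mulrBl cabsM ler_wpM2r ?cabs_ge0 // pker_psum.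
Qed.

Definition pois v z := cavg (fun t => pker z t * v t).

Lemma rint_pker v z : cabs z < 1 -> rint v -> rint (fun t => pker z t * v t).
Proof.
move=> z1 iv; apply: (@rint_le _ _ (fun t => 2 / (1 - cabs z) * `|v t|)).
- by apply: measurable_funM; [exact: measurable_pker|exact: rint_meas].
- by apply: rintZ; exact: rint_abs.
- by move=> t _; rewrite normrM ger0_norm ?pker_ge0 // ler_wpM2r // pker_le.
Qed.

(** In the Poisson series of the constant 1 only the term of index 0 survives. *)
Lemma cavg_pker z : cabs z < 1 -> cavg (pker z) = 1.
Proof.
move=> z1; have := poisson_series z1 (cint_cst (1 : R[i])).
set L := circle_int _ => cv.
have LE : complex.Re L = cavg (pker z).
  by rewrite /L circle_intE; apply: cavg_eq => t _; rewrite (mulr1 (_%:C)).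
have : L = 1; last by move=> L1; rewrite -LE L1.
have cst1 n : psum (pois_term (fun=> 1) z) n.+1 = 1.
  elim: n => [|n IH].
    by rewrite psumS {1}/psum big_ord0 /= circle_int_cst add0r.
  rewrite psumS IH /pois_term /fcp /fcm.
  have -> : circle_int (fun t : R => 1 * cis (n.+1%:R * t)) = 0.
    by under eq_fun do rewrite mul1r; rewrite circle_int_cis_nat.
  have -> : circle_int (fun t : R => 1 * (cis (n.+1%:R * t))^*%C) = 0.
    under eq_fun do rewrite mul1r.
    by rewrite circle_int_conj ?circle_int_cis_nat ?conjc0 //; exact: cint_cis.
  by rewrite !mul0r !addr0.
apply/eqP; rewrite -subr_eq0 -cabs_eq0 eq_le cabs_ge0 andbT.
apply: (@ccvg_bound _ _ _ _ 1%N _ cv) => -[//|n] _.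
by rewrite cst1 subrr cabs0.
Qed.

Lemma pois_real u z : circle_int (fun t => (pker z t)%:C * u t) =
  pois (fun t => complex.Re (u t)) z +i* pois (fun t => complex.Im (u t)) z.
Proof.
rewrite circle_intE; congr (_ +i* _); apply: cavg_eq => t _.
  by rewrite ReM /= mul0r subr0.
by rewrite ImM /= mul0r addr0.
Qed.

End PoissonKernel.

(** * Radial limits of Poisson integrals *)

Section PoissonLimit.
Variable R : realType.
Implicit Types (u w : R -> R[i]) (c z : R[i]) (v g : R -> R).

Local Notation mu := (@lebesgue_measure R).
Local Notation D := (@period R).

Lemma rint_sum n (f : nat -> R -> R) : (forall k, rint (f k)) ->
  rint (fun t => \sum_(k < n) f k t).
Proof.
move=> H; elim: n => [|n IH].
  by under eq_fun do rewrite big_ord0; exact: rint_cst.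
by under eq_fun do rewrite big_ord_recr; exact: rintD.
Qed.

Lemma cavg_sum n (f : nat -> R -> R) : (forall k, rint (f k)) ->
  cavg (fun t => \sum_(k < n) f k t) = \sum_(k < n) cavg (f k).
Proof.
move=> H; elim: n => [|n IH].
  by under eq_fun do rewrite big_ord0; rewrite big_ord0 cavg_cst.
under eq_fun do rewrite big_ord_recr.
by rewrite cavgD ?IH ?big_ord_recr //; exact: rint_sum.
Qed.

(** Through [cos_half] this bounds the denominator of the kernel from below near its peak. *)
Lemma sin_lower : exists2 s : R, 0 < s & forall x : R, `|x| < s -> x ^+ 2 / 4 <= sin x ^+ 2.
Proof.
have [s s0 hs] := @real_derive_bound R sin (cos 0) (is_derive_sin 0) (1 / 2) ltac:(by rewrite divr_gt0).
exists s => // x /hs; rewrite sin0 cos0 subr0 mul1r => h.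
have h2 : `|x| / 2 <= `|sin x|.
  have := ler_normD (sin x - x) (- sin x); rewrite addrAC subrr add0r !normrN; lra.
rewrite -(real_normK (num_real x)) -(real_normK (num_real (sin x))).
have -> : `|x| ^+ 2 / 4 = (`|x| / 2) ^+ 2 by field.
by rewrite ler_pXn2r ?nnegrE // divr_ge0.
Qed.

Lemma cos_half (x : R) : 1 - cos x = 2 * sin (x / 2) ^+ 2.
Proof.
rewrite {1}(splitr x) cosD -!expr2 cos2sin2; ring.
Qed.

(** Differences of two angles of the period may exceed pi, in which case |x| is replaced by 2 pi -
    |x|. *)
Lemma cos_far (e x : R) : 0 < e -> e <= pi -> e <= `|x| -> `|x| <= 2 * pi - e -> cos x <= cos e.
Proof.
move=> e0 ep ex xe; have -> : cos x = cos `|x| by case: (ger0P x) => _; rewrite ?cosN.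
have [xp|xp] := leP `|x| pi.
  by rewrite leNgt ltr_cos ?in_itv /= -?leNgt ?normr_ge0 ?xp ?(ltW e0) ?ep.
have -> : cos `|x| = cos (2 * pi - `|x|).
  rewrite cosB mulr_natl cos2pi sin2pi; ring.
by rewrite leNgt ltr_cos ?in_itv /= -?leNgt ?(ltW e0) ?ep //; lra.
Qed.

Lemma pker_polar (r t0 t : R) : 0 <= r ->
  pker (r%:C * cis t0) t = (1 - r ^+ 2) / ((1 - r) ^+ 2 + 2 * r * (1 - cos (t0 - t))).
Proof.
move=> r0; rewrite /pker cabsM cabs_cis mulr1 cabs_real ger0_norm //; congr (_ / _).
rewrite cabs_sqr cosB ReD ImD ReN ImN !ReM !ImM /=.
have h1 := cos2Dsin2 t0; have h2 := cos2Dsin2 t.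
transitivity (1 - 2 * r * (cos t0 * cos t + sin t0 * sin t) +
  r ^+ 2 * (cos t0 ^+ 2 + sin t0 ^+ 2) * (cos t ^+ 2 + sin t ^+ 2)); first by ring.
rewrite h1 h2; ring.
Qed.

Lemma cabs_polar (r t0 : R) : 0 <= r -> cabs (r%:C * cis t0) = r.
Proof. by move=> r0; rewrite cabsM cabs_cis mulr1 cabs_real ger0_norm. Qed.

Lemma rint_indic v (B : set R) : measurable (B : set (measurableTypeR R)) -> rint v ->
  rint (fun t => v t * \1_B t).
Proof.
move=> mB iv; apply: (@rint_le _ _ (fun t => `|v t|)).
- apply: measurable_funM; first exact: rint_meas.
  exact: measurable_indic.
- exact: rint_abs.
- move=> t _; rewrite normrM indicE; case: (t \in B); first by rewrite normr1 mulr1.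
  by rewrite normr0 mulr0.
Qed.

Lemma measurable_ball' (t0 rho : R) : measurable (ball t0 rho : set (measurableTypeR R)).
Proof. exact: measurable_ball. Qed.

(** A Lebesgue point of [v]: the integral of |v - v(t0)| over the ball of radius rho is o(rho). The
    indicator turns it into a mean over the whole period, directly comparable with a Poisson
    integral. *)
Definition poisson_regular v (t0 : R) := forall e : R, 0 < e -> exists2 s : R, 0 < s &
  forall rho, 0 < rho -> rho <= s ->
    cavg (fun t => `|v t - v t0| * \1_(ball t0 rho) t) <= e * rho.

(** A dyadic majorant by indicators of balls centred at 0. One term is enough: the least k with |x|
    < 2^k d. Minimality gives |x| >= 2^{k-1} d unless k = 0, where d^2 alone suffices. *)
Lemma near_kernel (s d x : R) (K : nat) : 0 < s -> 0 < d -> `|x| < s -> s <= 2 ^+ K * d ->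
  d / (d ^+ 2 + x ^+ 2) <=
  \sum_(k < K.+1) 4 / (4 ^+ k * d) * (`|x| < Num.min (2 ^+ k * d) s)%R%:R.
Proof.
move=> s0 d0 xs sK.
have exk : exists k : nat, `|x| < 2 ^+ k * d.
  by exists K; exact: lt_le_trans sK.
pose k := ex_minn exk; have : k = ex_minn exk by [].
case: ex_minnP => k' hk' kmin kk'; rewrite -kk' in hk' kmin.
have kK : (k < K.+1)%N by rewrite ltnS; apply: kmin; exact: lt_le_trans sK.
have x20 := sqr_ge0 x; have d20 : 0 < d ^+ 2 by rewrite exprn_gt0.
have dx : 0 < d ^+ 2 + x ^+ 2 by lra.
rewrite (bigD1 (Ordinal kK)) //= lt_min hk' xs /= mulr1.
apply: (@le_trans _ _ (4 / (4 ^+ k * d))); last first.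
  rewrite lerDl; apply: sumr_ge0 => i _; rewrite mulr_ge0 // divr_ge0 // mulr_ge0 ?exprn_ge0 //.
  exact: ltW.
have k4 : 0 < 4 ^+ k :> R by rewrite exprn_gt0.
rewrite ler_pdivrMr // mulrAC ler_pdivlMr ?mulr_gt0 //.
case: k hk' kmin k4 {kk' kK} => [|k] hk kmin k4.
  rewrite expr0 mul1r -expr2; lra.
have : 2 ^+ k * d <= `|x|.
  by rewrite leNgt; apply/negP => /kmin; rewrite ltnn.
move=> hx; have : (2 ^+ k * d) ^+ 2 <= `|x| ^+ 2.
  by rewrite ler_pXn2r ?nnegrE ?normr_ge0 // mulr_ge0 ?exprn_ge0 // ltW.
have e4 : 4 ^+ k = 2 ^+ k * 2 ^+ k :> R by rewrite -exprMn -natrM.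
rewrite real_normK ?num_real // => h2.
have -> : d * (4 ^+ k.+1 * d) = 4 * (2 ^+ k * d) ^+ 2 by rewrite exprS e4; ring.
rewrite ler_pM2l //; lra.
Qed.

(** Fatou's theorem at a Lebesgue point. Near t0 the kernel lies below a sum over k of 4^{-k} / d
    times the indicator of a ball of radius 2^k d, up to a constant, with d = 1 - r. Regularity
    makes the k-th ball contribute O(e 2^{-k}). Away from t0 the kernel itself is O(d). *)
Lemma poisson_point v (t0 : R) : rint v -> 0 < t0 -> t0 < 2 * pi -> poisson_regular v t0 ->
  forall e : R, 0 < e -> exists2 s : R, 0 < s &
  forall r, 1 - s < r -> r < 1 -> `|pois v (r%:C * cis t0) - v t0| <= e.
Proof.
move=> iv t00 t0p reg e e0.
have [s1 s10 hs1] := sin_lower.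
(* With this constant the k-th ball contributes at most (e / 16) 2^{-k}. *)
have e1 : 0 < e / (64 * 16) by rewrite divr_gt0.
have [s2 s20 hs2] := reg _ e1.
have pi0 := pi_gt0 R.
(* The bounds by [t0] and [2 * pi - t0] keep |t0 - t| <= 2 pi - s over the period, as [cos_far]
   requires. *)
have [s s0 [ss1 ss2 st st' sp]] : exists2 s : R, 0 < s &
    [/\ s <= s1, s <= s2, s <= t0, s <= 2 * pi - t0 & s <= pi].
  exists (Num.min (Num.min s1 s2) (Num.min (Num.min t0 (2 * pi - t0)) pi)).
    by rewrite !lt_min s10 s20 t00 pi0 /= andbT subr_gt0.
  by split; rewrite !ge_min lexx ?orbT.
pose w (t : R) : R := `|v t - v t0|.
have iw : rint w by apply: rint_abs; apply: rintB iv (rint_cst _).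
have w0 t : 0 <= w t by exact: normr_ge0.
pose A := cavg w; have A0 : 0 <= A by apply: cavg_ge0 => t _.
have cs : 0 < 1 - cos s.
  rewrite subr_gt0 -cos0 ltr_cos ?in_itv /= ?lexx ?(ltW s0) //.
  exact: ltW.
have B0 : 0 < 2 * (A + 1) / (1 - cos s).
  by apply: divr_gt0 => //; apply: mulr_gt0 => //; lra.
(* From r >= 1 / 2 the factor 2r in the denominator is at least 1; the other bound makes the far
   part at most e / 2. *)
exists (Num.min (1 / 2) (e / 2 / (2 * (A + 1) / (1 - cos s)))).
  by rewrite lt_min divr_gt0 //= divr_gt0 // divr_gt0.
move=> r; rewrite ltrBlDr -ltrBlDl lt_min => /andP[r2 rA0] r1; pose d : R := 1 - r.
have rA : (1 - r) * (2 * (A + 1) / (1 - cos s)) < e / 2 by rewrite -ltr_pdivlMr.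
have d0 : 0 < d by rewrite /d; lra.
have rh : 1 / 2 <= r by lra.
have r0 : 0 <= r by lra.
have z1 : cabs (r%:C * cis t0) < 1 by rewrite cabs_polar.
have [K hK] : exists K : nat, s <= 2 ^+ K * d.
  have [N hN] := @geo_small R 1 (1 / 2) ltac:(by rewrite divr_ge0) ltac:(lra) ler01 (d / s) ltac:(by rewrite divr_gt0).
  exists N; have := hN N (leqnn _); rewrite mul1r ltr_pdivlMr // expr_div_n expr1n mulrAC mul1r.
  by rewrite ltr_pdivrMr ?exprn_gt0 // mulrC => /ltW.
have iker := rint_pker z1 iw.
have step1 : `|pois v (r%:C * cis t0) - v t0| <= cavg (fun t => pker (r%:C * cis t0) t * w t).
  have ic := rint_pker z1 (rint_cst (v t0)).
  have -> : v t0 = cavg (fun t => pker (r%:C * cis t0) t * v t0).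
    rewrite (cavg_eq (w := fun t => v t0 * pker (r%:C * cis t0) t)); last by move=> t _; rewrite mulrC.
    rewrite cavgZ ?cavg_pker ?mulr1 //.
    by have := rint_pker z1 (rint_cst 1); under eq_fun do rewrite mulr1.
  rewrite /pois -cavgB //; last exact: rint_pker.
  apply: le_trans (cavg_norm_le _) _; first by apply: rintB ic; exact: rint_pker.
  rewrite le_eqVlt; apply/orP; left; apply/eqP; apply: cavg_eq => t _.
  by rewrite -mulrBr normrM ger0_norm ?pker_ge0 //; congr (_ * `|_ - _|).
apply: le_trans step1 _.
pose rho k : R := Num.min (2 ^+ k * d) s.
have rho0 k : 0 < rho k by rewrite /rho lt_min s0 andbT mulr_gt0 ?exprn_gt0.
pose G (k : nat) (t : R) : R := 64 / (4 ^+ k * d) * (w t * \1_(ball t0 (rho k)) t).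
have iG k : rint (G k) by apply: rintZ; apply: rint_indic iw; exact: measurable_ball'.
have pw t : D t -> pker (r%:C * cis t0) t * w t <=
    \sum_(k < K.+1) G k t + 2 * d / (1 - cos s) * w t.
  rewrite /period /= in_itv /= => /andP[tl tu].
  have num : 1 - r ^+ 2 <= 2 * d by have := sqr_ge0 (1 - r); rewrite /d; lra.
  have Gge0 : 0 <= \sum_(k < K.+1) G k t.
    apply: sumr_ge0 => k _; rewrite /G !mulr_ge0 ?invr_ge0 ?mulr_ge0 ?exprn_ge0 ?(ltW d0) //.
  have [near|far] := ltP `|t0 - t| s.
    have fw : 0 <= 2 * d / (1 - cos s) * w t by rewrite !mulr_ge0 ?invr_ge0 ?(ltW d0) ?(ltW cs).
    apply: (@le_trans _ _ (\sum_(k < K.+1) G k t)); last by rewrite lerDl.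
    rewrite -subr_ge0.
    have -> : \sum_(k < K.+1) G k t = 16 * (\sum_(k < K.+1) 4 / (4 ^+ k * d) *
        (`|t0 - t| < rho k)%R%:R) * w t.
      rewrite mulr_sumr mulr_suml; apply: eq_bigr => k _; rewrite /G indicE.
      have -> : (t \in (ball t0 (rho k) : set R)) = (`|t0 - t| < rho k).
        by apply/idP/idP => [/set_mem|h]; [|apply/mem_set].
      have := d0; have k4 : 4 ^+ k != 0 :> R by rewrite expf_neq0.
      by move=> d0'; field; rewrite gt_eqF.
    rewrite subr_ge0 ler_wpM2r //.
    apply: (@le_trans _ _ (16 * (d / (d ^+ 2 + (t0 - t) ^+ 2)))); last first.
      by rewrite ler_pM2l //; exact: near_kernel.
    rewrite pker_polar // cos_half.
    have sl : (t0 - t) ^+ 2 / 16 <= sin ((t0 - t) / 2) ^+ 2.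
      have : `|(t0 - t) / 2| < s1 by rewrite normrM [`|2^-1|]ger0_norm ?invr_ge0 //; lra.
      by move=> /hs1; rewrite expr_div_n; lra.
    have x20 := sqr_ge0 (t0 - t); have d20 : 0 < d ^+ 2 by rewrite exprn_gt0.
    set S := sin _ ^+ 2 in sl *.
    have S0 : 0 <= S by apply: le_trans sl; rewrite divr_ge0.
    have rS : 1 / 2 * S <= r * S by rewrite ler_wpM2r.
    have den : (d ^+ 2 + (t0 - t) ^+ 2) / 8 <= (1 - r) ^+ 2 + 2 * r * (2 * S).
      by rewrite -/d; lra.
    have den0 : 0 < (d ^+ 2 + (t0 - t) ^+ 2) / 8 by rewrite divr_gt0 //; lra.
    rewrite ler_pdivrMr; last exact: lt_le_trans den.
    apply: le_trans num _; apply: (@le_trans _ _ (16 * (d / (d ^+ 2 + (t0 - t) ^+ 2)) * ((d ^+ 2 + (t0 - t) ^+ 2) / 8))).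
      rewrite le_eqVlt; apply/orP; left; apply/eqP; field; by rewrite gt_eqF //; lra.
    by rewrite ler_wpM2l // mulr_ge0 // divr_ge0 ?(ltW d0) //; lra.
  apply: (@le_trans _ _ (2 * d / (1 - cos s) * w t)); last by rewrite lerDr.
  rewrite ler_wpM2r // pker_polar //.
  have cf : cos (t0 - t) <= cos s.
    by apply: cos_far => //; rewrite ler_norml; apply/andP; split; lra.
  have c1 : 0 < 1 - cos (t0 - t) by lra.
  have c2 : 1 - cos s <= 2 * r * (1 - cos (t0 - t)).
    have : 1 * (1 - cos (t0 - t)) <= 2 * r * (1 - cos (t0 - t)) by rewrite ler_wpM2r //; lra.
    lra.
  have den : 1 - cos s <= (1 - r) ^+ 2 + 2 * r * (1 - cos (t0 - t)).
    by have := sqr_ge0 (1 - r); lra.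
  rewrite ler_pdivrMr; last exact: lt_le_trans den.
  apply: le_trans num _; rewrite mulrAC ler_pdivlMr //.
  by rewrite ler_wpM2l // mulr_ge0 // ltW.
have isum := rint_sum K.+1 iG.
apply: le_trans (cavg_le iker _ pw) _.
  by apply: rintD => //; exact: rintZ.
rewrite cavgD //; last exact: rintZ.
rewrite cavg_sum // cavgZ // -/A.
have b1 : \sum_(k < K.+1) cavg (G k) <= e / 2.
  have Gk k : cavg (G k) <= e / 16 * (1 / 2) ^+ k.
    rewrite /G cavgZ; last by apply: rint_indic iw; exact: measurable_ball'.
    have k4 : 0 < 4 ^+ k :> R by rewrite exprn_gt0.
    have k2 : 0 < 2 ^+ k :> R by rewrite exprn_gt0.
    have c0 : 0 < 64 / (4 ^+ k * d) by rewrite divr_gt0 // mulr_gt0.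
    have rs : rho k <= s2 by apply: le_trans ss2; rewrite /rho ge_min lexx orbT.
    have rd : rho k <= 2 ^+ k * d by rewrite /rho ge_min lexx.
    have := hs2 _ (rho0 k) rs => h.
    apply: (@le_trans _ _ (64 / (4 ^+ k * d) * (e / (64 * 16) * (2 ^+ k * d)))).
      by rewrite ler_pM2l // (le_trans h) // ler_pM2l.
    rewrite le_eqVlt; apply/orP; left; apply/eqP.
    rewrite (_ : 4 ^+ k = 2 ^+ k * 2 ^+ k); last by rewrite -exprMn -natrM.
    rewrite expr_div_n expr1n; field; by rewrite !gt_eqF.
  apply: (@le_trans _ _ (\sum_(k < K.+1) e / 16 * (1 / 2) ^+ k)).
    by apply: ler_sum => k _; exact: Gk.
  rewrite -mulr_sumr.
  have := @geo_sum_le R (1 / 2) 0 K.+1 ltac:(by rewrite divr_ge0) ltac:(lra).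
  rewrite big_mkord expr0 => h.
  apply: (@le_trans _ _ (e / 16 * (1 / (1 - 1 / 2)))).
    by rewrite ler_wpM2l // divr_ge0 // ltW.
  have -> : 1 / (1 - 1 / 2) = 2 :> R by field.
  lra.
have b2 : 2 * d / (1 - cos s) * A <= e / 2.
  apply: le_trans (ltW rA); rewrite -/d.
  have -> : 2 * d / (1 - cos s) * A = d * (2 * A / (1 - cos s)) by ring.
  rewrite ler_pM2l // ler_pM2r ?invr_gt0 //; lra.
lra.
Qed.

End PoissonLimit.

(** * Lebesgue points *)

Section PoissonRegular.
Variable R : realType.
Implicit Types (v : R -> R) (t : R).

Local Notation mu := (@lebesgue_measure R).
Local Notation D := (@period R).

Lemma cavg_indic_ball v t (rho : R) : ball t rho `<=` (D : set R) ->
  (forall y, 0 <= v y) -> rint (fun y => v y * \1_(ball t rho) y) ->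
  (cavg (fun y => v y * \1_(ball t rho) y))%:E =
  (((2 * pi)^-1)%:E * \int[mu]_(y in ball t rho) (v y)%:E)%E.
Proof.
move=> bD v0 iv; rewrite -cavgE_ereal //; congr (_ * _)%E.
rewrite -{2}(setIidr bD) integral_mkcondr; apply: eq_integral => y _.
by rewrite indicE /patch; case: (y \in _); rewrite ?mulr1 ?mulr0.
Qed.

Lemma ball_period t (rho : R) : rho <= t -> rho <= 2 * pi - t -> ball t rho `<=` (D : set R).
Proof.
move=> h1 h2 y; rewrite /ball /= ltr_norml /D /period /= in_itv /= => /andP[a b].
by apply/andP; split; lra.
Qed.

Lemma poisson_regular_cont v t : rint v -> 0 < t -> t < 2 * pi ->
  (forall e : R, 0 < e -> exists2 s : R, 0 < s & forall y, `|y - t| < s -> `|v y - v t| <= e) ->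
  poisson_regular v t.
Proof.
move=> iv t0 tp H e e0; have [s s0 hs] := H _ e0.
exists (Num.min s (Num.min t (2 * pi - t))); first by rewrite !lt_min s0 t0 subr_gt0.
move=> rho rho0; rewrite !le_min => /andP[rs /andP[rt rp]].
have iw : rint (fun y => `|v y - v t|) by apply: rint_abs; apply: rintB iv (rint_cst _).
have mB := @measurable_ball' R t rho.
apply: (@le_trans _ _ (cavg (fun y => e * \1_(ball t rho) y))).
  apply: cavg_le; [exact: rint_indic|exact: rint_indic (rint_cst _)|] => y _.
  rewrite indicE; case: (boolP (y \in _)) => [/set_mem yB|_]; last by rewrite !mulr0.
  rewrite !mulr1; apply: hs; apply: lt_le_trans rs.
  by move: yB; rewrite /ball /= distrC.
rewrite -lee_fin cavg_indic_ball //; last 3 first.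
- exact: ball_period.
- by move=> y; exact: ltW.
- by apply: rint_indic (rint_cst _).
rewrite integral_cst // [X in (_ * (_ * X))%E](lebesgue_measure_ball t (ltW rho0)) -!EFinM lee_fin.
have pi2 := pi_ge2 R; have p0 := twopi_gt0 R.
rewrite ler_pdivrMl //.
have er : 0 < e * rho by exact: mulr_gt0.
have h : 2 * (e * rho) <= pi * (e * rho) by rewrite ler_pM2r.
have -> : e * (rho *+ 2) = 2 * (e * rho) by ring.
by apply: le_trans h _; rewrite ler_pM2r //; lra.
Qed.

(** Lebesgue differentiation of [v] cut off outside the period. For an interior t, small balls stay
    inside the period, where the cut-off changes nothing. *)
Lemma ae_poisson_regular v : rint v ->
  {ae mu, forall t, 0 < t -> t < 2 * pi -> poisson_regular v t}.
Proof.
move=> iv; have iv' : mu.-integrable D (EFin \o v) by exact: iv.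
have := lebesgue_differentiation (integrable_locally_restrict (@mD R) iv').
apply: filterS => t Lt t0 tp e e0.
have nb : nbhs (0%E : \bar R) [set x | (x < e%:E)%E].
  by apply: open_nbhs_nbhs; split; [exact: open_ereal_lt_ereal|rewrite /= lte_fin].
have /nbhs_ballP [s /= s0 hs] := Lt _ nb.
exists (Num.min (s / 2) (Num.min t (2 * pi - t))).
  by rewrite !lt_min divr_gt0 // t0 subr_gt0.
move=> rho rho0; rewrite !le_min => /andP[rs /andP[rt rp]].
have iw : rint (fun y => `|v y - v t|) by apply: rint_abs; apply: rintB iv (rint_cst _).
have mB := @measurable_ball' R t rho.
have bD := ball_period rt rp.
have := hs rho; rewrite /ball /= sub0r normrN gtr0_norm //.
move=> /(_ ltac:(lra) rho0) /ltW; rewrite /davg /iavg.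
rewrite [X in (X^-1 * _)%E](lebesgue_measure_ball t (ltW rho0)).
rewrite inver gt_eqF ?pmulrn_rgt0 // lee_pdivrMl ?pmulrn_rgt0 // => h.
rewrite -lee_fin cavg_indic_ball //; last by apply: rint_indic.
have DE y : ball t rho y -> (v \_ D) y = v y.
  by move=> /bD Dy; rewrite /patch mem_set.
apply: (@le_trans _ _ (((2 * pi)^-1)%:E * ((rho *+ 2)%:E * e%:E))%E).
  apply: lee_wpmul2l; first by rewrite lee_fin invr_ge0 ltW ?twopi_gt0.
  apply: le_trans h; rewrite le_eqVlt; apply/orP; left; apply/eqP.
  apply: eq_integral => y /set_mem yB /=; rewrite !DE //.
  exact: ballxx.
have pi2 := pi_ge2 R; have p0 := twopi_gt0 R.
rewrite -!EFinM lee_fin ler_pdivrMl //.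
have er : 0 < e * rho by exact: mulr_gt0.
have h' : 2 * (e * rho) <= pi * (e * rho) by rewrite ler_pM2r.
have -> : (rho *+ 2) * e = 2 * (e * rho) by ring.
by apply: le_trans h' _; rewrite ler_pM2r //; lra.
Qed.

End PoissonRegular.

(** * Taylor expansion of analytic functions *)

Section IntervalIntegral.
Variable R : realType.
Implicit Types (u w : R -> R[i]) (c z : R[i]) (a b : R).

Local Notation mu := (@lebesgue_measure R).

Definition ii u a b : R[i] :=
  (\int[mu]_(t in `[a, b]) complex.Re (u t)) +i* (\int[mu]_(t in `[a, b]) complex.Im (u t)).

Definition ccont_on u a b := {within `[a, b], continuous (fun t => complex.Re (u t))} /\
  {within `[a, b], continuous (fun t => complex.Im (u t))}.

Lemma ccont_onP u a b :
  (forall t, a <= t -> t <= b -> forall e : R, 0 < e -> exists2 r : R, 0 < r &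
    forall t', `|t' - t| < r -> cabs (u t' - u t) < e) -> ccont_on u a b.
Proof.
move=> H; split; apply: continuous_in_subspaceT.
- move=> t; rewrite inE /= in_itv /= => /andP[at_ tb].
  apply/cvgrPdist_lt => e e0; have [r r0 hr] := H t at_ tb e e0.
  apply/nbhs_ballP; exists r => // t' /= tt'.
  rewrite -ReN -ReD; apply: le_lt_trans (Re_le_cabs _) _.
  by rewrite cabsB; apply: hr; rewrite distrC.
- move=> t; rewrite inE /= in_itv /= => /andP[at_ tb].
  apply/cvgrPdist_lt => e e0; have [r r0 hr] := H t at_ tb e e0.
  apply/nbhs_ballP; exists r => // t' /= tt'.
  rewrite -ImN -ImD; apply: le_lt_trans (Im_le_cabs _) _.
  by rewrite cabsB; apply: hr; rewrite distrC.
Qed.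

Lemma ccont_onB u w a b : ccont_on u a b -> ccont_on w a b ->
  ccont_on (fun t => u t - w t) a b.
Proof.
move=> [u1 u2] [w1 w2]; split.
  rewrite (_ : (fun t => _) = (fun t => complex.Re (u t) - complex.Re (w t))).
    by move=> t; apply: cvgB; [exact: u1|exact: w1].
  by apply/funext => t; rewrite ReD ReN.
rewrite (_ : (fun t => _) = (fun t => complex.Im (u t) - complex.Im (w t))).
  by move=> t; apply: cvgB; [exact: u2|exact: w2].
by apply/funext => t; rewrite ImD ImN.
Qed.

Lemma integrable_cont (v : R -> R) a b : {within `[a, b], continuous v} ->
  mu.-integrable `[a, b] (EFin \o v).
Proof. by move=> cv; apply: continuous_compact_integrable => //; exact: segment_compact. Qed.

Lemma Rint_split (v : R -> R) (a b c : R) : a <= b -> b <= c ->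
  {within `[a, c], continuous v} ->
  \int[mu]_(t in `[a, c]) v t = \int[mu]_(t in `[a, b]) v t + \int[mu]_(t in `[b, c]) v t.
Proof.
move=> ab bc cv; have iv := integrable_cont cv.
have h := @Rintegral_itvB R v (BLeft a) (BRight c) b iv.
rewrite -[LHS](subrK (\int[mu]_(t in `[a, b]) v t)) addrC; congr (_ + _).
rewrite h ?bnd_simp // Rintegral_itv_obnd_cbnd //.
apply: (@integrableS _ _ R mu `[a, c] `]b, c]) iv => //.
by move=> t /=; rewrite !in_itv /= => /andP[h3 ->]; rewrite (le_trans ab (ltW h3)).
Qed.

Lemma ii_split u (a b c : R) : a <= b -> b <= c -> ccont_on u a c -> ii u a c = ii u a b + ii u b c.
Proof.
move=> ab bc [c1 c2]; apply: complex_ext; rewrite ?ReD ?ImD /=; exact: Rint_split.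
Qed.

Lemma iiB u w a b : ccont_on u a b -> ccont_on w a b ->
  ii (fun t => u t - w t) a b = ii u a b - ii w a b.
Proof.
move=> [u1 u2] [w1 w2]; apply: complex_ext; rewrite ?ReD ?ImD ?ReN ?ImN /=.
  under eq_Rintegral do rewrite ReD ReN.
  by rewrite RintegralB //; exact: integrable_cont.
under eq_Rintegral do rewrite ImD ImN.
by rewrite RintegralB //; exact: integrable_cont.
Qed.

(** The factor 2 comes from estimating real and imaginary parts separately. *)
Lemma ii_near_cst u c a b (M : R) : a <= b -> ccont_on u a b ->
  (forall t, a <= t -> t <= b -> cabs (u t - c) <= M) ->
  cabs (ii u a b - c * (b - a)%:C) <= 2 * M * (b - a).
Proof.
move=> ab [u1 u2] H.
have key (v : R -> R) (k : R) : {within `[a, b], continuous v} ->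
   (forall t, a <= t -> t <= b -> `|v t - k| <= M) ->
   `|\int[mu]_(t in `[a, b]) v t - k * (b - a)| <= M * (b - a).
  move=> cv hv; have iv := integrable_cont cv.
  have muE : fine (mu `[a, b]) = b - a.
    rewrite lebesgue_measure_itv /= lte_fin; case: ltP => // ba /=.
    by lra.
  have ck k' : mu.-integrable `[a, b] (EFin \o (fun=> k')).
    by apply: integrable_cont; apply: continuous_subspaceT => t; exact: cvg_cst.
  have ek k' : \int[mu]_(t in `[a, b]) k' = k' * (b - a) by rewrite Rintegral_cst // muE.
  rewrite -!ek -RintegralB //; apply: le_trans (le_normr_Rintegral _ _) _ => //.
    have cvk : {within `[a, b], continuous (fun t => v t - k)}.
      by move=> t; apply: cvgB; [exact: cv|exact: cvg_cst].
    exact: integrable_cont cvk.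
  apply: le_Rintegral => //.
    apply: integrable_norm => //.
    have cvk : {within `[a, b], continuous (fun t => v t - k)}.
      by move=> t; apply: cvgB; [exact: cv|exact: cvg_cst].
    exact: integrable_cont cvk.
  by move=> t /=; rewrite in_itv /= => /andP[]; exact: hv.
apply: le_trans (cabs_le_ReIm _) _.
rewrite ReD ImD ReN ImN ReM ImM /= !mulr0 subr0 add0r.
have -> : 2 * M * (b - a) = M * (b - a) + M * (b - a) by ring.
apply: lerD; apply: key => // t h1 h2.
  by rewrite -ReN -ReD; apply: le_trans (Re_le_cabs _) (H _ h1 h2).
by rewrite -ImN -ImD; apply: le_trans (Im_le_cabs _) (H _ h1 h2).
Qed.

Lemma circle_int_ii u : circle_int u = ((2 * pi)^-1)%:C * ii u 0 (2 * pi).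
Proof.
by apply: complex_ext; rewrite ?ReM ?ImM /= mul0r ?subr0 ?addr0.
Qed.

End IntervalIntegral.

(** * Cauchy's theorem on rectangles of the left half-plane, the logarithmic image of the punctured
    disc *)

Section Goursat.
Variable R : realType.
Variable G : R[i] -> R[i].
Hypothesis G_diff : forall s, complex.Re s < 0 -> exists d, cdiff G s d.
Implicit Types (x y w h : R).

Local Notation hseg y a b := (ii (fun x => G (x +i* y)) a b).
Local Notation vseg x a b := (ii (fun y => G (x +i* y)) a b).

Lemma hcont y a b : b < 0 -> ccont_on (fun x => G (x +i* y)) a b.
Proof.
move=> b0; apply: ccont_onP => x ax xb e e0.
have [d Gd] := G_diff (s := x +i* y) (le_lt_trans xb b0).
have [r r0 hr] := cdiff_continuous Gd e0; exists r => // x' xx'; apply: hr.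
have -> : (x' +i* y) - (x +i* y) = (x' - x)%:C by apply: complex_ext => /=; ring.
by rewrite cabs_real.
Qed.

Lemma vcont x a b : x < 0 -> ccont_on (fun y => G (x +i* y)) a b.
Proof.
move=> x0; apply: ccont_onP => y ay yb e e0.
have [d Gd] := G_diff (s := x +i* y) x0.
have [r r0 hr] := cdiff_continuous Gd e0; exists r => // y' yy'; apply: hr.
have -> : (x +i* y') - (x +i* y) = 'i * (y' - y)%:C by apply: complex_ext => /=; ring.
by rewrite cabsM cabs_real (_ : cabs 'i = 1) ?mul1r // cabs_sqrt /= expr0n add0r expr1n sqrtr1.
Qed.

(** The integral of G, counterclockwise, along the boundary of the rectangle with lower left corner
    x + iy. *)
Definition rect_int x y w h : R[i] :=
  hseg y x (x + w) - hseg (y + h) x (x + w) +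
  'i * (vseg (x + w) y (y + h) - vseg x y (y + h)).

Lemma rect_split x y w h : 0 < w -> 0 < h -> x + w < 0 ->
  rect_int x y w h =
  rect_int x y (w / 2) (h / 2) + rect_int (x + w / 2) y (w / 2) (h / 2) +
  rect_int x (y + h / 2) (w / 2) (h / 2) + rect_int (x + w / 2) (y + h / 2) (w / 2) (h / 2).
Proof.
move=> w0 h0 xw; rewrite /rect_int.
have hs y' : hseg y' x (x + w) = hseg y' x (x + w / 2) + hseg y' (x + w / 2) (x + w).
  by apply: ii_split; [lra|lra|exact: hcont].
have vs x' : x' <= x + w -> vseg x' y (y + h) = vseg x' y (y + h / 2) + vseg x' (y + h / 2) (y + h).
  by move=> x'w; apply: ii_split; [lra|lra|apply: vcont; lra].
have -> : x + w / 2 + w / 2 = x + w by field.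
have -> : y + h / 2 + h / 2 = y + h by field.
rewrite !hs (vs x) ?(vs (x + w)) //; last by lra.
ring.
Qed.

(** Opposite sides are subtracted before integration. The affine part of G at s then becomes the
    constants - i d h and d w, whose contributions cancel exactly; what remains is at most 2e (w +
    h) pointwise. *)
Lemma rect_small (s d : R[i]) (e r : R) x y w h : 0 < w -> 0 < h -> x + w < 0 ->
  (forall z, cabs z < r -> cabs (G (s + z) - G s - d * z) <= e * cabs z) -> 0 <= e ->
  x <= complex.Re s -> complex.Re s <= x + w -> y <= complex.Im s -> complex.Im s <= y + h ->
  w + h < r -> cabs (rect_int x y w h) <= 4 * e * (w + h) ^+ 2.
Proof.
move=> w0 h0 xw H e0 sx1 sx2 sy1 sy2 wr.
have Eb x' y' : x <= x' -> x' <= x + w -> y <= y' -> y' <= y + h ->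
    cabs (G (x' +i* y') - G s - d * (x' +i* y' - s)) <= e * (w + h).
  move=> a1 a2 a3 a4; have zs : cabs (x' +i* y' - s) <= w + h.
    apply: le_trans (cabs_le_ReIm _) _; rewrite ReD ImD ReN ImN /=.
    by apply: lerD; rewrite ler_norml; apply/andP; split; lra.
  have := H (x' +i* y' - s) (le_lt_trans zs wr).
  rewrite (addrC s) subrK => hh; apply: le_trans hh _.
  by rewrite ler_wpM2l.
have cu y' : ccont_on (fun x => G (x +i* y')) x (x + w) by exact: hcont.
have cv x' : x' <= x + w -> ccont_on (fun y => G (x' +i* y)) y (y + h).
  by move=> xx; apply: vcont; lra.
rewrite /rect_int -iiB // -iiB //; try (by apply: cv; lra).
set A := ii _ _ _; set B := ii _ y _.
have hA : cabs (A - (- d * 'i * h%:C) * (x + w - x)%:C) <= 2 * (2 * (e * (w + h))) * (x + w - x).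
  apply: ii_near_cst; first by lra.
    exact: ccont_onB.
  move=> t t1 t2.
  have -> : G (t +i* y) - G (t +i* (y + h)) - - d * 'i * h%:C =
     (G (t +i* y) - G s - d * (t +i* y - s)) -
     (G (t +i* (y + h)) - G s - d * (t +i* (y + h) - s)).
    have -> : t +i* (y + h) = t +i* y + 'i * h%:C by apply: complex_ext => /=; ring.
    ring.
  apply: le_trans (cabsD _ _) _; rewrite cabsN.
  have := Eb t y t1 t2 (lexx _) ltac:(lra).
  have := Eb t (y + h) t1 t2 ltac:(lra) (lexx _); lra.
have hB : cabs (B - (d * w%:C) * (y + h - y)%:C) <= 2 * (2 * (e * (w + h))) * (y + h - y).
  apply: ii_near_cst; first by lra.
    by apply: ccont_onB; apply: cv; lra.
  move=> t t1 t2.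
  have -> : G ((x + w) +i* t) - G (x +i* t) - d * w%:C =
     (G ((x + w) +i* t) - G s - d * ((x + w) +i* t - s)) -
     (G (x +i* t) - G s - d * (x +i* t - s)).
    have -> : (x + w) +i* t = x +i* t + w%:C by apply: complex_ext => /=; ring.
    ring.
  apply: le_trans (cabsD _ _) _; rewrite cabsN.
  have := Eb (x + w) t ltac:(lra) (lexx _) t1 t2.
  have := Eb x t (lexx _) ltac:(lra) t1 t2; lra.
have -> : A + 'i * B = (A - (- d * 'i * h%:C) * (x + w - x)%:C) +
   'i * (B - (d * w%:C) * (y + h - y)%:C).
  have -> : x + w - x = w by ring.
  have -> : y + h - y = h by ring.
  ring.
apply: le_trans (cabsD _ _) _.
rewrite cabsM (_ : cabs 'i = 1) ?mul1r; last by rewrite cabs_sqrt /= expr0n add0r expr1n sqrtr1.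
have -> : 4 * e * (w + h) ^+ 2 = 2 * (2 * (e * (w + h))) * (x + w - x) + 2 * (2 * (e * (w + h))) * (y + h - y).
  ring.
exact: lerD.
Qed.

Definition good_rect (p : (R * R) * (R * R)) := [/\ 0 < p.2.1, 0 < p.2.2 & p.1.1 + p.2.1 < 0].
Definition rect_of (p : (R * R) * (R * R)) := rect_int p.1.1 p.1.2 p.2.1 p.2.2.

Definition quarter (p q : (R * R) * (R * R)) :=
  [/\ q.2 = (p.2.1 / 2, p.2.2 / 2), p.1.1 <= q.1.1 <= p.1.1 + p.2.1 / 2,
      p.1.2 <= q.1.2 <= p.1.2 + p.2.2 / 2 & cabs (rect_of p) / 4 <= cabs (rect_of q)].

(** The hypothesis [good_rect] stands under the existential so that [choice] yields a total
    successor map. *)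
Lemma quarter_exists p : exists q, good_rect p -> quarter p q.
Proof.
have [gp|gp] := pselect (good_rect p); last by exists p.
case: p gp => [[x y] [w h]] [/= w0 h0 xw].
have half (a b : R) : 0 < b -> a <= a <= a + b / 2 /\ a <= a + b / 2 <= a + b / 2.
  by move=> b0; rewrite !lexx lerDl andbT; split; rewrite divr_ge0 // ltW.
have [x1 x2] := half x _ w0; have [y1 y2] := half y _ h0.
have := rect_split y w0 h0 xw => E.
set A := rect_int x y (w / 2) (h / 2) in E.
set B := rect_int (x + w / 2) y (w / 2) (h / 2) in E.
set C := rect_int x (y + h / 2) (w / 2) (h / 2) in E.
set D := rect_int (x + w / 2) (y + h / 2) (w / 2) (h / 2) in E.
have tri : cabs (rect_int x y w h) <= cabs A + cabs B + cabs C + cabs D.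
  rewrite E; apply: le_trans (cabsD _ _) _; rewrite lerD2r.
  by apply: le_trans (cabsD _ _) _; rewrite lerD2r; exact: cabsD.
have Q x' y' : x <= x' <= x + w / 2 -> y <= y' <= y + h / 2 ->
    cabs (rect_int x y w h) / 4 <= cabs (rect_int x' y' (w / 2) (h / 2)) ->
    exists q, good_rect ((x, y), (w, h)) -> quarter ((x, y), (w, h)) q.
  by move=> h1 h2 h3; exists ((x', y'), (w / 2, h / 2)).
have [hA|hA] := leP (cabs (rect_int x y w h) / 4) (cabs A); first exact: (Q x y).
have [hB|hB] := leP (cabs (rect_int x y w h) / 4) (cabs B); first exact: (Q (x + w / 2) y).
have [hC|hC] := leP (cabs (rect_int x y w h) / 4) (cabs C); first exact: (Q x (y + h / 2)).
have [hD|hD] := leP (cabs (rect_int x y w h) / 4) (cabs D).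
  exact: (Q (x + w / 2) (y + h / 2)).
exists ((0,0),(0,0)) => _; clear E Q.
move: tri hA hB hC hD; move: (cabs A) (cabs B) (cabs C) (cabs D) (cabs _) => *.
by exfalso; lra.
Qed.

Lemma nested_point (a w : nat -> R) : (forall n, 0 <= w n) ->
  (forall n, a n <= a n.+1) -> (forall n, a n.+1 + w n.+1 <= a n + w n) ->
  exists x, forall n, a n <= x <= a n + w n.
Proof.
move=> w0 ai bd.
have am n m : (n <= m)%N -> a n <= a m.
  by move=> /(homo_leq (@lexx _ R) (@le_trans _ R) ai).
have bm n m : (n <= m)%N -> a m + w m <= a n + w n.
  move=> nm; have := @homo_leq R (fun n => - (a n + w n)) (fun x y => x <= y) (@lexx _ R)
    (fun y x z => @le_trans _ R y x z).
  move=> /(_ _ n m nm); rewrite lerN2; apply => k; by rewrite lerN2.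
have ab n m : a n <= a m + w m.
  apply: le_trans (am n (maxn n m) (leq_maxl _ _)) _.
  by apply: le_trans (bm m (maxn n m) (leq_maxr _ _)); rewrite lerDl.
exists (sup (range a)) => n; apply/andP; split.
  by apply: ub_le_sup; [exists (a 0%N + w 0%N) => _ [m _ <-]|exists n].
by apply: ge_sup; [exists (a 0%N); exists 0%N|move=> _ [m _ <-]].
Qed.

Lemma goursat x y w h : 0 < w -> 0 < h -> x + w < 0 -> rect_int x y w h = 0.
Proof.
move=> w0 h0 xw; apply/eqP; rewrite -cabs_eq0; apply/negPn/negP => I0.
have Ip : 0 < cabs (rect_int x y w h) by rewrite lt_def I0 cabs_ge0.
have [nxt hn] := choice quarter_exists.
pose p n := iter n nxt ((x, y), (w, h)).
have gp n : good_rect (p n) /\ (p n).2 = (w / 2 ^+ n, h / 2 ^+ n).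
  elim: n => [|n [g E]]; first by rewrite /p /= !expr0 !divr1.
  have [e1 /andP[_ e2] _ _] := hn _ g; rewrite /p iterS -/(p n) e1 E /=.
  split; last by congr (_, _); rewrite exprS; field; rewrite expf_neq0.
  case: g => g1 g2 g3; split; rewrite e1 /= ?divr_gt0 //.
  by move: e2 g3; lra.
have q n : quarter (p n) (p n.+1) by rewrite /p iterS; apply: hn; exact: (gp n).1.
have Ib n : cabs (rect_int x y w h) / 4 ^+ n <= cabs (rect_of (p n)).
  elim: n => [|n IH]; first by rewrite expr0 divr1 /p.
  have [_ _ _] := q n; apply: le_trans; rewrite exprSr invfM mulrA.
  by rewrite ler_pM2r // invr_gt0.
have [sx hsx] : exists sx, forall n, (p n).1.1 <= sx <= (p n).1.1 + (p n).2.1.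
  apply: nested_point => n; first by have [[/ltW]] := gp n.
    by have [_ /andP[]] := q n.
  by have [-> /andP[_ h2] _ _] := q n; move: h2 => /=; lra.
have [sy hsy] : exists sy, forall n, (p n).1.2 <= sy <= (p n).1.2 + (p n).2.2.
  apply: nested_point => n; first by have [[_ /ltW]] := gp n.
    by have [_ _ /andP[]] := q n.
  by have [-> _ /andP[_ h2] _] := q n; move: h2 => /=; lra.
have sx0 : sx < 0.
  by have /andP[_] := hsx 0%N; have [[_ _]] := gp 0%N; lra.
have [d Gd] := G_diff (s := sx +i* sy) sx0.
(* With this [e], [rect_small] bounds the N-th integral by |I| / (2 4^N), where I is the integral
   over the whole rectangle: half of the lower bound [Ib]. *)
pose e := cabs (rect_int x y w h) / (8 * (w + h) ^+ 2).
have wh : 0 < w + h by lra.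
have e0 : 0 < e by rewrite divr_gt0 // mulr_gt0 // exprn_gt0.
have [r r0 hr] := Gd e e0.
have [N hN] := @geo_small R (w + h) (1 / 2) ltac:(by rewrite divr_ge0) ltac:(lra) (ltW wh) r r0.
have := hN N (leqnn _); rewrite expr_div_n expr1n mul1r => hr'.
have [[g1 g2 g3] E] := gp N.
have /andP[a1 a2] := hsx N; have /andP[a3 a4] := hsy N.
have wN : (p N).2.1 + (p N).2.2 = (w + h) / 2 ^+ N by rewrite E /= mulrDl.
have := @rect_small (sx +i* sy) d e r _ _ _ _ g1 g2 g3 hr (ltW e0) a1 a2 a3 a4.
rewrite wN => /(_ hr'); have := Ib N; rewrite /rect_of => b1 b2.
have := le_trans b1 b2.
have p2 : 0 < 2 ^+ N :> R by rewrite exprn_gt0.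
have -> : 4 ^+ N = 2 ^+ N * 2 ^+ N :> R by rewrite -exprMn -natrM.
have -> : 4 * e * ((w + h) / 2 ^+ N) ^+ 2 =
  cabs (rect_int x y w h) / (2 ^+ N * 2 ^+ N) / 2.
  rewrite /e; field; by rewrite !gt_eqF.
have : 0 < cabs (rect_int x y w h) / (2 ^+ N * 2 ^+ N) by rewrite divr_gt0 // mulr_gt0.
lra.
Qed.

Hypothesis G_per : forall x, G (x +i* (2 * pi)) = G (x +i* 0).

(** Over a rectangle of height 2 pi the two horizontal sides cancel by periodicity. *)
Lemma circle_int_const x1 x2 : x1 < 0 -> x2 < 0 ->
  circle_int (fun t => G (x1 +i* t)) = circle_int (fun t => G (x2 +i* t)).
Proof.
wlog x12 : x1 x2 / x1 < x2.
  move=> H a b; have [h|h|->//] := ltgtP x1 x2; first exact: H.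
  by apply/esym; exact: H.
move=> a b; rewrite !circle_int_ii; congr (_ * _).
have := @goursat x1 0 (x2 - x1) (2 * pi).
rewrite subr_gt0 x12 (twopi_gt0 R) (addrC x1) subrK b => /(_ isT isT isT).
rewrite /rect_int add0r (addrC x1) subrK.
have -> : hseg (2 * pi) x1 x2 = hseg 0 x1 x2.
  by congr (_ +i* _); apply: eq_Rintegral => t _; rewrite G_per.
rewrite subrr add0r => /eqP; rewrite mulf_eq0 subr_eq0 => /orP[|/eqP ->//].
by move=> /eqP []; move/eqP; rewrite oner_eq0.
Qed.

End Goursat.

(** * Taylor coefficients and power series *)

Section Taylor.
Variable R : realType.
Implicit Types (c : nat -> R[i]) (z w : R[i]) (r t x : R).
Local Notation D := (@period R).

Lemma cis_cvg t : (cis t' : R[i]^o) @[t' --> t] --> (cis t : R[i]^o).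
Proof.
apply/(@ccvg_ReIm R _ (nbhs t)); split; first exact: continuous_cos.
exact: continuous_sin.
Qed.

Lemma circle_cvg (f : R[i] -> R[i]) r t d : cdiff f (r%:C * cis t) d ->
  (f (r%:C * cis t') : R[i]^o) @[t' --> t] --> (f (r%:C * cis t) : R[i]^o).
Proof.
move=> fd; apply/(@ccvgP R _ (nbhs t)) => e e0; have [s s0 hs] := cdiff_continuous fd e0.
have s1 : 0 < s / (`|r| + 1) by rewrite divr_gt0 // ltr_wpDl.
have /(@ccvgP R _ (nbhs t)) /(_ _ s1) := @cis_cvg t; apply: filterS => t' h.
rewrite cabsB; apply: hs; rewrite -mulrBr cabsM cabs_real cabsB.
move: h; rewrite ltr_pdivlMr ?ltr_wpDl // => h.
apply: le_lt_trans h; rewrite mulrC ler_wpM2l ?cabs_ge0 //; lra.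
Qed.

Definition diff_disc (f : R[i] -> R[i]) := forall z, cabs z < 1 -> exists d, cdiff f z d.

Lemma analytic_discP (f : R[i] -> R[i]) : analytic_disc (f : R[i]^o -> R[i]^o) <-> diff_disc f.
Proof.
split=> [H z z1|H z /discE z1]; first by apply: derivable_cdiff; apply: H; apply/discE.
by have [d] := H z z1; exact: cdiff_derivable.
Qed.

Lemma circle_continuous (f : R[i] -> R[i]) r : diff_disc f -> 0 <= r -> r < 1 ->
  continuous (fun t => complex.Re (f (r%:C * cis t))) /\
  continuous (fun t => complex.Im (f (r%:C * cis t))).
Proof.
move=> fd r0 r1; split => t; have [d Fd] : exists d, cdiff f (r%:C * cis t) d.
- by apply: fd; rewrite cabs_polar.
- by have /(@ccvg_ReIm R _ (nbhs t)) [] := circle_cvg Fd.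
- by apply: fd; rewrite cabs_polar.
- by have /(@ccvg_ReIm R _ (nbhs t)) [] := circle_cvg Fd.
Qed.

Lemma cint_circle (f : R[i] -> R[i]) r : diff_disc f -> 0 <= r -> r < 1 ->
  cint (fun t => f (r%:C * cis t)).
Proof.
by move=> fd r0 r1; have [h1 h2] := circle_continuous fd r0 r1; split; exact: rint_continuous.
Qed.

(** The condition on [cis] says that k is an integer. Then f(e^s) e^{ks} has period 2 pi i in the
    left half-plane, and its means over vertical segments agree; |z| = r is the segment at abscissa
    ln r. *)
Lemma circle_moment (f : R[i] -> R[i]) (k : R) r1 r2 : diff_disc f -> cis (k * (2 * pi)) = 1 ->
  0 < r1 -> r1 < 1 -> 0 < r2 -> r2 < 1 ->
  (expR (k * ln r1))%:C * circle_int (fun t => f (r1%:C * cis t) * cis (k * t)) =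
  (expR (k * ln r2))%:C * circle_int (fun t => f (r2%:C * cis t) * cis (k * t)).
Proof.
move=> fd kp r10 r11 r20 r21.
pose G s := f (cexp s) * cexp (k%:C * s).
have GE x y : G (x +i* y) = (expR (k * x))%:C * (f ((expR x)%:C * cis y) * cis (k * y)).
  rewrite /G /cexp ReM ImM /= !mul0r subr0 addr0; ring.
have Gd s : complex.Re s < 0 -> exists d, cdiff G s d.
  move=> s0; have [d fd'] : exists d, cdiff f (cexp s) d.
    by apply: fd; rewrite cabs_cexp expR_lt1.
  eexists; apply: (cdiffM (f := fun s => f (cexp s)) (g := fun s => cexp (k%:C * s))).
    by apply: cdiff_comp fd'; exact: cdiff_cexp.
  apply: (cdiff_comp (f := @cexp R) (g := fun s => k%:C * s)); last exact: cdiff_cexp.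
  by apply: (cdiffM (f := fun=> k%:C) (g := id)); [exact: cdiff_cst|exact: cdiff_id].
have Gp x : G (x +i* (2 * pi)) = G (x +i* 0).
  by rewrite !GE cis_2pi kp mulr0 !cis0.
have lr r : 0 < r -> r < 1 -> ln r < 0 by move=> a b; apply: ln_lt0; rewrite a b.
have := circle_int_const Gd Gp (lr _ r10 r11) (lr _ r20 r21).
have ci r : 0 < r -> r < 1 -> cint (fun t => f (r%:C * cis t) * cis (k * t)).
  move=> a b; apply: (@cint_mulb _ _ _ 1); first by apply: cint_circle => //; exact: ltW.
    exact: cmeas_cis.
  by move=> t; rewrite cabs_cis.
have E r : 0 < r -> r < 1 -> circle_int (fun t => G (ln r +i* t)) =
    (expR (k * ln r))%:C * circle_int (fun t => f (r%:C * cis t) * cis (k * t)).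
  move=> a b; rewrite -circle_intZ; last exact: ci.
  by apply: circle_int_eq => t _; rewrite GE lnK.
by rewrite !E.
Qed.

Lemma expR_ln_pow r n : 0 < r -> expR (n%:R * ln r) = r ^+ n.
Proof. by move=> r0; rewrite expRM_natl lnK. Qed.

(** The product of r^n with this coefficient does not depend on r, and it tends to 0 with r because
    f is bounded near 0. *)
Lemma fcm_circle0 (f : R[i] -> R[i]) r n : diff_disc f -> 0 < r -> r < 1 -> (0 < n)%N ->
  fcm (fun t => f (r%:C * cis t)) n = 0.
Proof.
move=> fd r0 r1 n0.
have H r' : 0 < r' -> r' < 1 -> (r ^+ n)%:C * fcm (fun t => f (r%:C * cis t)) n =
    (r' ^+ n)%:C * fcm (fun t => f (r'%:C * cis t)) n.
  move=> r'0 r'1; rewrite -!expR_ln_pow //; apply: circle_moment => //.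
  exact: cis_2pi_nat.
suff : (r ^+ n)%:C * fcm (fun t => f (r%:C * cis t)) n = 0.
  move=> /eqP; rewrite mulf_eq0 => /orP[|/eqP//].
  by rewrite -cabs_eq0 cabs_real normr_eq0 expf_eq0 n0 gt_eqF.
apply/eqP; rewrite -cabs_eq0 eq_le cabs_ge0 andbT; apply/ler_addgt0Pr => e e0; rewrite add0r.
have [d fd0] : exists d, cdiff f 0 d by apply: fd; rewrite cabs0.
have [s s0 hs] := cdiff_continuous fd0 ltr01.
pose M := cabs (f 0) + 1.
have M0 : 0 < M by rewrite /M ltr_wpDl ?cabs_ge0.
pose r' := Num.min (Num.min (s / 2) (1 / 2)) (e / M).
have r'0 : 0 < r' by rewrite /r' !lt_min !divr_gt0.
have [r's r'2 r'e] : [/\ r' <= s / 2, r' <= 1 / 2 & r' <= e / M].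
  by split; rewrite /r' !ge_min lexx ?orbT.
have r'1 : r' < 1 by lra.
rewrite (H r') // cabsM cabs_real ger0_norm; last by rewrite exprn_ge0 // ltW.
have fM : cabs (fcm (fun t => f (r'%:C * cis t)) n) <= M.
  apply: circle_int_bound; first by apply: cint_fcm; apply: cint_circle => //; exact: ltW.
  move=> t _; rewrite cabsM cabs_cis mulr1.
  have := hs (r'%:C * cis t); rewrite subr0 cabs_polar ?(ltW r'0) // => /(_ ltac:(lra)) h.
  have := cabsD (f (r'%:C * cis t) - f 0) (f 0); rewrite subrK /M; lra.
apply: (@le_trans _ _ (r' * M)); last by rewrite -ler_pdivlMr.
apply: ler_pM; rewrite ?cabs_ge0 ?exprn_ge0 ?(ltW r'0) //.
case: n n0 {H fM} => // n _; rewrite exprS ler_piMr ?(ltW r'0) //.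
by rewrite exprn_ile1 // ltW.
Qed.

(** Read off the circle of radius 1/2; by [taylor_fcp] every radius gives the same value. *)
Definition taylor (f : R[i] -> R[i]) n : R[i] :=
  fcp (fun t => f ((1 / 2)%:C * cis t)) n * (2 ^+ n)%:C.

Lemma taylor_fcp (f : R[i] -> R[i]) r n : diff_disc f -> 0 < r -> r < 1 ->
  fcp (fun t => f (r%:C * cis t)) n = taylor f n * (r ^+ n)%:C.
Proof.
move=> fd r0 r1.
have h0 : 0 < 1 / 2 :> R by rewrite divr_gt0.
have h1 : 1 / 2 < 1 :> R by lra.
have := @circle_moment f (- n%:R) r (1 / 2) fd.
rewrite mulNr cisN cis_2pi_nat conjc1 => /(_ erefl r0 r1 h0 h1).
have E r' : 0 < r' -> circle_int (fun t => f (r'%:C * cis t) * cis (- n%:R * t)) =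
    fcp (fun t => f (r'%:C * cis t)) n.
  by move=> _; apply: circle_int_eq => t _; rewrite mulNr cisN.
rewrite !E // !mulNr !expRN !expR_ln_pow //.
have rn : (r ^+ n)%:C != 0 by rewrite -cabs_eq0 cabs_real normr_eq0 expf_neq0 // gt_eqF.
rewrite fmorphV /= => h; apply: (mulfI (invr_neq0 rn)); rewrite h /taylor.
rewrite expr_div_n expr1n invf_div divr1; field; exact: rn.
Qed.

(** Real points are left out because [poisson_point] needs an angle interior to the period;
    [diff_disc_eq] restores them by continuity. *)
Lemma polar_im z : complex.Im z != 0 ->
  exists r t, [/\ z = r%:C * cis t, 0 < r, 0 < t & t < 2 * pi].
Proof.
case: z => x y /= y0.
pose r := cabs (x +i* y).
have r2 : r ^+ 2 = x ^+ 2 + y ^+ 2 by rewrite cabs_sqr.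
have y2 : 0 < y ^+ 2 by rewrite lt_def sqr_ge0 expf_neq0.
have r0 : 0 < r.
  rewrite lt_def cabs_ge0 andbT; apply/eqP => r0; move: r2; rewrite r0 expr0n /=.
  by have := sqr_ge0 x; lra.
have xr2 : (x / r) ^+ 2 < 1.
  by rewrite expr_div_n r2 ltr_pdivrMr; have := sqr_ge0 x; lra.
have xr : -1 < x / r < 1 by rewrite -ltr_norml -(@ltr_pXn2r _ 2) ?nnegrE // real_normK ?num_real // expr1n.
have [xr1 xr1'] := andP xr.
have xri : -1 <= x / r <= 1 by rewrite (ltW xr1) (ltW xr1').
pose a := acos (x / r).
have a0 : 0 < a by rewrite acos_gt0 // (ltW xr1) xr1'.
have ap : a < pi by rewrite acos_ltpi // xr1 (ltW xr1').
have ca : cos a = x / r by rewrite acosK.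
have sa : sin a = `|y| / r.
  rewrite sin_acos //.
  have -> : 1 - (x / r) ^+ 2 = (`|y| / r) ^+ 2.
    rewrite !expr_div_n real_normK ?num_real // r2; field; rewrite -r2 expf_neq0 // gt_eqF //.
  by rewrite sqrtr_sqr ger0_norm // divr_ge0 // ltW.
have pi0 := pi_gt0 R.
have [yp|yn] := ltP 0 y.
  exists r, a; split => //; last by lra.
  apply: complex_ext; rewrite ?ReM ?ImM /= ca ?sa ?(gtr0_norm yp); field; by rewrite gt_eqF.
have yl : y < 0 by rewrite lt_neqAle y0.
exists r, (2 * pi - a); split => //; [|lra|lra].
apply: complex_ext; rewrite ?ReM ?ImM /= ?cosB ?sinB mulr_natl cos2pi sin2pi ca ?sa ?(ltr0_norm yl);
  field; by rewrite gt_eqF.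
Qed.

(** Let u be f on the circle of radius r. For rho < 1 the Poisson series of u at rho e^{it} is the
    Taylor series of f at rho z. As rho tends to 1, the Poisson integral tends to u(t), since u is
    continuous, and the power series to its value at z. *)
Lemma taylor_pser_polar (f : R[i] -> R[i]) K r t : diff_disc f -> cbounded (taylor f) K ->
  0 < r -> r < 1 -> 0 < t -> t < 2 * pi ->
  f (r%:C * cis t) = pser (taylor f) (r%:C * cis t).
Proof.
move=> fd cK r0 r1 t0 tp.
pose u t := f (r%:C * cis t).
have iu : cint u by apply: cint_circle => //; exact: ltW.
pose z := r%:C * cis t.
have z1 : cabs z < 1 by rewrite /z cabs_polar // ltW.
have term rho n : 0 <= rho -> pois_term u (rho%:C * cis t) n = taylor f n * (rho%:C * z) ^+ n.
  move=> rh; case: n => [|n].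
    rewrite expr0 mulr1 /= -[LHS](_ : fcp u 0 = _); last first.
      by apply: circle_int_eq => s _; rewrite mul0r cis0 conjc1 mulr1.
    by rewrite taylor_fcp // expr0 mulr1.
  rewrite /= fcm_circle0 // mul0r addr0 taylor_fcp // rmorphXn /= /z !exprMn; ring.
have ser rho : 0 <= rho -> rho < 1 -> pser (taylor f) (rho%:C * z) =
    pois (fun t => complex.Re (u t)) (rho%:C * cis t) +i*
    pois (fun t => complex.Im (u t)) (rho%:C * cis t).
  move=> rh0 rh1; rewrite -pois_real /pser.
  have -> : (fun k => taylor f k * (rho%:C * z) ^+ k) = pois_term u (rho%:C * cis t).
    by apply/funext => k; rewrite term.
  by apply: csum_unique; apply: poisson_series iu; rewrite cabs_polar.
have [cr ci] := circle_continuous fd (ltW r0) r1.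
have reg v : continuous v -> rint v -> poisson_regular v t.
  move=> cv iv; apply: poisson_regular_cont => // e e0.
  have /cvgrPdist_lt /(_ e e0) /nbhs_ballP [s /= s0 hs] := cv t.
  by exists s => // y yt; rewrite distrC ltW //; apply: hs; rewrite /ball /= distrC.
apply/eqP; rewrite eq_sym -subr_eq0 -cabs_eq0 eq_le cabs_ge0 andbT.
apply/ler_addgt0Pr => e e0; rewrite add0r.
have e3 : 0 < e / 3 by rewrite divr_gt0.
have [s1 s10 h1] := poisson_point iu.1 t0 tp (reg _ cr iu.1) e3.
have [s2 s20 h2] := poisson_point iu.2 t0 tp (reg _ ci iu.2) e3.
have [s3 s30 h3] := cdiff_continuous (pser_cdiff cK z1) e3.
pose s := Num.min (Num.min s1 s2) (Num.min s3 1).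
have s0 : 0 < s by rewrite /s !lt_min s10 s20 s30 ltr01.
have [ss1 ss2 ss3 ss4] : [/\ s <= s1, s <= s2, s <= s3 & s <= 1].
  by split; rewrite /s !ge_min lexx ?orbT.
pose rho := 1 - s / 2.
have [rh0 rh1] : 0 <= rho /\ rho < 1 by rewrite /rho; split; lra.
have a1 := h1 rho ltac:(rewrite /rho; lra) rh1.
have a2 := h2 rho ltac:(rewrite /rho; lra) rh1.
have a3 : cabs (pser (taylor f) (rho%:C * z) - pser (taylor f) z) < e / 3.
  apply: h3; rewrite -[X in _ - X]mul1r -mulrBl -(rmorph1 (real_complex R)) -rmorphB cabsM cabs_real.
  have -> : `|rho - 1| = s / 2 by rewrite /rho addrAC subrr sub0r normrN gtr0_norm // divr_gt0.
  apply: le_lt_trans (_ : s / 2 * 1 < _); last by lra.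
  by rewrite ler_wpM2l ?(ltW z1) // divr_ge0 // ltW.
have a4 : cabs (pser (taylor f) (rho%:C * z) - u t) <= e / 3 + e / 3.
  rewrite ser //; apply: le_trans (cabs_le_ReIm _) _; rewrite ReD ImD ReN ImN /=.
  exact: lerD.
have key (A B X : R[i]) : A - B = - (X - A) + (X - B) by ring.
rewrite (key _ _ (pser (taylor f) (rho%:C * z))).
apply: le_trans (cabsD _ _) _; rewrite cabsN; apply: le_trans (lerD (ltW a3) a4) _.
by clear; lra.
Qed.

Lemma diff_disc_eq (f g : R[i] -> R[i]) z : diff_disc f -> diff_disc g -> cabs z < 1 ->
  (forall w, cabs w < 1 -> complex.Im w != 0 -> f w = g w) -> f z = g z.
Proof.
move=> fd gd z1 fg; have [zi|zi] := boolP (complex.Im z != 0); first exact: fg.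
move: zi; rewrite negbK => /eqP zi.
apply/eqP; rewrite -subr_eq0 -cabs_eq0 eq_le cabs_ge0 andbT.
apply/ler_addgt0Pr => e e0; rewrite add0r.
have e2 : 0 < e / 2 by rewrite divr_gt0.
have [d1 D1] := fd z z1; have [d2 D2] := gd z z1.
have [s1 s10 h1] := cdiff_continuous D1 e2; have [s2 s20 h2] := cdiff_continuous D2 e2.
pose s := Num.min (Num.min s1 s2) (1 - cabs z).
have s0 : 0 < s by rewrite /s !lt_min s10 s20 subr_gt0.
have [ss1 ss2 ss3] : [/\ s <= s1, s <= s2 & s <= 1 - cabs z].
  by split; rewrite /s !ge_min lexx ?orbT.
pose w : R[i] := z + 'i * (s / 2)%:C.
have wz : cabs (w - z) = s / 2.
  rewrite /w addrAC subrr add0r cabsM cabs_real gtr0_norm ?divr_gt0 //.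
  by rewrite (_ : cabs 'i = 1) ?mul1r // cabs_sqrt /= expr0n add0r expr1n sqrtr1.
have w1 : cabs w < 1 by have := cabsD (w - z) z; rewrite subrK wz; lra.
have wi : complex.Im w != 0.
  by rewrite /w ImD ImM /= zi mulr0 mul1r !add0r gt_eqF // divr_gt0.
have b1 := h1 w ltac:(lra); have b2 := h2 w ltac:(lra).
have key (A B X : R[i]) : A - B = - (X - A) + (X - B) by ring.
rewrite (key _ _ (f w)) {2}(fg w w1 wi).
apply: le_trans (cabsD _ _) _; rewrite cabsN; apply: le_trans (lerD (ltW b1) (ltW b2)) _.
by clear; lra.
Qed.

Lemma pser_diff_disc c K : cbounded c K -> diff_disc (pser c).
Proof. by move=> cK z z1; eexists; exact: pser_cdiff cK z1. Qed.

Lemma taylor_pser (f : R[i] -> R[i]) K z : diff_disc f -> cbounded (taylor f) K ->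
  cabs z < 1 -> f z = pser (taylor f) z.
Proof.
move=> fd cK z1; apply: diff_disc_eq => //; first exact: pser_diff_disc cK.
move=> w w1 /polar_im [r [t [wE r0 t0 tp]]]; rewrite wE; apply: taylor_pser_polar cK _ _ _ _ => //.
by move: w1; rewrite wE cabs_polar // ltW.
Qed.

Lemma fcp_pser c K r n : cbounded c K -> 0 <= r -> r < 1 ->
  fcp (fun t => pser c (r%:C * cis t)) n = c n * (r ^+ n)%:C.
Proof.
move=> cK r0 r1; have K0 : 0 <= K by apply: le_trans (cK 0%N); exact: cabs_ge0.
have y0 : 0 < 1 - r by lra.
apply/eqP; rewrite -subr_eq0 -cabs_eq0 eq_le cabs_ge0 andbT.
apply/ler_addgt0Pr => e e0; rewrite add0r.
have [N hN] := geo_small r0 r1 (divr_ge0 K0 (ltW y0)) e0.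
pose m := (maxn N n).+1.
have iu : cint (fun t => pser c (r%:C * cis t)).
  by apply: cint_circle => //; exact: pser_diff_disc cK.
pose q t := psum (fun k => c k * (r%:C * cis t) ^+ k) m.
have qE : q = (fun t => \sum_(k < m) (c k * (r ^+ k)%:C) * cis (k%:R * t)).
  apply/funext => t; apply: eq_bigr => k _; rewrite exprMn cis_exp rmorphXn; ring.
have ik k : cint (fun t => (c k * (r ^+ k)%:C) * cis (k%:R * t)) by apply: cintZ; exact: cint_cis.
have iq : cint q by rewrite qE; apply: cint_sum.
have fq : fcp q n = c n * (r ^+ n)%:C.
  rewrite qE /fcp.
  transitivity (circle_int (fun t => \sum_(k < m) (c k * (r ^+ k)%:C) *
     (cis (k%:R * t) * (cis (n%:R * t))^*%C))).
    by apply: circle_int_eq => t _; rewrite mulr_suml; apply: eq_bigr => k _; rewrite mulrA.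
  have ick (k : nat) : cint (fun t : R => cis (k%:R * t) * (cis (n%:R * t))^*%C).
    by apply: cint_fcp; exact: cint_cis.
  rewrite circle_int_sum; last by move=> k; apply: cintZ.
  have nm : (n < m)%N by rewrite ltnS leq_maxr.
  rewrite (bigD1 (Ordinal nm)) //= circle_intZ // circle_int_cis2 eqxx mulr1.
  rewrite big1 ?addr0 // => k kn; rewrite circle_intZ // circle_int_cis2.
  by rewrite (negbTE (_ : (k : nat) != n)) ?mulr0 //; apply: contra kn => /eqP kn; apply/eqP/val_inj.
rewrite -fq /fcp -circle_intB; [|exact: cint_fcp|exact: cint_fcp].
apply: le_trans (ltW (hN m _)); last by rewrite leqW // leq_maxl.
apply: circle_int_bound.
  have i1 := cint_fcp n iu; have i2 := cintZ (-1) (cint_fcp n iq).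
  by have := cintD i1 i2; under eq_fun do rewrite mulN1r.
move=> t _; rewrite -mulrBl cabsM cabs_conj cabs_cis mulr1.
have z1 : cabs (r%:C * cis t) < 1 by rewrite cabs_polar.
by have := geo_tail m (pser_geo cK z1); rewrite cabs_polar // mulrA mulrAC.
Qed.

Lemma taylor_unique c K (f : R[i] -> R[i]) : cbounded c K ->
  (forall z, cabs z < 1 -> f z = pser c z) -> taylor f = c.
Proof.
move=> cK fE; apply/funext => n.
have h1 : 1 / 2 < 1 :> R by lra.
have h0 : 0 <= 1 / 2 :> R by rewrite divr_ge0.
have -> : taylor f n = taylor (pser c) n.
  congr (_ * _); apply: circle_int_eq => t _; rewrite fE //.
  by rewrite cabs_polar.
rewrite /taylor (fcp_pser n cK h0 h1) -mulrA -rmorphM -exprMn.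
by rewrite mul1r mulVf ?expr1n ?mulr1 // pnatr_eq0.
Qed.

End Taylor.

(** * H^2 and its boundary functions *)

Section SquareSummable.
Variable R : realType.
Implicit Types (c d : nat -> R[i]) (z w : R[i]) (r t x : R) (u : R -> R[i]).
Local Notation D := (@period R).

Definition l2 c (C : R) := forall N, \sum_(n < N) cabs (c n) ^+ 2 <= C.

Definition trig c N (t : R) : R[i] := \sum_(k < N) c k * cis (k%:R * t).

Lemma cint_trig c N : cint (trig c N).
Proof.
by rewrite /trig; apply: cint_sum => k; apply: cintZ; exact: cint_cis.
Qed.

Lemma trig_bound c N : exists M : R, forall t, cabs (trig c N t) <= M.
Proof.
exists (\sum_(k < N) cabs (c k)) => t; apply: le_trans (cabs_sum _ _ _) _.
by apply: ler_sum => k _; rewrite cabsM cabs_cis mulr1.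
Qed.

Lemma cint_mul_trig u c N : cint u -> cint (fun t => u t * (trig c N t)^*%C).
Proof.
move=> iu; have [M hM] := trig_bound c N; apply: (@cint_mulb _ _ _ M) => //.
  by apply: cmeas_conj; apply: cint_meas; exact: cint_trig.
by move=> t; rewrite cabs_conj.
Qed.

Lemma circle_int_trig u c N : cint u ->
  circle_int (fun t => u t * (trig c N t)^*%C) = \sum_(k < N) fcp u k * ((c k)^*)%C.
Proof.
move=> iu.
transitivity (circle_int (fun t => \sum_(k < N) ((c k)^*)%C * (u t * (cis (k%:R * t))^*%C))).
  apply: circle_int_eq => t _; rewrite /trig rmorph_sum mulr_sumr; apply: eq_bigr => k _.
  rewrite -[LHS]/(u t * ((c k * cis (k%:R * t))^*)%C) conjM; ring.
rewrite circle_int_sum; last by move=> k; apply: cintZ; exact: cint_fcp.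
by apply: eq_bigr => k _; rewrite (circle_intZ _ (cint_fcp k iu)) mulrC.
Qed.

Lemma fcp_trig c N n : fcp (trig c N) n = if (n < N)%N then c n else 0.
Proof.
rewrite /fcp.
transitivity (circle_int (fun t => \sum_(k < N) c k * (cis (k%:R * t) * (cis (n%:R * t))^*%C))).
  by apply: circle_int_eq => t _; rewrite mulr_suml; apply: eq_bigr => k _; rewrite mulrA.
have ick (k : nat) : cint (fun t : R => cis (k%:R * t) * (cis (n%:R * t))^*%C).
  by apply: cint_fcp; exact: cint_cis.
rewrite circle_int_sum; last by move=> k; apply: cintZ.
case: ltnP => nN.
  rewrite (bigD1 (Ordinal nN)) //= circle_intZ // circle_int_cis2 eqxx mulr1.
  rewrite big1 ?addr0 // => k kn; rewrite circle_intZ // circle_int_cis2.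
  by rewrite (negbTE (_ : (k : nat) != n)) ?mulr0 //; apply: contra kn => /eqP kn; apply/eqP/val_inj.
rewrite big1 // => k _; rewrite circle_intZ // circle_int_cis2.
by rewrite (negbTE (_ : (k : nat) != n)) ?mulr0 // neq_ltn (leq_trans (ltn_ord k)).
Qed.

Lemma fcm_trig c N n : (0 < n)%N -> fcm (trig c N) n = 0.
Proof.
move=> n0; rewrite /fcm.
transitivity (circle_int (fun t => \sum_(k < N) c k * cis ((k + n)%:R * t))).
  apply: circle_int_eq => t _; rewrite mulr_suml; apply: eq_bigr => k _.
  by rewrite -mulrA -cisD natrD mulrDl.
rewrite circle_int_sum; last by move=> k; apply: cintZ; exact: cint_cis.
rewrite big1 // => k _; rewrite circle_intZ; last exact: cint_cis.
by rewrite circle_int_cis_nat ?mulr0 // addn_gt0 n0 orbT.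
Qed.

Lemma trig_inner c d N :
  circle_int (fun t => trig c N t * (trig d N t)^*%C) = \sum_(k < N) c k * ((d k)^*)%C.
Proof.
rewrite circle_int_trig; last exact: cint_trig.
by apply: eq_bigr => k _; rewrite fcp_trig ltn_ord.
Qed.

Lemma cavg_cabs2 u : cavg (fun t => cabs (u t) ^+ 2) = complex.Re (circle_int (fun t => u t * (u t)^*%C)).
Proof. by rewrite circle_intE; apply: cavg_eq => t _; rewrite mul_conj_cabs. Qed.

Lemma cavg_trig2 c N : cavg (fun t => cabs (trig c N t) ^+ 2) = \sum_(k < N) cabs (c k) ^+ 2.
Proof.
rewrite cavg_cabs2 trig_inner; elim: N => [|N IH]; first by rewrite !big_ord0.
by rewrite !big_ord_recr ReD IH mul_conj_cabs.
Qed.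

Lemma rint_cabs2 u (M : R) : cmeas u -> (forall t, cabs (u t) <= M) -> rint (fun t => cabs (u t) ^+ 2).
Proof.
move=> mu_ uM; apply: (@rint_bounded _ _ (M ^+ 2)); first exact: cmeas_cabs2.
move=> t _; rewrite ger0_norm ?exprn_ge0 ?cabs_ge0 //.
by rewrite ler_pXn2r ?nnegrE ?cabs_ge0 // (le_trans _ (uM t)) ?cabs_ge0.
Qed.

Lemma bessel u N : cint u -> rint (fun t => cabs (u t) ^+ 2) ->
  \sum_(k < N) cabs (fcp u k) ^+ 2 <= cavg (fun t => cabs (u t) ^+ 2).
Proof.
move=> iu iu2; pose c := fcp u; set S := \sum_(k < N) _.
have [M hM] := trig_bound c N.
have it2 : rint (fun t => cabs (trig c N t) ^+ 2).
  by apply: rint_cabs2 hM; apply: cint_meas; exact: cint_trig.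
have iut := cint_mul_trig c N iu.
have E1 : cavg (fun t => complex.Re (u t * (trig c N t)^*%C)) = S.
  rewrite -[LHS]/(complex.Re (circle_int (fun t => u t * (trig c N t)^*%C))).
  rewrite circle_int_trig // /S; elim: N {S hM it2 iut} => [|N IH]; first by rewrite !big_ord0.
  by rewrite !big_ord_recr ReD IH mul_conj_cabs.
have E t : cabs (u t - trig c N t) ^+ 2 =
   cabs (u t) ^+ 2 + (-2 * complex.Re (u t * (trig c N t)^*%C) + cabs (trig c N t) ^+ 2).
  by rewrite !cabs_sqr ReD ImD ReN ImN ReM Re_conj Im_conj; ring.
have : 0 <= cavg (fun t => cabs (u t - trig c N t) ^+ 2).
  by apply: cavg_ge0 => t _; exact: sqr_ge0.
rewrite (cavg_eq (fun t _ => E t)) cavgD //; last by apply: rintD => //; apply: rintZ; exact: iut.1.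
rewrite cavgD // ?cavgZ; last by apply: rintZ; exact: iut.1.
  rewrite E1 cavg_trig2 -/S; lra.
exact: iut.1.
Qed.

Lemma mean_squareE (f : R[i] -> R[i]) r : diff_disc f -> 0 <= r -> r < 1 ->
  rint (fun t => cabs (f (r%:C * cis t)) ^+ 2) /\
  mean_square (f : R[i]^o -> R[i]^o) r = (cavg (fun t => cabs (f (r%:C * cis t)) ^+ 2))%:E.
Proof.
move=> fd r0 r1; have [c1 c2] := circle_continuous fd r0 r1.
have i2 : rint (fun t => cabs (f (r%:C * cis t)) ^+ 2).
  apply: rint_continuous => t; under eq_fun do rewrite cabs_sqr.
  by apply: cvgD; [have := c1 t | have := c2 t] => h; exact: cvgM.
split=> //; exact: cavgE_ereal.
Qed.

Lemma l2_bounded c C : l2 c C -> cbounded c (C + 1).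
Proof.
move=> cC n; have := cC n.+1; rewrite big_ord_recr /= => h.
have h2 : cabs (c n) ^+ 2 <= C.
  by apply: le_trans h; rewrite lerDr; apply: sumr_ge0 => i _; exact: sqr_ge0.
by have := sqr_ge0 (cabs (c n) - 1); have := sqr_ge0 (cabs (c n)); lra.
Qed.

Lemma hardy2_mean (f : R[i] -> R[i]) : hardy2 (f : R[i]^o -> R[i]^o) <->
  diff_disc f /\ exists C : R, forall r, 0 <= r -> r < 1 ->
     cavg (fun t => cabs (f (r%:C * cis t)) ^+ 2) <= C.
Proof.
split=> [[/analytic_discP fd]|[fd [C hC]]].
  set S := ereal_sup _ => Soo; split => //; exists (fine S) => r r0 r1.
  have [i2 E] := mean_squareE fd r0 r1.
  have le : (mean_square (f : R[i]^o -> R[i]^o) r <= S)%E.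
    by apply: ereal_sup_ubound; exists r => //=; rewrite in_itv /= r0 r1.
  have Sfin : S \is a fin_num.
    rewrite fin_numE -ltey Soo andbT; apply/eqP => SN; move: le; rewrite E SN.
    by rewrite leeNy_eq.
  by rewrite -lee_fin fineK // -E.
split; first exact/analytic_discP.
apply: le_lt_trans (ltry C); apply: ge_ereal_sup => _ [r + <-].
rewrite /= in_itv /= => /andP[r0 r1].
by have [_ ->] := mean_squareE fd r0 r1; rewrite lee_fin hC.
Qed.

(** Bessel's inequality on the circle of radius r gives S r^{2N} <= C for the N-th partial sum S; N
    is fixed, so Bernoulli's inequality lets r tend to 1. *)
Lemma hardy2_l2 (f : R[i] -> R[i]) : hardy2 (f : R[i]^o -> R[i]^o) -> exists C, l2 (taylor f) C.
Proof.
move=> /hardy2_mean [fd [C hC]]; exists C => N.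
set S := \sum_(n < N) _.
have S0 : 0 <= S by apply: sumr_ge0 => i _; exact: sqr_ge0.
have key r : 0 < r -> r < 1 -> S * r ^+ (2 * N) <= C.
  move=> r0 r1; have [i2 _] := mean_squareE fd (ltW r0) r1.
  apply: le_trans (hC r (ltW r0) r1); apply: le_trans (bessel N (cint_circle fd (ltW r0) r1) i2).
  rewrite /S mulr_suml; apply: ler_sum => i _.
  rewrite taylor_fcp // cabsM cabs_real exprMn ger0_norm ?exprn_ge0 ?(ltW r0) //.
  rewrite -exprM ler_wpM2l ?sqr_ge0 // mulnC ler_wiXn2l ?(ltW r0) ?(ltW r1) //.
  by rewrite leq_mul2r (ltnW (ltn_ord i)) orbT.
have [->|Sn] := eqVneq S 0; first by apply: le_trans (hC 0 (lexx _) ltr01); apply: cavg_ge0 => t _; exact: sqr_ge0.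
have Sp : 0 < S by rewrite lt_def Sn.
apply/ler_addgt0Pr => e e0.
pose m := (2 * N)%N.
have d0 : 0 < S * (m%:R + 1) by rewrite mulr_gt0 // ltr_wpDl.
pose r := 1 - Num.min (1 / 2) (e / (S * (m%:R + 1))).
have h1 : 0 < Num.min (1 / 2) (e / (S * (m%:R + 1))) by rewrite lt_min !divr_gt0.
have h2 : Num.min (1 / 2) (e / (S * (m%:R + 1))) <= 1 / 2 by rewrite ge_min lexx.
have h3 : Num.min (1 / 2) (e / (S * (m%:R + 1))) * (S * (m%:R + 1)) <= e.
  by rewrite -ler_pdivlMr // ge_min lexx orbT.
have := key r ltac:(rewrite /r; lra) ltac:(rewrite /r; lra).
have := @bernoulli R r m ltac:(rewrite /r; lra) ltac:(rewrite /r; lra).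
rewrite -/m; move: h3 h1; rewrite /r; set y := Num.min _ _ => h3 h1 b k.
have := ler_wpM2l S0 b; have := mulr_ge0 S0 (ltW h1).
rewrite -/m in k; lra.
Qed.

Lemma hardy2_pser (f : R[i] -> R[i]) z : hardy2 (f : R[i]^o -> R[i]^o) -> cabs z < 1 ->
  f z = pser (taylor f) z.
Proof.
move=> hf z1; have [C /l2_bounded cC] := hardy2_l2 hf.
by apply: taylor_pser cC z1; have /hardy2_mean [] := hf.
Qed.

Lemma l2_scale c C r : l2 c C -> 0 <= r -> r <= 1 -> l2 (fun n => c n * (r ^+ n)%:C) C.
Proof.
move=> cC r0 r1 N; apply: le_trans (cC N); apply: ler_sum => i _.
rewrite cabsM cabs_real ger0_norm ?exprn_ge0 // exprMn ler_piMr ?sqr_ge0 //.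
by rewrite -exprM exprn_ile1.
Qed.

(** On each circle the partial sums have mean square at most [C], and Fatou's lemma passes this
    bound to f. *)
Lemma l2_hardy2 c C (f : R[i] -> R[i]) : l2 c C -> (forall z, cabs z < 1 -> f z = pser c z) ->
  hardy2 (f : R[i]^o -> R[i]^o).
Proof.
move=> cC fE; have cK := l2_bounded cC.
have fd : diff_disc f.
  move=> z z1; exists (pser (quot_coef c z) z); apply: cdiff_ext (pser_cdiff cK z1).
  exists (1 - cabs z); first by rewrite subr_gt0.
  by move=> w wz; rewrite fE //; have := cabsD (w - z) z; rewrite subrK; lra.
apply/hardy2_mean; split => //; exists C => r r0 r1.
pose c' n := c n * (r ^+ n)%:C.
have tE N t : trig c' N t = psum (fun k => c k * (r%:C * cis t) ^+ k) N.
  by apply: eq_bigr => k _; rewrite /c' exprMn cis_exp rmorphXn mulrA.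
have i2 N : rint (fun t => cabs (trig c' N t) ^+ 2).
  have [M hM] := trig_bound c' N.
  by apply: rint_cabs2 hM; apply: cint_meas; exact: cint_trig.
have [if2 _] := mean_squareE fd r0 r1.
have [] := @cavg_fatou R (fun N t => cabs (trig c' N t) ^+ 2) (fun t => cabs (f (r%:C * cis t)) ^+ 2) C i2.
- by move=> n t _; exact: sqr_ge0.
- exact: rint_meas.
- by move=> t _; exact: sqr_ge0.
- apply: aeD_all => t _.
  have z1 : cabs (r%:C * cis t) < 1 by rewrite cabs_polar.
  rewrite fE //; under eq_fun do rewrite tE.
  have h := @ccvg_cabs R _ _ eventually_filter _ _ (geo_cvg (pser_geo cK z1)).
  exact: (cvgM h h).
- by move=> N; rewrite cavg_trig2; exact: (l2_scale cC r0 (ltW r1)).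
by [].
Qed.

End SquareSummable.

(** * Boundary functions as limits almost everywhere *)

Section BoundaryValues.
Variable R : realType.
Implicit Types (c d : nat -> R[i]) (z w : R[i]) (r t x : R) (u : R -> R[i]).
Local Notation D := (@period R).
Local Notation mu := (@lebesgue_measure R).

(** Multiplying by the indicator of the complement of the exceptional null set makes the sequence
    converge everywhere, so that the limit is measurable. *)
Lemma cmeas_ae_lim (f : nat -> R -> R[i]) : (forall n, cmeas (f n)) ->
  aeD (fun t => exists l : R[i]^o, (f n t : R[i]^o) @[n --> \oo] --> l) ->
  exists u, cmeas u /\ aeD (fun t => (f n t : R[i]^o) @[n --> \oo] --> (u t : R[i]^o)).
Proof.
move=> mf [N [mN N0 sub]].
pose g n t := (\1_(~` N) t)%:C * f n t.
have mg n : cmeas (g n).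
  by apply: cmeasM (mf n); apply: cmeas_real; apply: measurable_indic; exact: measurableC.
pose u t : R[i] := limn (fun n => complex.Re (g n t)) +i* limn (fun n => complex.Im (g n t)).
have gu t : D t -> (g n t : R[i]^o) @[n --> \oo] --> (u t : R[i]^o).
  move=> Dt; have [tN|tN] := pselect (N t).
    have -> : (fun n => g n t : R[i]^o) = fun=> 0.
      apply/funext => n; rewrite /g indicE; have -> : t \in ~` N = false.
        by apply/negbTE; rewrite in_setC negbK; apply/mem_set.
      by rewrite mul0r.
    have -> : u t = 0.
      have g0 n : g n t = 0.
        rewrite /g indicE; have -> : t \in ~` N = false.
          by apply/negbTE; rewrite in_setC negbK; apply/mem_set.
        by rewrite mul0r.
      rewrite /u; under eq_fun do rewrite g0 /=; rewrite lim_cst //.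
      by under eq_fun do rewrite g0 /=; rewrite lim_cst.
    exact: cvg_cst.
  have gE n : g n t = f n t.
    by rewrite /g indicE; have -> : t \in ~` N by [apply/mem_set]; rewrite mul1r.
  have [l fl] : exists l : R[i]^o, (f n t : R[i]^o) @[n --> \oo] --> l.
    by apply: contrapT => h; apply: tN; apply: sub => /= /(_ Dt).
  have gl : (g n t : R[i]^o) @[n --> \oo] --> l by under eq_fun do rewrite gE.
  have [h1 h2] := (@ccvg_ReIm R _ _ eventually_filter _ _).1 gl.
  have -> : u t = l by apply: complex_ext => /=; apply: cvg_lim.
  exact: gl.
exists u; split.
  split.
    apply: (@measurable_fun_cvg _ _ _ D (fun n t => complex.Re (g n t))) => [n|t Dt].
      by have [] := mg n.
    by have [] := (@ccvg_ReIm R _ _ eventually_filter _ _).1 (gu t Dt).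
  apply: (@measurable_fun_cvg _ _ _ D (fun n t => complex.Im (g n t))) => [n|t Dt].
    by have [] := mg n.
  by have [] := (@ccvg_ReIm R _ _ eventually_filter _ _).1 (gu t Dt).
exists N; split => // t /= h; apply: contrapT => tN; apply: h => Dt.
have := gu t Dt; under eq_fun do rewrite /g indicE.
by have -> : t \in ~` N by [apply/mem_set]; under eq_fun do rewrite mul1r.
Qed.

(** The sum in the extended reals has finite integral by monotone convergence, hence is finite
    almost everywhere; [Q] is its real part [fine]. *)
Lemma ae_dominate (q : nat -> R -> R) (C : R) : (forall k, rint (q k)) ->
  (forall k t, 0 <= q k t) -> (forall K, \sum_(k < K) cavg (q k) <= C) ->
  exists Q, [/\ rint Q, forall t, 0 <= Q t & aeD (fun t => forall K, \sum_(k < K) q k t <= Q t)].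
Proof.
move=> iq q0 qC.
pose F (t : measurableTypeR R) : \bar R := (\sum_(0 <= k <oo) (q k t)%:E)%E.
have F0 t : (0 <= F t)%E by apply: nneseries_ge0 => k _ _; rewrite lee_fin.
have mq k : measurable_fun D (fun t => (q k t)%:E).
  by apply/measurable_EFinP; exact: rint_meas.
have mF : measurable_fun D F.
  by apply: ge0_emeasurable_sum => [k t Dt _|k _]; [rewrite lee_fin|exact: mq].
have p0 := twopi_gt0 R.
have Fint : (\int[mu]_(t in D) F t <= ((2 * pi) * C)%:E)%E.
  rewrite integral_nneseries //; [|exact: mD|by move=> k t _; rewrite lee_fin].
  apply: lime_le; first by apply: is_cvg_nneseries => k _ _; apply: integral_ge0 => t _; rewrite lee_fin.
  apply: nearW => K; rewrite (eq_bigr (fun k => ((2 * pi) * cavg (q k))%:E)).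
    rewrite sumEFin lee_fin -mulr_sumr ler_pM2l //; have := qC K.
    by rewrite big_mkord.
  move=> k _; have := cavgE_ereal (iq k) => h.
  by rewrite EFinM -h muleA -EFinM mulfV ?mul1e // gt_eqF.
have iF : mu.-integrable D F.
  apply/integrableP; split => //; apply: le_lt_trans (ltry (2 * pi * C)).
  apply: le_trans Fint; rewrite le_eqVlt; apply/orP; left; apply/eqP.
  by apply: eq_integral => t _; rewrite gee0_abs.
exists (fun t => fine (F t)); split.
- apply: (le_integrable (@mD R) _ _ iF).
    by apply/measurable_EFinP; apply: (@measurableT_comp _ _ _ _ _ _ (@fine R)) => //; exact: fine_measurable.
  move=> t _ /=; rewrite ger0_norm ?fine_ge0 // gee0_abs //.
  by have [|] := eqVneq (F t) +oo%E => [->|Ft]; rewrite ?leey // fineK // ge0_fin_numE // ltey.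
- by move=> t; exact: fine_ge0.
- have := integrable_ae (@mD R) iF; apply: filterS => t h Dt K.
  rewrite -lee_fin fineK; last exact: h.
  rewrite -sumEFin; have := @nneseries_lim_ge R (fun k => (q k t)%:E) xpredT 0 K.
  rewrite big_mkord; apply => k _; by rewrite lee_fin.
Qed.

Definition sum2 c N := \sum_(n < N) cabs (c n) ^+ 2.

Lemma sum2_le c m n : (m <= n)%N -> sum2 c m <= sum2 c n.
Proof.
move=> mn; rewrite /sum2 -(subnKC mn) big_split_ord /= lerDl.
by apply: sumr_ge0 => i _; exact: sqr_ge0.
Qed.

Lemma l2_tail c C : l2 c C -> forall e : R, 0 < e ->
  exists N, forall m n, (N <= m)%N -> (m <= n)%N -> sum2 c n - sum2 c m <= e.
Proof.
move=> cC e e0; have hs : has_sup (range (sum2 c)).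
  by split; [exists (sum2 c 0%N), 0%N|exists C => _ [n _ <-]; exact: cC].
have [_ [N _ <-] hN] := sup_adherent e0 hs.
exists N => m n Nm mn.
have : sum2 c n <= sup (range (sum2 c)) by apply: ub_le_sup; [case: hs|exists n].
have := sum2_le c Nm; lra.
Qed.

Definition rapid c (N : nat -> nat) := forall k, [/\ (k <= N k)%N, (N k <= N k.+1)%N &
  forall m, (N k <= m)%N -> sum2 c m - sum2 c (N k) <= (1 / 16) ^+ k].

(** A common subsequence for two sequences allows the inner product of two boundary functions to be
    computed along it. *)
Lemma rapid_exists2 c d C C' : l2 c C -> l2 d C' -> exists N, rapid c N /\ rapid d N.
Proof.
move=> cC dC.
have e0 k : 0 < (1 / 16) ^+ k :> R by rewrite exprn_gt0 // divr_gt0.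
have [F hF] := choice (fun k => l2_tail cC (e0 k)).
have [G hG] := choice (fun k => l2_tail dC (e0 k)).
pose N k := (\sum_(j < k.+1) (F j + G j + 1))%N.
have NF k : [/\ (F k <= N k)%N, (G k <= N k)%N & (k <= N k)%N].
  split.
  - by rewrite /N big_ord_recr /=; apply: leq_trans (leq_addl _ _); rewrite -addnA leq_addr.
  - by rewrite /N big_ord_recr /=; apply: leq_trans (leq_addl _ _); rewrite addnAC leq_addl.
  - elim: k => // k IH; rewrite /N big_ord_recr /= -/(N k) addn1 addnS ltnS.
    exact: leq_trans IH (leq_addr _ _).
have Ni k : (N k <= N k.+1)%N by rewrite /N [X in (_ <= X)%N]big_ord_recr leq_addr.
exists N; split => k; have [f1 g1 k1] := NF k; split => // m Nm.
  exact: (hF k).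
exact: (hG k).
Qed.

Lemma sum_mask (V : zmodType) (F : nat -> V) m M : (m <= M)%N ->
  \sum_(k < M) (if (k < m)%N then 0 else F k) = \sum_(k < M) F k - \sum_(k < m) F k.
Proof.
elim: M => [|M IH]; first by rewrite leqn0 => /eqP ->; rewrite !big_ord0 subrr.
rewrite leq_eqVlt => /orP[/eqP ->|]; first by rewrite subrr big1 // => i _; rewrite ltn_ord.
by rewrite ltnS => mM; rewrite !big_ord_recr /= IH // ltnNge mM /= addrAC.
Qed.

Definition cmask c m n : R[i] := if (n < m)%N then 0 else c n.

Lemma trig_mask c m M t : (m <= M)%N -> trig (cmask c m) M t = trig c M t - trig c m t.
Proof.
move=> mM; rewrite /trig -(@sum_mask _ (fun k => c k * cis (k%:R * t)) m M mM); apply: eq_bigr => k _.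
by rewrite /cmask; case: ifP => _; rewrite ?mul0r.
Qed.

Lemma sum2_mask c m M : (m <= M)%N -> sum2 (cmask c m) M = sum2 c M - sum2 c m.
Proof.
move=> mM; rewrite /sum2 -(@sum_mask _ (fun k => cabs (c k) ^+ 2) m M mM); apply: eq_bigr => k _.
by rewrite /cmask; case: ifP => _; rewrite ?cabs0 ?expr0n.
Qed.

Lemma rint_trig2 c N : rint (fun t => cabs (trig c N t) ^+ 2).
Proof.
have [M hM] := trig_bound c N.
by apply: rint_cabs2 hM; apply: cint_meas; exact: cint_trig.
Qed.

Lemma cmeas_trig c N : cmeas (trig c N).
Proof. by apply: cint_meas; exact: cint_trig. Qed.

(* Against tails [16 ^- k] the weights [4 ^+ k] keep the weighted increments
   summable in mean, which dominates the subsequence of partial sums. *)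
Lemma rapid_limit c N : rapid c N -> exists u G, [/\ cmeas u, rint G,
  aeD (fun t => (trig c (N k) t : R[i]^o) @[k --> \oo] --> (u t : R[i]^o)) &
  aeD (fun t => forall k, cabs (trig c (N k) t) ^+ 2 <= G t)].
Proof.
move=> rN; pose d k := trig (cmask c (N k)) (N k.+1).
have dE k t : d k t = trig c (N k.+1) t - trig c (N k) t.
  by apply: trig_mask; have [] := rN k.
pose q k t := 4 ^+ k * cabs (d k t) ^+ 2.
have iq k : rint (q k) by apply: rintZ; exact: rint_trig2.
have q0 k t : 0 <= q k t by rewrite mulr_ge0 ?sqr_ge0 // exprn_ge0.
have qC K : \sum_(k < K) cavg (q k) <= 2.
  apply: (@le_trans _ _ (\sum_(0 <= k < K) (1 / 4) ^+ k)); last first.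
    have := @geo_sum_le R (1 / 4) 0 K ltac:(by rewrite divr_ge0) ltac:(lra).
    have -> : (1 / 4) ^+ 0 / (1 - 1 / 4) = 4 / 3 :> R by rewrite expr0; field.
    by move=> /le_trans; apply; lra.
  rewrite big_mkord; apply: ler_sum => k _.
  rewrite cavgZ ?cavg_trig2 ?rint_trig2 // -/(sum2 _ _) //.
  have [_ Nk tl] := rN k; rewrite sum2_mask //.
  have k4 : 0 < 4 ^+ k :> R by rewrite exprn_gt0.
  apply: (@le_trans _ _ (4 ^+ k * (1 / 16) ^+ k)); first by rewrite ler_pM2l // tl.
  by rewrite -exprMn le_eqVlt; apply/orP; left; apply/eqP; congr (_ ^+ k); field.
have [Q [iQ Q0 hQ]] := ae_dominate iq q0 qC.
(* The weight 4^k turns the bound by Q into |d_k| <= sqrt Q 2^{-k}. *)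
have geo t : (forall K, \sum_(k < K) q k t <= Q t) ->
    geo_dominated (fun k => d k t) (Num.sqrt (Q t)) (1 / 2).
  move=> h; split; [by rewrite divr_ge0|lra|move=> k].
  have qk : q k t <= Q t.
    apply: le_trans (h k.+1); rewrite big_ord_recr /= lerDr; apply: sumr_ge0 => i _; exact: q0.
  have k2 : 0 < 2 ^+ k :> R by rewrite exprn_gt0.
  have e4 : 4 ^+ k = 2 ^+ k * 2 ^+ k :> R by rewrite -exprMn -natrM.
  rewrite expr_div_n expr1n mul1r ler_pdivlMr //.
  rewrite -(@ler_pXn2r _ 2) ?nnegrE ?sqrtr_ge0 //; last by rewrite mulr_ge0 ?cabs_ge0 // ltW.
  by rewrite sqr_sqrtr // exprMn mulrC [2 ^+ k ^+ 2]expr2 -e4.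
have tel t k : psum (fun k => d k t) k = trig c (N k) t - trig c (N 0%N) t.
  elim: k => [|k IH]; first by rewrite /psum big_ord0 subrr.
  by rewrite psumS IH dE addrC addrA subrK.
have [u [mu_ hu]] : exists u, cmeas u /\
    aeD (fun t => (trig c (N k) t : R[i]^o) @[k --> \oo] --> (u t : R[i]^o)).
  apply: cmeas_ae_lim; first by move=> n; exact: cmeas_trig.
  apply: aeD_mono hQ => t _ /geo /geo_cvg cv.
  exists (csum (fun k => d k t) + trig c (N 0%N) t).
  apply/(@ccvgP R _ _ eventually_filter) => e e0.
  have /(@ccvgP R _ _ eventually_filter) /(_ e e0) := cv.
  by apply: filterS => k; rewrite tel opprB addrA.
have [M hM] := trig_bound c (N 0%N).
(* The partial sums are at most M + 2 sqrt Q, whose square is at most 2 M^2 + 8 Q. *)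
exists u, (fun t => 2 * M ^+ 2 + 8 * Q t); split => //.
  by apply: rintD; [exact: rint_cst|exact: rintZ].
apply: aeD_mono hQ => t _ h k; have gt := geo t h.
have s0 := sqrtr_ge0 (Q t).
have b : cabs (trig c (N k) t) <= M + 2 * Num.sqrt (Q t).
  have -> : trig c (N k) t = trig c (N 0%N) t + psum (fun k => d k t) k by rewrite tel addrC subrK.
  apply: le_trans (cabsD _ _) _; apply: lerD => //.
  have := psum_diff (fun k => d k t) (leq0n k); rewrite {2}/psum big_ord0 subr0 => /le_trans; apply.
  case: gt => g1 g2 g3; apply: (@le_trans _ _ (\sum_(0 <= j < k) Num.sqrt (Q t) * (1 / 2) ^+ j)).
    by apply: ler_sum_nat => j _; exact: g3.
  rewrite -mulr_sumr mulrC ler_wpM2r //.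
  have := @geo_sum_le R (1 / 2) 0 k g1 g2.
  have -> : (1 / 2) ^+ 0 / (1 - 1 / 2) = 2 :> R by rewrite expr0; field.
  by [].
have M0 : 0 <= M by apply: le_trans (hM 0); exact: cabs_ge0.
apply: (@le_trans _ _ ((M + 2 * Num.sqrt (Q t)) ^+ 2)).
  by rewrite ler_pXn2r ?nnegrE ?cabs_ge0 // addr_ge0 // mulr_ge0.
have := sqr_ge0 (M - 2 * Num.sqrt (Q t)); have := sqr_sqrtr (Q0 t); lra.
Qed.

Lemma aeD_open : aeD (fun t : R => 0 < t /\ t < 2 * pi).
Proof.
exists ([set 0] `|` [set 2 * pi]); split.
- by apply: measurableU; exact: measurable_set1.
- apply/eqP; rewrite eq_le measure_ge0 andbT.
  have := @measureU2 _ _ _ mu [set 0] [set 2 * pi] (measurable_set1 0) (measurable_set1 (2 * pi)).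
  rewrite [X in (_ <= X + _)%E -> _](lebesgue_measure_set1 (0 : R)).
  by rewrite [X in (_ <= _ + X)%E -> _](lebesgue_measure_set1 (2 * pi : R)) adde0.
- move=> t /= h; apply: contrapT => h2; apply: h.
  rewrite /period /= in_itv /= => /andP[a b]; rewrite !lt_neqAle a b !andbT.
  by split; apply/eqP => e; apply: h2; [left|right]; rewrite -?e.
Qed.

Lemma ccvg_const_unique (v : nat -> R[i]) (l a : R[i]) (n0 : nat) :
  (v n : R[i]^o) @[n --> \oo] --> (l : R[i]^o) -> (forall n, (n0 <= n)%N -> v n = a) -> l = a.
Proof.
move=> vl H; apply/eqP; rewrite -subr_eq0 -cabs_eq0 eq_le cabs_ge0 andbT.
by apply: (@ccvg_bound _ _ _ _ n0 _ vl) => n /H ->; rewrite subrr cabs0.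
Qed.

Lemma sq_dom (x y : R) : 0 <= x -> x ^+ 2 <= y -> x <= y + 1.
Proof. by move=> x0 h; have := sqr_ge0 (x - 1); have := sqr_ge0 x; lra. Qed.

(** By dominated convergence, coefficients of u are limits of those of the partial sums, which are
    stationary in k because k <= N k. *)
Lemma rapid_coefs c N u (G : R -> R) : rapid c N -> cmeas u -> rint G ->
  aeD (fun t => (trig c (N k) t : R[i]^o) @[k --> \oo] --> (u t : R[i]^o)) ->
  aeD (fun t => forall k, cabs (trig c (N k) t) ^+ 2 <= G t) ->
  [/\ cint u, forall n, fcp u n = c n & forall n, (0 < n)%N -> fcm u n = 0].
Proof.
move=> rN mu_ iG hu hG.
have iG1 : rint (fun t => G t + 1) by apply: rintD => //; exact: rint_cst.
have key (w : R -> R[i]) : cmeas w -> (forall t, cabs (w t) = 1) ->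
    cint (fun t => u t * w t) /\
    ((circle_int (fun t => trig c (N k) t * w t) : R[i]^o) @[k --> \oo] -->
     (circle_int (fun t => u t * w t) : R[i]^o)).
  move=> mw w1; apply: (@circle_int_dct R (fun k t => trig c (N k) t * w t)
      (fun t => u t * w t) (fun t => G t + 1) _ _ _ iG1).
  - by move=> n; apply: cmeasM mw; exact: cmeas_trig.
  - exact: cmeasM.
  - apply: aeD_mono hu => t _ h.
    apply/(@ccvgP R _ _ eventually_filter) => e e0.
    have /(@ccvgP R _ _ eventually_filter) /(_ e e0) := h.
    by apply: filterS => k; rewrite -mulrBl cabsM w1 mulr1.
  - by apply: aeD_mono hG => t _ h k; rewrite cabsM w1 mulr1; apply: sq_dom (h k); exact: cabs_ge0.
have mc n : cmeas (fun t : R => (cis (n%:R * t))^*%C) by apply: cmeas_conj; exact: cmeas_cis.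
split.
- have [i1 _] := key (fun=> 1) (cmeas_cst _) (fun=> cabs1 R).
  by move: i1; under eq_fun do rewrite mulr1.
- move=> n; have [_ cv] := key _ (mc n) (fun t => etrans (cabs_conj _) (cabs_cis _)).
  apply: (@ccvg_const_unique _ _ _ n.+1 cv) => k nk.
  rewrite -[LHS]/(fcp (trig c (N k)) n) fcp_trig.
  by have [kN _ _] := rN k; rewrite (leq_trans nk kN).
- move=> n n0; have [_ cv] := key _ (cmeas_cis n%:R) (fun t => cabs_cis _).
  apply: (@ccvg_const_unique _ _ _ 0 cv) => k _.
  by rewrite -[LHS]/(fcm (trig c (N k)) n) fcm_trig.
Qed.

(** Since the coefficients of negative index vanish, the Poisson series of u is the power series of
    f. Hence f is the Poisson integral of u, and its radial limits exist at the Lebesgue points of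
    u. *)
Lemma coefs_radial c C (f : R[i] -> R[i]) u : l2 c C -> (forall z, cabs z < 1 -> f z = pser c z) ->
  cint u -> (forall n, fcp u n = c n) -> (forall n, (0 < n)%N -> fcm u n = 0) ->
  aeD (fun t => (f (r%:C * cis t) : R[i]^o) @[r --> (1 : R)^'-] --> (u t : R[i]^o)).
Proof.
move=> cC fE iu up um.
have fP z : cabs z < 1 -> f z = pois (fun t => complex.Re (u t)) z +i* pois (fun t => complex.Im (u t)) z.
  move=> z1; rewrite fE // -pois_real /pser.
  have -> : (fun k => c k * z ^+ k) = pois_term u z.
    apply/funext => -[|k]; rewrite /pois_term.
      rewrite expr0 mulr1 -up; apply: circle_int_eq => t _.
      by rewrite mul0r cis0 conjc1 mulr1.
    by rewrite up um // mul0r addr0.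
  by apply: csum_unique; exact: poisson_series.
have h1 := ae_poisson_regular iu.1; have h2 := ae_poisson_regular iu.2.
have h12 : aeD (fun t => [/\ 0 < t, t < 2 * pi, poisson_regular (fun t => complex.Re (u t)) t
   & poisson_regular (fun t => complex.Im (u t)) t]).
  have := aeD_open; rewrite /aeD; move: h1 h2; apply: filterS3 => t a b o Dt.
  by have [t0 tp] := o Dt; split => //; [exact: a|exact: b].
apply: aeD_mono h12 => t _ [t0 tp p1 p2].
apply/(@ccvgP R _ _ (at_left_proper_filter (1 : R))) => e e0.
have e4 : 0 < e / 4 by rewrite divr_gt0.
have [s1 s10 hs1] := poisson_point iu.1 t0 tp p1 e4.
have [s2 s20 hs2] := poisson_point iu.2 t0 tp p2 e4.
apply/nbhs_ballP; exists (Num.min (Num.min s1 s2) 1); first by rewrite /= !lt_min s10 s20 ltr01.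
move=> r; rewrite /ball /= !lt_min ltr_norml !ltr_norml => /andP[/andP[/andP[_ r1] /andP[_ r2]] /andP[_ r3]] rl.
have r0 : 0 <= r by lra.
rewrite fP ?cabs_polar //.
apply: le_lt_trans (cabs_le_ReIm _) _; rewrite ReD ImD ReN ImN /=.
rewrite distrC [X in _ + X]distrC.
have a := hs1 r ltac:(lra) rl; have b := hs2 r ltac:(lra) rl.
apply: le_lt_trans (lerD a b) _; lra.
Qed.

End BoundaryValues.

(** * The Hilbert space of square summable sequences *)

Section L2Sequences.
Variable R : realType.
Implicit Types (c d f : nat -> R[i]) (tau l : R[i]).

Definition l2seq c := exists C, l2 c C.

Definition n2 c : R := limn (sum2 c).

Definition sip c d : R[i] := csum (fun n => c n * ((d n)^*)%C).

Lemma sum2_cvg c : l2seq c -> sum2 c @ \oo --> n2 c.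
Proof.
move=> [C cC]; apply: nondecreasing_is_cvgn; first by move=> m n; exact: sum2_le.
by exists C => _ [n _ <-]; exact: cC.
Qed.

Lemma sum2_le_n2 c N : l2seq c -> sum2 c N <= n2 c.
Proof.
move=> lc; apply: limr_ge; first by apply/cvg_ex; exists (n2 c); exact: sum2_cvg.
by exists N => // n /= Nn; exact: sum2_le.
Qed.

Lemma n2_le c C : l2 c C -> n2 c <= C.
Proof.
move=> cC; apply: limr_le; first by apply/cvg_ex; exists (n2 c); apply: sum2_cvg; exists C.
by apply: nearW => n; exact: cC.
Qed.

Lemma n2_ge0 c : l2seq c -> 0 <= n2 c.
Proof. by move=> lc; apply: le_trans (sum2_le_n2 0 lc); rewrite /sum2 big_ord0. Qed.

Lemma l2_n2 c : l2seq c -> l2 c (n2 c).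
Proof. by move=> lc N; exact: sum2_le_n2. Qed.

Lemma n2_term c n : l2seq c -> cabs (c n) ^+ 2 <= n2 c.
Proof.
move=> lc; apply: le_trans (sum2_le_n2 n.+1 lc); rewrite /sum2 big_ord_recr /= lerDr.
by apply: sumr_ge0 => i _; exact: sqr_ge0.
Qed.

Definition addZ c tau d : nat -> R[i] := fun n => c n + tau * d n.

Lemma l2_addZ_le c tau d C C' : l2 c C -> l2 d C' ->
  l2 (addZ c tau d) (2 * C + 2 * (cabs tau ^+ 2 * C')).
Proof.
move=> cC dC N.
apply: (@le_trans _ _ (\sum_(n < N) (2 * cabs (c n) ^+ 2 + 2 * (cabs tau ^+ 2 * cabs (d n) ^+ 2)))).
  apply: ler_sum => n _; rewrite -exprMn -cabsM.
  apply: (@le_trans _ _ ((cabs (c n) + cabs (tau * d n)) ^+ 2)).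
    by rewrite ler_pXn2r ?nnegrE ?addr_ge0 ?cabs_ge0 // cabsD.
  have := sqr_ge0 (cabs (c n) - cabs (tau * d n)); lra.
rewrite big_split /= -!mulr_sumr lerD // ler_pM2l //; first exact: cC.
by rewrite ler_wpM2l ?sqr_ge0 //; exact: dC.
Qed.

Lemma l2_addZ c tau d : l2seq c -> l2seq d -> l2seq (addZ c tau d).
Proof. by move=> [C cC] [C' dC]; eexists; exact: (l2_addZ_le tau cC dC). Qed.

Lemma sip_cvg c d : l2seq c -> l2seq d ->
  (psum (fun n => c n * ((d n)^*)%C) N : R[i]^o) @[N --> \oo] --> (sip c d : R[i]^o).
Proof.
move=> [C cC] [C' dC]; apply: csum_cvg; apply: nondecreasing_is_cvgn.
  apply/nondecreasing_seqP => n; rewrite /series /= big_nat_recr //= lerDl; exact: cabs_ge0.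
exists (C + C') => _ [N _ <-]; rewrite /series /= big_mkord.
apply: (@le_trans _ _ (\sum_(n < N) (cabs (c n) ^+ 2 + cabs (d n) ^+ 2))).
  apply: ler_sum => n _; rewrite cabsM cabs_conj.
  have := sqr_ge0 (cabs (c n) - cabs (d n)); have := sqr_ge0 (cabs (c n)); have := sqr_ge0 (cabs (d n)); lra.
by rewrite big_split; apply: lerD; [exact: cC|exact: dC].
Qed.

Lemma sip_addZl c tau d e : l2seq c -> l2seq d -> l2seq e ->
  sip (addZ c tau d) e = sip c e + tau * sip d e.
Proof.
move=> lc ld le_; apply: csum_unique; apply/(@ccvgP R _ _ eventually_filter) => r r0.
have T0 : 0 < cabs tau + 1 by rewrite ltr_wpDl ?cabs_ge0.
have r2 : 0 < r / 2 / (cabs tau + 1) by rewrite !divr_gt0.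
have r2' : 0 < r / 2 by rewrite divr_gt0.
have /(@ccvgP R _ _ eventually_filter) /(_ _ r2') h1 := sip_cvg lc le_.
have /(@ccvgP R _ _ eventually_filter) /(_ _ r2) h2 := sip_cvg ld le_.
apply: filterS2 h1 h2 => N h1 h2.
have -> : psum (fun n => addZ c tau d n * ((e n)^*)%C) N =
   psum (fun n => c n * ((e n)^*)%C) N + tau * psum (fun n => d n * ((e n)^*)%C) N.
  rewrite /psum mulr_sumr -big_split /=; apply: eq_bigr => n _; rewrite /addZ; ring.
have key (a b p q t : R[i]) : a + t * b - (p + t * q) = (a - p) + t * (b - q) by ring.
rewrite key; apply: le_lt_trans (cabsD _ _) _; rewrite cabsM.
have : cabs tau * cabs (sip d e - psum (fun n => d n * ((e n)^*)%C) N) <= r / 2.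
  move: h2; rewrite ltr_pdivlMr // => h2; apply: le_trans (ltW h2).
  by rewrite mulrC ler_wpM2l ?cabs_ge0 // lerDl.
lra.
Qed.

Lemma sip_conj c d : l2seq c -> l2seq d -> sip d c = ((sip c d)^*)%C.
Proof.
move=> lc ld; apply: csum_unique.
have h := @ccvg_conj R _ _ eventually_filter _ _ (sip_cvg lc ld).
apply: cvg_trans h; apply: near_eq_cvg; apply: nearW => N.
rewrite /psum rmorph_sum /=; apply: eq_bigr => n _.
by rewrite -[LHS]/(((c n * ((d n)^*)%C)^*)%C) conjM conjcK mulrC.
Qed.

Lemma sip_addZr c tau d e : l2seq c -> l2seq d -> l2seq e ->
  sip e (addZ c tau d) = sip e c + (tau^*)%C * sip e d.
Proof.
move=> lc ld le_; rewrite (sip_conj (l2_addZ tau lc ld) le_) sip_addZl // conjD conjM.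
by rewrite -!sip_conj.
Qed.

Lemma sip_self c : l2seq c -> sip c c = (n2 c)%:C.
Proof.
move=> lc; apply: csum_unique; apply/(@ccvg_ReIm R _ _ eventually_filter).
have E N : psum (fun n => c n * ((c n)^*)%C) N = (sum2 c N)%:C.
  by rewrite /sum2 rmorph_sum; apply: eq_bigr => n _; rewrite mul_conj_cabs.
split; under eq_fun do rewrite E /=; first exact: sum2_cvg.
exact: cvg_cst.
Qed.

Lemma n2_addZ c tau d : l2seq c -> l2seq d ->
  n2 (addZ c tau d) = n2 c + 2 * complex.Re ((tau^*)%C * sip c d) + cabs tau ^+ 2 * n2 d.
Proof.
move=> lc ld; have lcd := l2_addZ tau lc ld.
have : (n2 (addZ c tau d))%:C = (n2 c)%:C + (tau^*)%C * sip c d + tau * (((sip c d)^*)%C + (tau^*)%C * (n2 d)%:C).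
  rewrite -!sip_self // sip_addZl // !sip_addZr // (sip_conj lc ld); ring.
move=> /(congr1 (@complex.Re R)) /= ->.
rewrite !ReD !ReM ?ReD ?ImD ?ReM ?ImM !Re_conj !Im_conj /= cabs_sqr; ring.
Qed.

Lemma Re_conj_scale (x : R) (z : R[i]) : complex.Re ((- (x%:C * z))^*%C * z) = - (x * cabs z ^+ 2).
Proof. by rewrite !ReM Re_conj Im_conj ReN ImN ReM ImM cabs_sqr /=; ring. Qed.

Lemma sip_cs c d : l2seq c -> l2seq d -> cabs (sip c d) ^+ 2 <= n2 c * n2 d.
Proof.
move=> lc ld; set s := sip c d.
have q (x : R) : 0 <= n2 c - 2 * x * cabs s ^+ 2 + x ^+ 2 * cabs s ^+ 2 * n2 d.
  have := n2_ge0 (l2_addZ (- (x%:C * s)) lc ld); rewrite n2_addZ // -/s.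
  rewrite cabsN cabsM cabs_real exprMn real_normK ?num_real //.
  have -> : complex.Re ((- (x%:C * s))^*%C * s) = - (x * cabs s ^+ 2).
    by rewrite Re_conj_scale.
  lra.
have c0 := n2_ge0 lc; have d0 := n2_ge0 ld; have s0 := sqr_ge0 (cabs s).
have [d00|dn] := eqVneq (n2 d) 0.
  rewrite d00 mulr0; rewrite leNgt; apply/negP => sp.
  have := q ((n2 c + 1) / (2 * cabs s ^+ 2)); rewrite d00 mulr0 addr0.
  have -> : 2 * ((n2 c + 1) / (2 * cabs s ^+ 2)) * cabs s ^+ 2 = n2 c + 1.
    by set y := cabs s ^+ 2 in sp *; field; rewrite gt_eqF.
  lra.
have dp : 0 < n2 d by rewrite lt_def dn.
have := q (n2 d)^-1.
have -> : n2 c - 2 * (n2 d)^-1 * cabs s ^+ 2 + (n2 d)^-1 ^+ 2 * cabs s ^+ 2 * n2 d =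
   n2 c - cabs s ^+ 2 / n2 d by field.
by rewrite subr_ge0 ler_pdivrMr.
Qed.

Lemma small_real (B : R) : (forall e, 0 < e -> B <= e) -> B <= 0.
Proof. by move=> h; apply/ler_addgt0Pr => e e0; rewrite add0r; exact: h. Qed.

Definition rcp (j : nat) : R := j.+1%:R^-1.

(* The Riesz representation on the graph of a functional: minimize
   |x|^2 - 2 Re l over pairs (x, l) of the graph. *)
Lemma riesz_graph (Gam : (nat -> R[i]) -> R[i] -> Prop) (C : R) :
  (exists x l, Gam x l) ->
  (forall x l, Gam x l -> l2seq x) ->
  (forall x l tau y m, Gam x l -> Gam y m -> Gam (addZ x tau y) (l + tau * m)) ->
  (forall x l, Gam x l -> cabs l ^+ 2 <= C * n2 x) ->
  exists f, l2seq f /\ forall x l, Gam x l -> sip x f = l.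
Proof.
move=> [x0 [l0 G0]] Gl Gadd Gb.
(* When l = <x, f>, this is |x - f|^2 - |f|^2. *)
pose J x l : R := n2 x - 2 * complex.Re l.
have Jlow x l : Gam x l -> - `|C| <= J x l.
  move=> g; have n0 := n2_ge0 (Gl _ _ g); have b := Gb _ _ g.
  have rl : `|complex.Re l| <= cabs l by exact: Re_le_cabs.
  have b1 : cabs l ^+ 2 <= `|C| * n2 x.
    by apply: le_trans b _; rewrite ler_wpM2r // ler_norm.
  have c0 := normr_ge0 C.
  have b2 : cabs l ^+ 2 <= ((`|C| + n2 x) / 2) ^+ 2.
    by apply: le_trans b1 _; have := sqr_ge0 (`|C| - n2 x); lra.
  have b3 : cabs l <= (`|C| + n2 x) / 2.
    by rewrite -(@ler_pXn2r _ 2) ?nnegrE ?cabs_ge0 // divr_ge0 // addr_ge0.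
  have := ler_norm (complex.Re l); rewrite /J; lra.
pose S : set R := [set - J p.1 p.2 | p in [set p | Gam p.1 p.2]].
have hs : has_sup S.
  split; first by exists (- J x0 l0), (x0, l0).
  by exists `|C| => _ [[x l] /= g <-]; rewrite lerNl; exact: Jlow.
pose m := - sup S.
have mJ x l : Gam x l -> m <= J x l.
  by move=> g; rewrite lerNl; apply: ub_le_sup; [case: hs|exists (x, l)].
have ex (j : nat) : exists p, Gam p.1 p.2 /\ J p.1 p.2 <= m + rcp j.
  have j0 : 0 < rcp j :> R by rewrite /rcp invr_gt0 ltr0n.
  have [_ [p gp <-] h] := sup_adherent j0 hs.
  by exists p; split => //; rewrite /m; move: (J _ _) h => Jv; set v := rcp j; move: (sup S) => sv; clear; lra.
have [p hp] := choice ex.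
pose X j := (p j).1; pose L j := (p j).2.
have GX j : Gam (X j) (L j) by have [] := hp j.
have JX j : J (X j) (L j) <= m + rcp j by have [] := hp j.
have lX j : l2seq (X j) by exact: Gl (GX j).
have par j k : n2 (addZ (X j) (-1) (X k)) <= 2 * rcp j + 2 * rcp k.
  have gm := Gadd _ _ 1 _ _ (GX j) (GX k).
  (* The sum minus half of itself is the midpoint; its value of J is at least m, and the
     parallelogram law bounds the distance of two near-minimizers. *)
  have gm2 := Gadd _ _ (- (1 / 2)%:C) _ _ gm gm.
  have := mJ _ _ gm2; rewrite /J.
  have ls := l2_addZ 1 (lX j) (lX k).
  rewrite !n2_addZ // sip_self //.
  have -> : complex.Re ((-1)^*%C * sip (X j) (X k)) = - complex.Re (sip (X j) (X k)).
    by rewrite ReM Re_conj Im_conj /=; ring.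
  have -> : complex.Re (((1 : R[i])^*)%C * sip (X j) (X k)) = complex.Re (sip (X j) (X k)).
    by rewrite conjc1 mul1r.
  rewrite !cabsN cabs1 cabs_real ger0_norm ?divr_ge0 // expr1n !mul1r n2_addZ // conjc1 mul1r cabs1 expr1n mul1r.
  have -> : complex.Re ((- (2^-1)%:C)^*%C * (n2 (X j) + 2 * complex.Re (sip (X j) (X k)) + n2 (X k))%:C) =
     - 2^-1 * (n2 (X j) + 2 * complex.Re (sip (X j) (X k)) + n2 (X k)).
    by rewrite ReM Re_conj Im_conj /=; ring.
  have -> : complex.Re (L j + L k + - (2^-1)%:C * (L j + L k)) =
     2^-1 * (complex.Re (L j) + complex.Re (L k)).
    by rewrite !ReD ReM ReN ImN ReD ImD /=; field.
  have := JX j; have := JX k; rewrite /J.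
  rewrite (_ : 2^-1 ^+ 2 = 4^-1 :> R); last by field.
  move: (n2 _) (n2 _) (complex.Re _) (complex.Re _) (complex.Re _) => a b s lj lk.
  clearbody m; move: (rcp j) (rcp k) => u v; clear; lra.
have invs (e : R) : 0 < e -> exists N : nat, forall j, (N <= j)%N -> rcp j <= e :> R.
  move=> e0; have /cvgrPdist_lt /(_ _ e0) [N _ hN] := @cvg_harmonic R.
  exists N => j /hN /=; rewrite sub0r normrN ger0_norm; first exact: ltW.
  by rewrite invr_ge0.
have cau n : exists v : R[i], (X j n : R[i]^o) @[j --> \oo] --> (v : R[i]^o).
  have cd (re : R[i] -> R) : (forall z, `|re z| <= cabs z) -> (forall z w, re (z - w) = re z - re w) ->
      cvgn (fun j => re (X j n)).
    move=> re1 reB; apply: cauchy_cvg; apply/cauchy_ballP => e e0.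
    have e4 : 0 < (e / 2) ^+ 2 / 4 by rewrite divr_gt0 // exprn_gt0 // divr_gt0.
    have [N hN] := invs _ e4.
    have key j k : (N <= j)%N -> (N <= k)%N -> `|re (X j n) - re (X k n)| < e.
      move=> Nj Nk; rewrite -reB; apply: le_lt_trans (re1 _) _.
      have b : cabs (X j n - X k n) ^+ 2 <= (e / 2) ^+ 2.
        have -> : X j n - X k n = addZ (X j) (-1) (X k) n by rewrite /addZ mulN1r.
        apply: le_trans (n2_term n (l2_addZ _ (lX j) (lX k))) _.
        apply: le_trans (par j k) _; have := hN j Nj; have := hN k Nk; lra.
      have : cabs (X j n - X k n) <= e / 2.
        by rewrite -(@ler_pXn2r _ 2) ?nnegrE ?cabs_ge0 // divr_ge0 // ltW.
      by move=> /le_lt_trans; apply; lra.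
    exists ([set re (X j n) | j in [set j | (N <= j)%N]], [set re (X j n) | j in [set j | (N <= j)%N]]).
      by split; exists N => // j Nj; exists j.
    by move=> [_ _] /= [[j Nj <-] [k Nk <-]]; exact: key.
  exists (limn (fun j => complex.Re (X j n)) +i* limn (fun j => complex.Im (X j n))).
  apply/(@ccvg_ReIm R _ _ eventually_filter); split.
    by apply: cd; [exact: Re_le_cabs|move=> z w; rewrite ReD ReN].
  by apply: cd; [exact: Im_le_cabs|move=> z w; rewrite ImD ImN].
have [f hf] := choice cau.
(* The estimate [par] with k sent to infinity, one partial sum at a time. *)
have dl j : l2 (addZ (X j) (-1) f) (2 * rcp j).
  move=> N; apply/ler_addgt0Pr => e e0.
  have fin : (fun k => sum2 (addZ (X j) (-1) (X k)) N) @ \oo --> sum2 (addZ (X j) (-1) f) N.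
    rewrite /sum2; elim: N => [|N IH].
      by under eq_fun do rewrite big_ord0; rewrite big_ord0; exact: cvg_cst.
    under eq_fun do rewrite big_ord_recr; rewrite big_ord_recr /=; apply: cvgD => //.
    have h : cabs (addZ (X j) (-1) (X k) N) @[k --> \oo] --> cabs (addZ (X j) (-1) f N).
      apply: (@ccvg_cabs R _ _ eventually_filter).
      apply/(@ccvgP R _ _ eventually_filter) => r r0.
      have /(@ccvgP R _ _ eventually_filter) /(_ _ r0) := hf N.
      apply: filterS => k; rewrite /addZ.
      have -> : X j N + -1 * f N - (X j N + -1 * X k N) = - (f N - X k N) by ring.
      by rewrite cabsN.
    exact: (cvgM h h).
  have e2 : 0 < e / 2 by rewrite divr_gt0.
  have [N0 hN0] := invs _ e2.
  rewrite -[X in X <= _]/(sum2 (addZ (X j) (-1) f) N) -(cvg_lim _ fin) //; apply: limr_le; first by apply/cvg_ex; eexists; exact: fin.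
  exists N0 => // k /= N0k; apply: le_trans (sum2_le_n2 N (l2_addZ _ (lX j) (lX k))) _.
  apply: le_trans (par j k) _; have := hN0 k N0k; lra.
have lf : l2seq f.
  have : l2seq (addZ (X 0%N) (-1) (addZ (X 0%N) (-1) f)).
    by apply: l2_addZ => //; exists (2 * rcp 0%N); exact: dl.
  congr l2seq; apply/funext => n; rewrite /addZ; ring.
exists f; split => // y l gy; have ly := Gl _ _ gy.
pose d := sip y f - l.
have n0 := n2_ge0 ly.
have sX (e : R) : 0 < e -> exists j, [/\ cabs (sip y (X j) - sip y f) <= e & rcp j <= e :> R].
  move=> e0; have e2 : 0 < e ^+ 2 / (2 * (n2 y + 1)).
    by rewrite divr_gt0 ?exprn_gt0 // mulr_gt0 // ltr_wpDl.
  have em : 0 < Num.min e (e ^+ 2 / (2 * (n2 y + 1))) by rewrite lt_min e0.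
  have [N /(_ N (leqnn _)) hN] := invs _ em; exists N; split; last first.
    by apply: le_trans hN _; rewrite ge_min lexx.
  have hN2 : rcp N <= e ^+ 2 / (2 * (n2 y + 1)).
    by apply: le_trans hN _; rewrite ge_min lexx orbT.
  have -> : sip y (X N) - sip y f = sip y (addZ (X N) (-1) f).
    rewrite sip_addZr // (_ : ((-1)^*)%C = -1) ?mulN1r //.
    by apply: complex_ext; rewrite ?Re_conj // Im_conj /= !oppr0.
  have lN : l2seq (addZ (X N) (-1) f) by eexists; exact: dl.
  rewrite -(@ler_pXn2r _ 2) ?nnegrE ?cabs_ge0 ?(ltW e0) //.
  apply: le_trans (sip_cs ly lN) _.
  apply: (@le_trans _ _ (n2 y * (2 * rcp N))); first by rewrite ler_wpM2l // n2_le.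
  apply: (@le_trans _ _ ((n2 y + 1) * (2 * (e ^+ 2 / (2 * (n2 y + 1)))))).
    by apply: ler_pM => //; [rewrite mulr_ge0 // /rcp invr_ge0|lra|rewrite ler_pM2l].
  rewrite le_eqVlt; apply/orP; left; apply/eqP; field; by rewrite gt_eqF // ltr_wpDl.
(* The limit f need not belong to the graph, so the variation is applied to a near-minimizer X j, in
   the direction - s conj(d) y, and the error e is removed at the end. *)
have var (s : R) : 0 < s -> 2 * s * cabs d ^+ 2 <= s ^+ 2 * cabs d ^+ 2 * n2 y.
  move=> s0; rewrite -subr_le0; apply: small_real => e e0.
  have K0 : 0 < 2 * s * cabs d + 1 by rewrite ltr_wpDl // !mulr_ge0 ?cabs_ge0 // ltW.
  have e1p : 0 < e / (2 * s * cabs d + 1) by rewrite divr_gt0.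
  have [j [h1 h2]] := sX _ e1p.
  have := mJ _ _ (Gadd _ _ (- (s%:C * (d^*)%C)) _ _ (GX j) gy).
  rewrite /J n2_addZ // (sip_conj ly (lX j)).
  set sy := sip y (X j) in h1 *.
  set e1 := e / _ in h1 h2 e1p.
  have key : complex.Re (((- (s%:C * (d^*)%C))^*)%C * (sy^*)%C) =
     complex.Re (- (s%:C * (d^*)%C) * (sy - sip y f)) - s * cabs d ^+ 2 + complex.Re (- (s%:C * (d^*)%C) * l).
    have -> : ((- (s%:C * (d^*)%C))^*)%C * (sy^*)%C = ((- (s%:C * (d^*)%C) * sy)^*)%C by rewrite conjM.
    rewrite Re_conj -[s * _ ^+ 2]/(s * cabs d ^+ 2).
    have -> : - (s%:C * (d^*)%C) * sy = - (s%:C * (d^*)%C) * (sy - sip y f) - s%:C * (d * (d^*)%C) + - (s%:C * (d^*)%C) * l.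
      by rewrite /d; ring.
    by rewrite mul_conj_cabs ReD [in LHS]ReD ReN ReM /= mul0r subr0.
  rewrite key cabsN cabsM cabs_conj cabs_real (ger0_norm (ltW s0)) exprMn ReD.
  have b : complex.Re (- (s%:C * (d^*)%C) * (sy - sip y f)) <= s * cabs d * e1.
    apply: le_trans (ler_norm _) _; apply: le_trans (Re_le_cabs _) _.
    rewrite cabsM cabsN cabsM cabs_conj cabs_real (ger0_norm (ltW s0)).
    by rewrite ler_wpM2l // mulr_ge0 ?cabs_ge0 // ltW.
  have Ee : e = e1 * (2 * s * cabs d + 1) by rewrite divfK // gt_eqF.
  have := JX j; rewrite /J; move: b h2 Ee; clear; lra.
have nz : 0 < n2 y + 1 by rewrite ltr_wpDl.
(* For this s one has s |y|^2 < 1, and the inequality [var] forces d = 0. *)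
have := var (n2 y + 1)^-1 ltac:(by rewrite invr_gt0).
set q := (n2 y + 1)^-1 => h.
have qn : q * (n2 y + 1) = 1 by rewrite mulVf // gt_eqF.
have q0 : 0 < q by rewrite invr_gt0.
have d0 := sqr_ge0 (cabs d).
have h2 : 2 * q * cabs d ^+ 2 <= q * cabs d ^+ 2.
  apply: le_trans h _; rewrite (_ : q ^+ 2 * _ * _ = q * cabs d ^+ 2 * (q * n2 y)); last by ring.
  rewrite ler_piMr //; first by rewrite mulr_ge0 // ltW.
  by move: qn; rewrite mulrDr mulr1; lra.
have h3 : q * cabs d ^+ 2 <= 0 by move: h2; lra.
have : cabs d ^+ 2 <= 0 by rewrite -(pmulr_rle0 _ q0).
rewrite le_eqVlt ltNge d0 orbF sqrf_eq0 cabs_eq0 => /eqP dE.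
by apply/eqP; rewrite -subr_eq0 -/d dE.
Qed.
End L2Sequences.

(** * Products, point evaluations and boundary values in H^2 *)

Section HardyAlgebra.
Variable R : realType.
Implicit Types (f g h a : R[i] -> R[i]) (z : R[i]) (r t x M : R) (u v w : R -> R[i]).
Local Notation D := (@period R).
Local Notation H2 f := (hardy2 (f : R[i]^o -> R[i]^o)).

Lemma hardy2_diff f : H2 f -> diff_disc f.
Proof. by move=> /hardy2_mean []. Qed.

Lemma hardy2_l2seq f : H2 f -> l2seq (taylor f).
Proof. exact: hardy2_l2. Qed.

Lemma l2seq_pser (c : nat -> R[i]) : l2seq c -> H2 (pser c) /\ taylor (pser c) = c.
Proof.
move=> [C cC]; split; first exact: (@l2_hardy2 R c C).
exact: taylor_unique (l2_bounded cC) _.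
Qed.

Lemma hardy2_addZ f tau g : H2 f -> H2 g -> H2 (fun z => f z + tau * g z) /\
  taylor (fun z => f z + tau * g z) = addZ (taylor f) tau (taylor g).
Proof.
move=> /hardy2_mean [fd [C hC]] /hardy2_mean [gd [C' hC']].
have sd : diff_disc (fun z => f z + tau * g z).
  move=> z z1; have [d fz] := fd z z1; have [d' gz] := gd z z1.
  by eexists; apply: cdiffD fz (cdiffM (cdiff_cst tau z) gz).
split; last first.
  apply/funext => n; rewrite /addZ /taylor.
  have h0 : 0 <= 1 / 2 :> R by rewrite divr_ge0.
  have h1 : 1 / 2 < 1 :> R by lra.
  have i1 := cint_fcp n (cint_circle fd h0 h1).
  have i2 := cint_fcp n (cint_circle gd h0 h1).
  rewrite mulrA -mulrDl; congr (_ * _); rewrite /fcp -(circle_intZ tau i2) -circle_intD //.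
    by apply: circle_int_eq => t _; rewrite mulrDl mulrA.
  exact: cintZ.
apply/hardy2_mean; split => //; exists (2 * C + 2 * cabs tau ^+ 2 * C') => r r0 r1.
have [i1 _] := mean_squareE fd r0 r1; have [i2 _] := mean_squareE gd r0 r1.
have [i3 _] := mean_squareE sd r0 r1.
apply: (@le_trans _ _ (cavg (fun t => 2 * cabs (f (r%:C * cis t)) ^+ 2 +
   (2 * cabs tau ^+ 2) * cabs (g (r%:C * cis t)) ^+ 2))).
  apply: cavg_le => //; first by apply: rintD; exact: rintZ.
  move=> t _; rewrite -mulrA -exprMn -cabsM; move: (f _) (tau * g _) => x y.
  have := cabsD x y; have := cabs_ge0 (x + y) => h1 h2.
  apply: (@le_trans _ _ ((cabs x + cabs y) ^+ 2)); first by rewrite ler_pXn2r ?nnegrE ?addr_ge0 ?cabs_ge0.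
  have := sqr_ge0 (cabs x - cabs y); lra.
rewrite cavgD; [|exact: rintZ|exact: rintZ]; rewrite !cavgZ //.
by apply: lerD; rewrite ler_wpM2l ?hC ?hC' // mulr_ge0 ?sqr_ge0.
Qed.

Definition bounded_disc f M := forall z, cabs z < 1 -> cabs (f z) <= M.

Lemma hardy_inftyP a : hardy_infty (a : R[i]^o -> R[i]^o) <->
  diff_disc a /\ exists M, bounded_disc a M.
Proof.
rewrite /hardy_infty /=; split=> -[/analytic_discP ad [M hM]]; split => //; exists M => z.
  by move=> /discE /hM; rewrite cabsE lecR.
by move=> /discE /hM; rewrite cabsE lecR.
Qed.

Lemma bounded_ge0 a M : bounded_disc a M -> 0 <= M.
Proof. by move=> h; apply: le_trans (h 0 _); rewrite ?cabs_ge0 ?cabs0. Qed.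

Lemma hardy2_mul a M f : diff_disc a -> bounded_disc a M -> H2 f -> H2 (fun z => a z * f z).
Proof.
move=> ad aM /hardy2_mean [fd [C hC]].
have sd : diff_disc (fun z => a z * f z).
  move=> z z1; have [d fz] := ad z z1; have [d' gz] := fd z z1.
  by eexists; exact: cdiffM fz gz.
apply/hardy2_mean; split => //; exists (M ^+ 2 * C) => r r0 r1.
have [i2 _] := mean_squareE fd r0 r1; have [i3 _] := mean_squareE sd r0 r1.
apply: (@le_trans _ _ (cavg (fun t => M ^+ 2 * cabs (f (r%:C * cis t)) ^+ 2))).
  apply: cavg_le => //; first exact: rintZ.
  move=> t _; rewrite cabsM exprMn ler_wpM2r ?sqr_ge0 // ler_pXn2r ?nnegrE ?cabs_ge0 ?(bounded_ge0 aM) //.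
  by apply: aM; rewrite cabs_polar.
by rewrite cavgZ // ler_wpM2l ?sqr_ge0 ?hC.
Qed.

Lemma diff_disc_cst (c : R[i]) : diff_disc (fun=> c).
Proof. by move=> z _; exists 0; exact: cdiff_cst. Qed.

Lemma hardy2_cst (c : R[i]) : H2 (fun=> c).
Proof.
apply/hardy2_mean; split; first exact: diff_disc_cst.
by exists (cabs c ^+ 2) => r _ _; rewrite cavg_cst.
Qed.

Lemma hardy_infty_hardy2 a M : diff_disc a -> bounded_disc a M -> H2 a.
Proof.
move=> ad aM; have := hardy2_mul ad aM (hardy2_cst 1).
by congr (H2 _); apply/funext => z; rewrite mulr1.
Qed.

(** Cauchy-Schwarz against the reproducing kernel at z, with coefficients conj(z)^n and squared norm
    1 / (1 - |z|^2). *)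
Lemma hardy2_point f z : H2 f -> cabs z < 1 ->
  cabs (f z) ^+ 2 * (1 - cabs z ^+ 2) <= n2 (taylor f).
Proof.
move=> hf z1; have lf := hardy2_l2seq hf.
pose e n : R[i] := ((z ^+ n)^*)%C.
have x0 := sqr_ge0 (cabs z).
have x1 : cabs z ^+ 2 < 1 by rewrite expr_lt1 ?cabs_ge0.
have le_ : l2 e (1 / (1 - cabs z ^+ 2)).
  move=> N; have := geo_sum_le 0 N x0 x1; rewrite big_mkord expr0 => h.
  apply: le_trans h; apply: ler_sum => n _.
  by rewrite /e cabs_conj cabsX -!exprM mulnC.
have -> : f z = sip (taylor f) e.
  rewrite (hardy2_pser hf z1) /pser /sip; congr csum; apply/funext => n; by rewrite /e conjcK.
have l2e : l2seq e by eexists; exact: le_.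
rewrite -ler_pdivlMr ?subr_gt0 //; apply: le_trans (sip_cs lf l2e) _.
by rewrite ler_wpM2l ?n2_ge0 // -div1r n2_le.
Qed.

(* A measurable representative of the boundary function, which is not known to
   be measurable itself. *)
Definition brep f u := [/\ cint u, rint (fun t => cabs (u t) ^+ 2) &
  aeD (fun t => (f (r%:C * cis t) : R[i]^o) @[r --> (1 : R)^'-] --> (u t : R[i]^o))].

Lemma brep_boundary f u : brep f u -> aeD (fun t => boundary (f : R[i]^o -> R[i]^o) t = u t).
Proof.
move=> [_ _]; apply: aeD_mono => t _ h; apply: (cvg_lim _ h); exact: norm_hausdorff.
Qed.

Lemma brep_unique f u v : brep f u -> brep f v -> aeD (fun t => u t = v t).
Proof.
move=> /brep_boundary h1 /brep_boundary h2; have := aeD_and h1 h2.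
by apply: aeD_mono => t _ [<- <-].
Qed.

Lemma cint_prod u v : cmeas u -> cmeas v -> rint (fun t => cabs (u t) ^+ 2) ->
  rint (fun t => cabs (v t) ^+ 2) -> cint (fun t => u t * (v t)^*%C).
Proof.
move=> mu_ mv iu iv; apply: (@cint_dom _ _ (fun t => cabs (u t) ^+ 2 + cabs (v t) ^+ 2)).
- by apply: cmeasM => //; exact: cmeas_conj.
- exact: rintD.
- move=> t _; rewrite cabsM cabs_conj.
  have := sqr_ge0 (cabs (u t) - cabs (v t)); have := sqr_ge0 (cabs (u t)); have := sqr_ge0 (cabs (v t)); lra.
Qed.

(** Along a common rapid subsequence, the inner products of the partial sums are partial sums of
    [sip], and dominated convergence takes them to the integral of u conj(v). *)
Lemma brep_pair f g : H2 f -> H2 g -> exists u v, [/\ brep f u, brep g v, forall n, fcp u n = taylor f n &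
  circle_int (fun t => u t * (v t)^*%C) = sip (taylor f) (taylor g)].
Proof.
move=> hf hg; have [C fC] := hardy2_l2 hf; have [C' gC] := hardy2_l2 hg.
have [N [rf rg]] := rapid_exists2 fC gC.
have [u [G [mu_ iG cu dG]]] := rapid_limit rf.
have [v [G' [mv iG' cv dG']]] := rapid_limit rg.
have [iu pu nu] := rapid_coefs rf mu_ iG cu dG.
have [iv pv nv] := rapid_coefs rg mv iG' cv dG'.
have sq (c : nat -> R[i]) (w : R -> R[i]) (F : R -> R) : cmeas w -> rint F ->
   aeD (fun t => (trig c (N k) t : R[i]^o) @[k --> \oo] --> (w t : R[i]^o)) ->
   aeD (fun t => forall k, cabs (trig c (N k) t) ^+ 2 <= F t) -> rint (fun t => cabs (w t) ^+ 2).
  move=> mw iF cw dF.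
  have [] // := @cavg_dct R (fun k t => cabs (trig c (N k) t) ^+ 2) (fun t => cabs (w t) ^+ 2) F _ _ _ iF _.
  - by move=> k; apply: cmeas_cabs2; exact: cmeas_trig.
  - exact: cmeas_cabs2.
  - apply: aeD_mono cw => t _ h; have := @ccvg_cabs R _ _ eventually_filter _ _ h => h2.
    exact: (cvgM h2 h2).
  - by apply: aeD_mono dF => t _ h k; rewrite ger0_norm ?sqr_ge0.
exists u, v; split; [| |exact: pu|].
- split; [exact: iu|exact: (sq _ _ _ mu_ iG cu dG)|].
  by apply: (coefs_radial fC _ iu pu nu) => z; exact: hardy2_pser.
- split; [exact: iv|exact: (sq _ _ _ mv iG' cv dG')|].
  by apply: (coefs_radial gC _ iv pv nv) => z; exact: hardy2_pser.
have [_ cc] := @circle_int_dct R (fun k t => trig (taylor f) (N k) t * (trig (taylor g) (N k) t)^*%C)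
   (fun t => u t * (v t)^*%C) (fun t => G t + G' t) ltac:(
     by move=> k; apply: cmeasM; [|apply: cmeas_conj]; exact: cmeas_trig)
   ltac:(by apply: cmeasM => //; exact: cmeas_conj) ltac:(
     have := aeD_and cu cv; apply: aeD_mono => t _ [h1 h2];
     exact: (cvgM h1 (@ccvg_conj R _ _ eventually_filter _ _ h2))) (rintD iG iG')
   ltac:(have := aeD_and dG dG'; apply: aeD_mono => t _ [h1 h2] k; rewrite cabsM cabs_conj;
     have := h1 k; have := h2 k;
     have := sqr_ge0 (cabs (trig (taylor f) (N k) t) - cabs (trig (taylor g) (N k) t));
     have := sqr_ge0 (cabs (trig (taylor f) (N k) t)); have := sqr_ge0 (cabs (trig (taylor g) (N k) t)); lra).
have sc : (circle_int (fun t => trig (taylor f) (N k) t * (trig (taylor g) (N k) t)^*%C) : R[i]^o)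
    @[k --> \oo] --> (sip (taylor f) (taylor g) : R[i]^o).
  apply/(@ccvgP R _ _ eventually_filter) => e e0.
  have /(@ccvgP R _ _ eventually_filter) /(_ e e0) [n0 _ hn] := sip_cvg (hardy2_l2seq hf) (hardy2_l2seq hg).
  exists n0 => // k /= n0k; rewrite trig_inner; apply: hn => /=.
  by have [kN _ _] := rf k; exact: leq_trans n0k kN.
have H := @norm_hausdorff R[i] R[i]^o.
by rewrite -[LHS](cvg_lim H cc) -[RHS](cvg_lim H sc).
Qed.

Lemma brep_exists f : H2 f -> exists u, brep f u.
Proof. by move=> hf; have [u [_ [hu _ _ _]]] := brep_pair hf hf; exists u. Qed.

Lemma brep_sip f g u v : H2 f -> H2 g -> brep f u -> brep g v ->
  circle_int (fun t => u t * (v t)^*%C) = sip (taylor f) (taylor g).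
Proof.
move=> hf hg bu bv; have [u' [v' [bu' bv' _ <-]]] := brep_pair hf hg.
apply: circle_int_ae; have := aeD_and (brep_unique bu bu') (brep_unique bv bv').
by apply: aeD_mono => t _ [-> ->].
Qed.

Lemma brep_cint_prod f g u v : brep f u -> brep g v -> cint (fun t => u t * (v t)^*%C).
Proof. by move=> [iu u2 _] [iv v2 _]; apply: cint_prod => //; exact: cint_meas. Qed.

Lemma brep_n2 f u : H2 f -> brep f u -> cavg (fun t => cabs (u t) ^+ 2) = n2 (taylor f).
Proof.
move=> hf bu; rewrite cavg_cabs2 (brep_sip hf hf bu bu) sip_self //.
exact: hardy2_l2seq.
Qed.

Lemma brep_mul f g k u v w : brep f u -> brep g v -> brep k w ->
  (forall z, cabs z < 1 -> k z = f z * g z) -> aeD (fun t => w t = u t * v t).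
Proof.
move=> [_ _ hu] [_ _ hv] [_ _ hw] kE; have := aeD_and hw (aeD_and hu hv).
apply: aeD_mono => t _ [h1 [h2 h3]]; have H := @norm_hausdorff R[i] R[i]^o.
rewrite -[LHS](cvg_lim H h1); apply: (cvg_lim H).
have FL : Filter (1 : R)^'- by case: (at_left_proper_filter (1 : R)).
have h4 := cvgM h2 h3; specialize (h4 FL).
apply: cvg_trans h4; apply: (@near_eq_cvg _ _ _ FL).
apply/nbhs_ballP; exists 1; first exact: ltr01.
move=> r; rewrite /ball /= ltr_norml => /andP[_ r3] rl.
by rewrite kE // cabs_polar //; lra.
Qed.

Lemma brep_bound a M u : bounded_disc a M -> brep a u -> aeD (fun t => cabs (u t) <= M).
Proof.
move=> aM [_ _]; apply: aeD_mono => t _ h.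
have h2 := @ccvg_cabs R _ _ (at_left_proper_filter (1 : R)) _ _ h.
rewrite -(cvg_lim _ h2) //; apply: limr_le; first by apply/cvg_ex; eexists; exact: h2.
apply/nbhs_ballP; exists 1; first exact: ltr01.
move=> r; rewrite /ball /= ltr_norml => /andP[_ r3] rl.
by apply: aM; rewrite cabs_polar //; lra.
Qed.

Lemma n2_mul a M f : diff_disc a -> bounded_disc a M -> H2 f ->
  n2 (taylor (fun z => a z * f z)) <= M ^+ 2 * n2 (taylor f).
Proof.
move=> ad aM hf; have haf := hardy2_mul ad aM hf.
have [w bw] := brep_exists haf; have [u bu] := brep_exists (hardy_infty_hardy2 ad aM).
have [v bv] := brep_exists hf.
rewrite -(brep_n2 haf bw) -(brep_n2 hf bv) -cavgZ; last by case: bv.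
apply: cavg_le_ae; [by case: bw|by apply: rintZ; case: bv|].
have := aeD_and (brep_mul bu bv bw (fun z _ => erefl)) (brep_bound aM bu).
apply: aeD_mono => t _ [-> h]; rewrite cabsM exprMn ler_wpM2r ?sqr_ge0 //.
by rewrite ler_pXn2r ?nnegrE ?cabs_ge0 ?(bounded_ge0 aM).
Qed.

(** On the circle conj(a) f conj(h) = f conj(a h), so orthogonality becomes an identity between
    inner products of coefficients. Range conditions are used only in this form afterwards. *)
Lemma coanalytic_toeplitzP a M f g : diff_disc a -> bounded_disc a M -> H2 f ->
  (is_coanalytic_toeplitz (a : R[i]^o -> R[i]^o) f g <-> H2 g /\ forall h, H2 h ->
    sip (taylor f) (taylor (fun z => a z * h z)) = sip (taylor g) (taylor h)).
Proof.
move=> ad aM hf; have ha := hardy_infty_hardy2 ad aM.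
have key h : H2 g -> H2 h ->
   L2_inner (fun t => (boundary (a : R[i]^o -> R[i]^o) t)^*%C * boundary (f : R[i]^o -> R[i]^o) t -
      boundary (g : R[i]^o -> R[i]^o) t) (boundary (h : R[i]^o -> R[i]^o)) =
   sip (taylor f) (taylor (fun z => a z * h z)) - sip (taylor g) (taylor h).
  move=> hg hh; have hah := hardy2_mul ad aM hh.
  have [ua ba] := brep_exists ha; have [uf bf] := brep_exists hf.
  have [ug bg] := brep_exists hg; have [uh bh] := brep_exists hh.
  have [w bw] := brep_exists hah.
  rewrite -(brep_sip hf hah bf bw) -(brep_sip hg hh bg bh) -(circle_intB (brep_cint_prod bf bw) (brep_cint_prod bg bh)).
  apply: circle_int_ae.
  have := aeD_and (aeD_and (brep_boundary ba) (brep_boundary bf)) (aeD_and (brep_boundary bg)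
    (aeD_and (brep_boundary bh) (brep_mul ba bh bw (fun z _ => erefl)))).
  apply: aeD_mono => t _ [[-> ->] [-> [-> ->]]]; rewrite conjM; ring.
split=> -[hg H]; (split; first exact: hg) => h hh.
  by apply/eqP; rewrite -subr_eq0 -key // H.
by rewrite key // H // subrr.
Qed.

Lemma fourier_taylor f (n : nat) : H2 f -> fourier_coef (f : R[i]^o -> R[i]^o) n = taylor f n.
Proof.
move=> hf; have [u [_ [bu _ <- _]]] := brep_pair hf hf.
apply: circle_int_ae; apply: aeD_mono (brep_boundary bu) => t _ ->.
by rewrite -pmulrn cisN.
Qed.

End HardyAlgebra.

(** * Coefficient bounds from |a p| *)

Section WeightedPoint.
Variable R : realType.
Implicit Types (f g : R[i] -> R[i]) (z : R[i]) (r t x : R).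
Local Notation D := (@period R).
Local Notation H2 f := (hardy2 (f : R[i]^o -> R[i]^o)).

Lemma Re_realM x z : complex.Re (x%:C * z) = x * complex.Re z.
Proof. by rewrite ReM /= mul0r subr0. Qed.

(* The Taylor coefficients of the analytic function whose real part is the
   Poisson integral of [u]. *)
Definition herglotz (u : R -> R) n : R[i] :=
  let v t := (u t)%:C in if n is 0 then fcp v 0 else 2 * fcp v n.

Section Weight.
Variables (u : R -> R) (B : R).
Hypothesis mu_ : measurable_fun D u.
Hypothesis uB : forall t, `|u t| <= B.

Let B0 : 0 <= B. Proof. exact: le_trans (uB 0). Qed.

Let iu : cint (fun t => (u t)%:C).
Proof.
apply: (@cint_bounded _ _ B); first exact: cmeas_real.
by move=> t _; rewrite cabs_real.
Qed.

Let ru : rint u.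
Proof. by case: iu. Qed.

Lemma herglotz_bounded : cbounded (herglotz u) (2 * B).
Proof.
have b n : cabs (fcp (fun t => (u t)%:C) n) <= B.
  apply: circle_int_bound; first exact: cint_fcp.
  by move=> t _; rewrite cabsM cabs_conj cabs_cis mulr1 cabs_real.
case=> [|n]; rewrite /herglotz; first by apply: le_trans (b 0%N) _; have := B0; lra.
by rewrite cabsM (_ : 2 = (2 : R)%:C) ?cabs_real ?ger0_norm ?ler_pM2l // rmorph_nat.
Qed.

Lemma Re_herglotz z : cabs z < 1 -> complex.Re (pser (herglotz u) z) = pois u z.
Proof.
move=> z1; have hp := poisson_series z1 iu; rewrite pois_real /= in hp.
have hq := geo_cvg (pser_geo herglotz_bounded z1).
have [h1 _] := (@ccvg_ReIm R _ _ eventually_filter _ _).1 hp.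
have [h2 _] := (@ccvg_ReIm R _ _ eventually_filter _ _).1 hq.
rewrite -[LHS](cvg_lim (@Rhausdorff R) h2) -[RHS](cvg_lim (@Rhausdorff R) h1).
congr (limn _); apply/funext => N.
rewrite /psum; elim: N => [|N IH]; first by rewrite !big_ord0.
rewrite !big_ord_recr !ReD IH; congr (_ + _).
case: N {IH} => [|n]; rewrite /herglotz /pois_term.
  rewrite expr0 mulr1 /fcp; congr complex.Re; apply: circle_int_eq => t _.
  by rewrite mul0r cis0 conjc1 mulr1.
have -> : fcm (fun t => (u t)%:C) n.+1 = ((fcp (fun t => (u t)%:C) n.+1)^*)%C.
  rewrite /fcp -circle_int_conj; last exact: cint_fcp.
  by apply: circle_int_eq => t _; rewrite conjM conjcK conjc_real.
rewrite -conjX -conjM ReD Re_conj -mulrA (_ : 2 = (2 : R)%:C); last by rewrite rmorph_nat.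
by rewrite Re_realM mulr_natl mulr2n.
Qed.

Lemma pois_bound z : cabs z < 1 -> `|pois u z| <= B.
Proof.
move=> z1; have ik := rint_pker z1 ru.
apply: le_trans (cavg_norm_le ik) _.
have ib : rint (fun t => B * pker z t).
  by apply: rintZ; have := rint_pker z1 (rint_cst 1); under eq_fun do rewrite mulr1.
apply: (@le_trans _ _ (cavg (fun t => B * pker z t))).
  apply: cavg_le => //; first exact: rint_abs.
  move=> t _; rewrite normrM ger0_norm ?pker_ge0 // mulrC ler_wpM2r ?pker_ge0 //.
rewrite cavgZ ?cavg_pker ?mulr1 //.
by have := rint_pker z1 (rint_cst 1); under eq_fun do rewrite mulr1.
Qed.

(** The dilation by rho of the outer function with squared boundary modulus e^u. For rho < 1 it is
    differentiable on the closed disc, so its boundary values are its own values there. *)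
Definition outer (rho : R) z : R[i] := cexp ((1 / 2)%:C * pser (herglotz u) (rho%:C * z)).

Lemma outer_cdiff rho z : cabs (rho%:C * z) < 1 -> exists d, cdiff (outer rho) z d.
Proof.
move=> h; have qd := pser_cdiff herglotz_bounded h.
have d1 := cdiffM (cdiff_cst rho%:C z) (cdiff_id z).
have d2 := cdiff_comp d1 qd.
have d3 := cdiffM (cdiff_cst (1 / 2)%:C z) d2.
by eexists; exact: (cdiff_comp d3 (cdiff_cexp _)).
Qed.

Lemma outer_cabs2 rho z : cabs (rho%:C * z) < 1 ->
  cabs (outer rho z) ^+ 2 = expR (pois u (rho%:C * z)).
Proof.
move=> h; rewrite /outer cabs_cexp Re_realM Re_herglotz // expr2 -expRD.
by congr expR; field.
Qed.

(* Point evaluation of [f * outer rho], since |outer rho|^2 is the exponential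
   of the Poisson integral of [u] at radius [rho]. *)
Lemma weighted_point_rho f v rho z : 0 <= rho -> rho < 1 -> H2 f -> brep f v -> cabs z < 1 ->
  cabs (f z) ^+ 2 * (1 - cabs z ^+ 2) * expR (pois u (rho%:C * z)) <=
  cavg (fun t => expR (pois u (rho%:C * cis t)) * cabs (v t) ^+ 2).
Proof.
move=> r0 r1 hf bv z1.
have rz w : cabs w <= 1 -> cabs (rho%:C * w) < 1.
  by move=> w1; rewrite cabsM cabs_real ger0_norm //; apply: le_lt_trans r1; rewrite ler_piMr.
have od : diff_disc (outer rho) by move=> w w1; apply: outer_cdiff; apply: rz; exact: ltW.
have ob : bounded_disc (outer rho) (Num.sqrt (expR B)).
  move=> w w1; rewrite -(@ler_pXn2r _ 2) ?nnegrE ?cabs_ge0 ?sqrtr_ge0 //.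
  rewrite outer_cabs2 ?rz ?(ltW w1) // sqr_sqrtr ?expR_ge0 // ler_expR.
  by apply: le_trans (ler_norm _) (pois_bound _); rewrite rz ?(ltW w1).
have hof := hardy2_mul od ob hf.
have := hardy2_point hof z1; rewrite cabsM exprMn outer_cabs2 ?rz ?(ltW z1) // => h.
rewrite mulrC mulrA; apply: le_trans h _.
have [w bw] := brep_exists hof; rewrite -(brep_n2 hof bw).
rewrite le_eqVlt; apply/orP; left; apply/eqP; apply: cavg_ae.
have [_ _ hv] := bv; have [_ _ hw] := bw.
apply: aeD_mono (aeD_and hv hw) => t _ [h2 h3].
have ct : cabs (rho%:C * cis t) < 1 by apply: rz; rewrite cabs_cis.
have [d hd] := outer_cdiff ct.
have FL : Filter (1 : R)^'- by case: (at_left_proper_filter (1 : R)).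
have h1 : (outer rho (r%:C * cis t) : R[i]^o) @[r --> (1 : R)^'-] --> (outer rho (cis t) : R[i]^o).
  apply/(@ccvgP R _ _ (at_left_proper_filter (1 : R))) => e e0.
  have [s s0 hs] := cdiff_continuous hd e0.
  apply/nbhs_ballP; exists s => //= r; rewrite /ball /= => rs _.
  rewrite cabsB; apply: hs; rewrite -{2}[cis t]mul1r -mulrBl cabsM cabs_cis mulr1.
  by rewrite -(rmorph1 (real_complex R)) -rmorphB cabs_real distrC.
have h4 := cvgM h1 h2; specialize (h4 FL).
have H := @norm_hausdorff R[i] R[i]^o.
have -> : w t = outer rho (cis t) * v t.
  by rewrite -[LHS](cvg_lim H h3) -[RHS](cvg_lim H h4).
by rewrite cabsM exprMn outer_cabs2.
Qed.

(** The limit rho -> 1 of [weighted_point_rho]: the left side is continuous in rho; on the right,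
    Poisson integrals converge to u almost everywhere and e^B |v|^2 dominates. *)
Lemma weighted_point f v z : H2 f -> brep f v -> cabs z < 1 ->
  cabs (f z) ^+ 2 * (1 - cabs z ^+ 2) * expR (pois u z) <=
  cavg (fun t => expR (u t) * cabs (v t) ^+ 2).
Proof.
move=> hf bv z1; pose rho n : R := 1 - n.+2%:R^-1.
have rho0 n : 0 <= rho n by rewrite subr_ge0 invf_le1 // ler1n.
have rho1 n : rho n < 1 by rewrite gtrBl invr_gt0.
have rhol (e : R) : 0 < e -> exists N : nat, forall n, (N <= n)%N -> 1 - rho n < e.
  move=> e0; have /cvgrPdist_lt /(_ _ e0) [N _ hN] := @cvg_harmonic R.
  exists N => n Nn; have := hN n.+1 (leqW Nn); rewrite sub0r normrN /harmonic /rho.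
  by rewrite ger0_norm ?invr_ge0 // opprB addrC subrK.
have [_ v2 _] := bv; have [iv _ _] := bv.
have conte := @continuous_expR R.
have ms n : measurable_fun D (fun t => expR (pois u ((rho n)%:C * cis t)) * cabs (v t) ^+ 2).
  apply: measurable_funM; last exact: rint_meas.
  apply: (@measurableT_comp _ _ _ _ _ _ (@expR R)) => //.
  rewrite (_ : (fun _ => _) = (fun t => complex.Re (pser (herglotz u) ((rho n)%:C * cis t)))).
    apply: measurable_continuous.
    by have [] := circle_continuous (pser_diff_disc herglotz_bounded) (rho0 n) (rho1 n).
  by apply/funext => t; rewrite Re_herglotz // cabs_polar.
have me : measurable_fun D (fun t => expR (u t) * cabs (v t) ^+ 2).
  by apply: measurable_funM; [apply: (@measurableT_comp _ _ _ _ _ _ (@expR R))|exact: rint_meas].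
have cv : aeD (fun t => expR (pois u ((rho n)%:C * cis t)) * cabs (v t) ^+ 2 @[n --> \oo] -->
    expR (u t) * cabs (v t) ^+ 2).
  have := ae_poisson_regular ru; have := aeD_open R; rewrite /aeD; apply: filterS2 => t o p Dt.
  have [t0 tp] := o Dt; have pp := p t0 tp.
  apply: cvgM; last exact: cvg_cst.
  apply: (continuous_cvg _ (conte _)).
  apply/cvgrPdist_le => e e0; have [s s0 hs] := poisson_point ru t0 tp pp e0.
  have [N hN] := rhol s s0; exists N => // n /= Nn; rewrite distrC; apply: hs => //.
  by have := hN n Nn; lra.
have bd : aeD (fun t => forall n, `|expR (pois u ((rho n)%:C * cis t)) * cabs (v t) ^+ 2| <=
    expR B * cabs (v t) ^+ 2).
  apply: aeD_all => t _ n; rewrite ger0_norm; last by apply: mulr_ge0; [exact: expR_ge0|exact: sqr_ge0].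
  rewrite ler_wpM2r ?sqr_ge0 // ler_expR.
  by apply: le_trans (ler_norm _) (pois_bound _); rewrite cabs_polar.
have [_ cc] := cavg_dct ms me cv (rintZ (expR B) v2) bd.
have cl : (fun n => cabs (f z) ^+ 2 * (1 - cabs z ^+ 2) * expR (pois u ((rho n)%:C * z))) @ \oo -->
   cabs (f z) ^+ 2 * (1 - cabs z ^+ 2) * expR (pois u z).
  apply: cvgM; first exact: cvg_cst.
  apply: (continuous_cvg _ (conte _)).
  apply/cvgrPdist_lt => e e0.
  have [s s0 hs] := cdiff_continuous (pser_cdiff herglotz_bounded z1) e0.
  have [N hN] := rhol s s0; exists N => // n /= Nn.
  have rz : cabs ((rho n)%:C * z) < 1.
    by rewrite cabsM cabs_real ger0_norm //; apply: le_lt_trans z1; rewrite ler_piMl ?cabs_ge0 // ltW.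
  rewrite -(Re_herglotz z1) -(Re_herglotz rz) distrC -ReN -ReD; apply: le_lt_trans (Re_le_cabs _) _.
  apply: hs; rewrite -{2}[z]mul1r -mulrBl cabsM -(rmorph1 (real_complex R)) -rmorphB cabs_real.
  rewrite distrC ger0_norm ?subr_ge0 ?(ltW (rho1 n)) //; apply: le_lt_trans (hN n Nn).
  by rewrite ler_piMr ?subr_ge0 ?ltW.
apply: (ler_cvg_to cl cc); apply: nearW => n; exact: weighted_point_rho.
Qed.

End Weight.
End WeightedPoint.

(** * Growth of the coefficients of p relative to the norm of a p *)

Section CoefficientBound.
Variable R : realType.
Local Notation D := (@period R).
Local Notation H2 f := (hardy2 (f : R[i]^o -> R[i]^o)).
Implicit Types (p : R[i] -> R[i]) (z : R[i]) (t e : R).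

Variables (a : R[i] -> R[i]) (M : R) (z0 : R[i]) (ua : R -> R[i]).
Hypotheses (ad : diff_disc a) (aM : bounded_disc a M).
Hypotheses (z01 : cabs z0 < 1) (az0 : a z0 != 0) (bua : brep a ua).

Let K := M ^+ 2.
Let K0 : 0 <= K. Proof. exact: sqr_ge0. Qed.

(** The cap is inactive almost everywhere, since |a|^2 <= K <= e^K there. It makes the bounds on
    [cut] hold at every t, as the weighted estimate demands. *)
Definition wt t := Num.min (cabs (ua t) ^+ 2) (expR K).
Definition wtN (N : nat) t := Num.max (wt t) (expR (- N%:R)).
(* [- ln |a|^2] truncated at level [N]; [wt] is [|a|^2] almost everywhere. *)
Definition cut (N : nat) t := - ln (wtN N t).

Lemma wt_ge0 t : 0 <= wt t.
Proof. by rewrite le_min sqr_ge0 expR_ge0. Qed.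

Lemma wtN_gt0 N t : 0 < wtN N t.
Proof. by rewrite lt_max expR_gt0 orbT. Qed.

Lemma wtN_le N t : wtN N t <= expR K.
Proof.
rewrite ge_max ge_min lexx orbT ler_expR /=.
by have := K0; have : 0 <= N%:R :> R by []; lra.
Qed.

Lemma wt_ae : aeD (fun t => wt t = cabs (ua t) ^+ 2).
Proof.
apply: aeD_mono (brep_bound aM bua) => t _ h; apply: min_l.
apply: (@le_trans _ _ K).
  by rewrite ler_pXn2r ?nnegrE ?cabs_ge0 ?(bounded_ge0 aM).
by have := expR_ge1Dx K; lra.
Qed.

Lemma expR_cut N t : expR (cut N t) = (wtN N t)^-1.
Proof. by rewrite expRN lnK // posrE wtN_gt0. Qed.

Lemma cut_ge N t : - K <= cut N t.
Proof. by rewrite lerN2 -[K]expRK ler_ln ?posrE ?wtN_gt0 ?expR_gt0 ?wtN_le. Qed.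

Lemma cut_le N t : cut N t <= N%:R.
Proof.
rewrite lerNl -[- N%:R]expRK ler_ln ?posrE ?wtN_gt0 ?expR_gt0 //.
by rewrite le_max lexx orbT.
Qed.

Lemma cut_mono (N N' : nat) t : (N <= N')%N -> cut N t <= cut N' t.
Proof.
move=> NN; rewrite lerN2 ler_ln ?posrE ?wtN_gt0 // ge_max le_max lexx /= le_max ler_expR.
by rewrite lerN2 ler_nat NN orbT.
Qed.

Lemma cut_meas N : measurable_fun D (cut N).
Proof.
apply: (@measurableT_comp _ _ _ _ _ _ (@GRing.opp R)) => //.
apply: (@measurableT_comp _ _ _ _ _ _ (@ln R)); first exact: measurable_ln.
apply: measurable_maxr; last exact: measurable_cst.
apply: measurable_minr; last exact: measurable_cst.
by apply: cmeas_cabs2; apply: cint_meas; case: bua.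
Qed.

Lemma cut_bound N t : `|cut N t| <= N%:R + K.
Proof.
rewrite ler_norml; have := cut_ge N t; have := cut_le N t.
by have := K0; have : 0 <= N%:R :> R by []; lra.
Qed.

Lemma cut_rint N : rint (cut N).
Proof. by apply: (rint_bounded (cut_meas N)) => t _; exact: cut_bound. Qed.

Lemma pois_lower v z : cabs z < 1 -> rint v -> (forall t, 0 <= v t) ->
  (1 - cabs z) / (1 + cabs z) * cavg v <= pois v z.
Proof.
move=> z1 iv v0; rewrite -cavgZ //; apply: cavg_le; [exact: rintZ|exact: rint_pker|].
by move=> t _; rewrite ler_wpM2r // pker_ge.
Qed.

Lemma pois_upper v z : cabs z < 1 -> rint v -> (forall t, 0 <= v t) ->
  pois v z <= 2 / (1 - cabs z) * cavg v.
Proof.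
move=> z1 iv v0; rewrite -cavgZ //; apply: cavg_le; [exact: rint_pker|exact: rintZ|].
by move=> t _; rewrite ler_wpM2r // pker_le.
Qed.

Lemma poisD v w z : cabs z < 1 -> rint v -> rint w ->
  pois (fun t => v t + w t) z = pois v z + pois w z.
Proof.
move=> z1 iv iw; rewrite -cavgD; [|exact: rint_pker|exact: rint_pker].
by apply: cavg_eq => t _; rewrite mulrDr.
Qed.

Lemma pois_cst k z : cabs z < 1 -> pois (fun=> k) z = k.
Proof.
move=> z1; transitivity (cavg (fun t => k * pker z t)).
  by apply: cavg_eq => t _; rewrite mulrC.
rewrite cavgZ ?cavg_pker ?mulr1 //.
by have := rint_pker z1 (rint_cst 1); under eq_fun do rewrite mulr1.
Qed.

(** A form of the integrability of ln |a|. The weighted estimate for f = a and u = [cut N] has right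
    side at most 1, which bounds the Poisson integral at z0 independently of N. The kernel is
    bounded below and [cut N] + K is nonnegative, so the mean is bounded too. *)
Lemma cut_avg_bounded : exists A, forall N, cavg (cut N) <= A.
Proof.
pose c := cabs (a z0) ^+ 2 * (1 - cabs z0 ^+ 2).
have c0 : 0 < c.
  rewrite mulr_gt0 // ?exprn_gt0 ?subr_gt0 ?expr_lt1 ?cabs_ge0 //.
  by rewrite lt_def cabs_eq0 az0 cabs_ge0.
pose kap := (1 - cabs z0) / (1 + cabs z0).
have kap0 : 0 < kap by rewrite divr_gt0 ?subr_gt0 // ltr_wpDr ?cabs_ge0.
exists ((- ln c + K) / kap - K) => N.
have := weighted_point (cut_meas N) (cut_bound N) (hardy_infty_hardy2 ad aM) bua z01.
rewrite -/c => h.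
have h1 : c * expR (pois (cut N) z0) <= 1.
  apply: le_trans h _; rewrite -[leRHS](cavg_cst 1).
  have E : aeD (fun t => expR (cut N t) * cabs (ua t) ^+ 2 = wt t / wtN N t).
    by apply: aeD_mono wt_ae => t _ <-; rewrite expR_cut mulrC.
  rewrite (cavg_ae E).
  have le1 t : wt t / wtN N t <= 1 by rewrite ler_pdivrMr ?wtN_gt0 // mul1r le_max lexx.
  have ge0 t : 0 <= wt t / wtN N t by rewrite divr_ge0 ?wt_ge0 // ltW ?wtN_gt0.
  apply: cavg_le => [||t _] //; last exact: rint_cst.
  apply: (@rint_bounded _ _ 1); last by move=> t _; rewrite ger0_norm.
  rewrite (_ : (fun _ => _) = (fun t => wt t * expR (cut N t))); last first.
    by apply/funext => t; rewrite expR_cut.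
  apply: measurable_funM.
    apply: measurable_minr; last exact: measurable_cst.
    by apply: cmeas_cabs2; apply: cint_meas; case: bua.
  by apply: (@measurableT_comp _ _ _ _ _ _ (@expR R)) => //; exact: cut_meas.
have h2 : pois (cut N) z0 <= - ln c.
  rewrite -ler_expR expRN lnK ?posrE // -div1r ler_pdivlMr //.
  by rewrite mulrC.
have iK : rint (fun t => cut N t + K) by apply: rintD; [exact: cut_rint|exact: rint_cst].
have := pois_lower z01 iK (fun t => ltac:(by have := cut_ge N t; lra)).
rewrite poisD //; [|exact: cut_rint|exact: rint_cst].
rewrite pois_cst // cavgD; [|exact: cut_rint|exact: rint_cst].
rewrite cavg_cst -/kap => h3.
rewrite lerBrDr ler_pdivlMr // mulrC.
by apply: le_trans h3 _; rewrite lerD2r.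
Qed.

(** The means increase with N and are bounded, so N0 may be taken where their supremum is almost
    reached. *)
Lemma cut_small e : 0 < e -> exists N0 : nat, forall N : nat, (N0 <= N)%N ->
  cavg (fun t => cut N t - cut N0 t) <= e.
Proof.
move=> e0; have [A hA] := cut_avg_bounded.
have hs : has_sup (range (fun N => cavg (cut N))).
  by split; [exists (cavg (cut 0%N)), 0%N|exists A => _ [n _ <-]].
have [_ [N0 _ <-] h] := sup_adherent e0 hs.
exists N0 => N _; rewrite cavgB; [|exact: cut_rint|exact: cut_rint].
have : cavg (cut N) <= sup (range (fun N => cavg (cut N))) by apply: ub_le_sup; [case: hs|exists N].
by move=> h3; rewrite lerBlDl -lerBlDr; apply: le_trans (ltW h); rewrite lerD2r.
Qed.

(** The weight is u = - (cut N - cut N0). Its Poisson integral at z is at least - 2e / (1 - |z|)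
    because the difference has mean at most e, while e^u <= e^{N0} (|a|^2 + e^{-N}) almost
    everywhere. Letting N grow removes the term with e^{-N}. *)
Lemma point_growth e : 0 < e -> exists2 C, 0 < C & forall p z, H2 p -> cabs z < 1 ->
  cabs (p z) ^+ 2 * (1 - cabs z ^+ 2) <=
  C * expR (2 / (1 - cabs z) * e) * n2 (taylor (fun z => a z * p z)).
Proof.
move=> e0; have [N0 hN0] := cut_small e0.
exists (expR N0%:R) => [|p z hp z1]; first exact: expR_gt0.
have hap := hardy2_mul ad aM hp.
have [v bv] := brep_exists hp; have [w bw] := brep_exists hap.
have iv : rint (fun t => cabs (v t) ^+ 2) by case: bv.
have iw : rint (fun t => cabs (w t) ^+ 2) by case: bw.
set E := expR (2 / _ * e); have E0 : 0 < E by exact: expR_gt0.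
have key N : (N0 <= N)%N -> cabs (p z) ^+ 2 * (1 - cabs z ^+ 2) <=
    expR N0%:R * E * (n2 (taylor (fun z => a z * p z)) + expR (- N%:R) * n2 (taylor p)).
  move=> NN; pose u t := - (cut N t - cut N0 t).
  have d0 t : 0 <= cut N t - cut N0 t by rewrite subr_ge0 cut_mono.
  have mu_ : measurable_fun D u.
    apply: (@measurableT_comp _ _ _ _ _ _ (@GRing.opp R)) => //.
    by apply: measurable_funB; exact: cut_meas.
  have uB t : `|u t| <= (N%:R + K) + (N0%:R + K).
    by rewrite normrN; apply: le_trans (ler_normB _ _) _; rewrite lerD // cut_bound.
  have id_ : rint (fun t => cut N t - cut N0 t) by apply: rintB; exact: cut_rint.
  have pu : - (2 / (1 - cabs z) * e) <= pois u z.
    have -> : pois u z = - pois (fun t => cut N t - cut N0 t) z.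
      by rewrite -cavgN; [apply: cavg_eq => t _; rewrite mulrN|exact: rint_pker].
    rewrite lerN2; apply: le_trans (pois_upper z1 id_ d0) _.
    by rewrite ler_wpM2l ?hN0 // divr_ge0 // subr_ge0 ltW.
  have := weighted_point mu_ uB hp bv z1 => h.
  have h1 : cabs (p z) ^+ 2 * (1 - cabs z ^+ 2) <= E * cavg (fun t => expR (u t) * cabs (v t) ^+ 2).
    rewrite -ler_pdivrMl // /E -expRN mulrC; apply: le_trans h.
    rewrite ler_wpM2l ?ler_expR // mulr_ge0 ?sqr_ge0 // subr_ge0.
    by rewrite exprn_ile1 ?cabs_ge0 // ltW.
  apply: le_trans h1 _; rewrite [expR _ * E]mulrC -mulrA ler_pM2l //.
  rewrite -(brep_n2 hp bv) -(brep_n2 hap bw) -(cavgZ (expR (- N%:R)) iv).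
  have ic := rintZ (expR (- N%:R)) iv.
  rewrite -cavgD // -cavgZ; last exact: rintD.
  apply: cavg_le_ae.
  - apply: (@rint_le _ _ (fun t => expR ((N%:R + K) + (N0%:R + K)) * cabs (v t) ^+ 2)).
    + apply: measurable_funM; last exact: rint_meas.
      by apply: (@measurableT_comp _ _ _ _ _ _ (@expR R)).
    + exact: rintZ.
    + move=> t _; rewrite ger0_norm; last by apply: mulr_ge0; [exact: expR_ge0|exact: sqr_ge0].
      by rewrite ler_wpM2r ?sqr_ge0 // ler_expR; apply: le_trans (ler_norm _) (uB t).
  - by apply: rintZ; exact: rintD.
  apply: aeD_mono (aeD_and wt_ae (brep_mul bua bv bw (fun z _ => erefl))) => t _ [we ->].
  rewrite cabsM exprMn -we -mulrDl mulrA ler_wpM2r ?sqr_ge0 //.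
  rewrite /u opprB expRD [expR (- cut N t)]expRN [expR (cut N t)]expR_cut invrK.
  apply: ler_pM; [exact: expR_ge0|exact: ltW (wtN_gt0 _ _)|by rewrite ler_expR cut_le|].
  by rewrite ge_max lerDl lerDr expR_ge0 wt_ge0.
apply/ler_addgt0Pr => x x0.
set n2a := n2 (taylor (fun z => a z * p z)) in key *.
have n0 : 0 <= n2 (taylor p) by apply: n2_ge0; exact: hardy2_l2seq.
have F0 : 0 < expR N0%:R * E by rewrite mulr_gt0 // expR_gt0.
have [N [NN hN]] : exists N : nat, (N0 <= N)%N /\ expR N0%:R * E * (expR (- N%:R) * n2 (taylor p)) <= x.
  pose y := x^-1 * (expR N0%:R * E * n2 (taylor p)).
  exists (N0 + Num.truncn y).+1%N; split; first by rewrite leqW // leq_addr.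
  rewrite [_ * n2 _]mulrC mulrA expRN ler_pdivrMr ?expR_gt0 // -ler_pdivrMl // -/y.
  apply: (@le_trans _ _ (N0 + Num.truncn y).+1%:R); last first.
    by apply: le_trans (expR_ge1Dx _); rewrite lerDr.
  apply: (@le_trans _ _ (Num.truncn y).+1%:R); last by rewrite ler_nat ltnS leq_addl.
  by apply: ltW; apply: real_truncnS_gt; exact: num_real.
by apply: le_trans (key N NN) _; rewrite mulrDr lerD2l.
Qed.

(** It suffices that (1 - s) (1 + 2s) >= 1 for s <= 1 / 2. *)
Lemma root_growth (n : nat) (s : R) : 0 < s -> s <= 1 / 2 ->
  1 <= (1 - s) ^+ (2 * n) * expR (4 * n%:R * s).
Proof.
move=> s0 s2.
have h : 1 <= (1 - s) * expR (2 * s).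
  apply: (@le_trans _ _ ((1 - s) * (1 + 2 * s))).
    have : 0 <= s * (1 - 2 * s) by apply: mulr_ge0; lra.
    lra.
  by rewrite ler_wpM2l ?expR_ge1Dx //; lra.
have -> : 4 * n%:R * s = (2 * n)%:R * (2 * s) by rewrite natrM; ring.
by rewrite expRM_natl -exprMn exprn_ege1.
Qed.

(** Cauchy's estimate on the radius 1 - s, with s = d / S and S = sqrt(n + 1). The exponent e S is
    spent as follows: a quarter on r^{-2n}, a quarter on the factor of [point_growth], half on 1 /
    s. *)
Lemma taylor_growth e : 0 < e -> exists2 C, 0 <= C & forall p n, H2 p ->
  cabs (taylor p n) ^+ 2 <= C * expR (e * Num.sqrt n%:R) * n2 (taylor (fun z => a z * p z)).
Proof.
move=> e0; pose d := Num.min (1 / 2) (e / 16).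
have d0 : 0 < d by rewrite lt_min !divr_gt0.
have d2 : d <= 1 / 2 by rewrite ge_min lexx.
have d16 : d <= e / 16 by rewrite ge_min lexx orbT.
clearbody d.
have ed0 : 0 < e * d / 8 by rewrite divr_gt0 // mulr_gt0.
have [C C0 hC] := point_growth ed0.
exists (C * (2 / (d * e)) * expR e) => [|p n hp].
  by rewrite !mulr_ge0 ?expR_ge0 ?(ltW C0) // invr_ge0 mulr_ge0 // ltW.
set A := n2 _.
have hap := hardy2_mul ad aM hp.
have A0 : 0 <= A by apply: n2_ge0; exact: hardy2_l2seq.
pose S := Num.sqrt n.+1%:R : R.
have S1 : 1 <= S by rewrite -sqrtr1 ler_sqrt // ler1n.
have SS : S ^+ 2 = n.+1%:R by rewrite sqr_sqrtr.
have Sn : S <= Num.sqrt n%:R + 1.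
  have q0 := sqrtr_ge0 (n%:R : R); have qq : Num.sqrt (n%:R : R) ^+ 2 = n%:R by rewrite sqr_sqrtr.
  rewrite -(@ler_pXn2r _ 2) ?nnegrE ?addr_ge0 ?sqrtr_ge0 // SS -natr1.
  by move: q0 qq; set q := Num.sqrt _ => q0 <-; lra.
have S0 : 0 < S by lra.
pose s := d / S.
have s0 : 0 < s by rewrite divr_gt0.
have s2 : s <= 1 / 2 by apply: le_trans d2; rewrite ler_pdivrMr // ler_peMr // ltW.
pose r := 1 - s.
have r0 : 0 < r by rewrite /r; lra.
have r1 : r < 1 by rewrite /r; lra.
have pd := hardy2_diff hp.
pose Q := C * expR (2 / s * (e * d / 8)) * A / s.
have Q0 : 0 <= Q by rewrite divr_ge0 ?(ltW s0) // !mulr_ge0 ?expR_ge0 // ltW.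
have pQ t : cabs (p (r%:C * cis t)) <= Num.sqrt Q.
  rewrite -(@ler_pXn2r _ 2) ?nnegrE ?cabs_ge0 ?sqrtr_ge0 // sqr_sqrtr //.
  rewrite ler_pdivlMr //.
  have := hC p (r%:C * cis t) hp; rewrite cabs_polar ?(ltW r0) // => /(_ r1).
  have -> : 1 - r = s by rewrite /r; ring.
  apply: le_trans; rewrite ler_wpM2l ?sqr_ge0 //.
  have : 0 <= s * (1 - s) by apply: mulr_ge0; lra.
  rewrite /r; lra.
have b1 : cabs (taylor p n) ^+ 2 * r ^+ (2 * n) <= Q.
  have := circle_int_bound (cint_fcp n (cint_circle pd (ltW r0) r1)) (M := Num.sqrt Q).
  rewrite -/(fcp _ n) taylor_fcp // cabsM cabs_real (ger0_norm (exprn_ge0 _ (ltW r0))).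
  move=> /(_ (fun t _ => ltac:(by rewrite cabsM cabs_conj cabs_cis mulr1))) h.
  rewrite mulnC exprM -exprMn -[Q]sqr_sqrtr //.
  by rewrite ler_pXn2r ?nnegrE ?sqrtr_ge0 // mulr_ge0 ?cabs_ge0 // exprn_ge0 // ltW.
have b2 : cabs (taylor p n) ^+ 2 <= Q * expR (4 * n%:R * s).
  have rg := root_growth n s0 s2; rewrite -/r in rg.
  apply: (@le_trans _ _ (cabs (taylor p n) ^+ 2 * (r ^+ (2 * n) * expR (4 * n%:R * s)))).
    by rewrite ler_peMr ?sqr_ge0.
  by rewrite mulrA ler_wpM2r ?expR_ge0.
apply: le_trans b2 _.
have x1 : 4 * n%:R * s <= e / 4 * S.
  apply: (@le_trans _ _ (4 * S ^+ 2 * s)).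
    by rewrite ler_pM2r // ler_pM2l // SS ler_nat.
  have -> : 4 * S ^+ 2 * s = 4 * d * S by rewrite /s; field; rewrite gt_eqF.
  by rewrite ler_pM2r //; lra.
have x2 : 2 / s * (e * d / 8) = e / 4 * S by rewrite /s; field; rewrite !gt_eqF.
have x3 : s^-1 <= 2 / (d * e) * expR (e / 2 * S).
  have -> : s^-1 = 2 / (d * e) * (e / 2 * S) by rewrite /s; field; rewrite !gt_eqF.
  rewrite ler_pM2l ?divr_gt0 ?mulr_gt0 //.
  by have := expR_ge1Dx (e / 2 * S); lra.
have x4 : expR (e / 4 * S) * (expR (e / 2 * S) * expR (e / 4 * S)) <= expR e * expR (e * Num.sqrt n%:R).
  rewrite -!expRD ler_expR; have := ler_wpM2l (ltW e0) Sn; lra.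
rewrite /Q x2.
apply: (@le_trans _ _ (C * expR (e / 4 * S) * A * (2 / (d * e) * expR (e / 2 * S)) * expR (e / 4 * S))).
  apply: ler_pM; [by move: Q0; rewrite /Q x2|exact: expR_ge0| |by rewrite ler_expR].
  by rewrite ler_wpM2l // !mulr_ge0 ?expR_ge0 // ltW.
have -> : C * expR (e / 4 * S) * A * (2 / (d * e) * expR (e / 2 * S)) * expR (e / 4 * S) =
   C * (2 / (d * e)) * A * (expR (e / 4 * S) * (expR (e / 2 * S) * expR (e / 4 * S))) by ring.
have -> : C * (2 / (d * e)) * expR e * expR (e * Num.sqrt n%:R) * A =
   C * (2 / (d * e)) * A * (expR e * expR (e * Num.sqrt n%:R)) by ring.
by rewrite ler_wpM2l // !mulr_ge0 ?(ltW C0) // invr_ge0 mulr_ge0 // ltW.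
Qed.

End CoefficientBound.

(** * Sufficiency of root-exponential decay *)

Section MultiplierSufficiency.
Variable R : realType.
Local Notation D := (@period R).
Local Notation H2 f := (hardy2 (f : R[i]^o -> R[i]^o)).
Implicit Types (f g p h : R[i] -> R[i]) (c d : nat -> R[i]) (z : R[i]).

Lemma taylor_eq f g : (forall z, cabs z < 1 -> f z = g z) -> taylor f = taylor g.
Proof.
move=> fg; apply/funext => n; rewrite /taylor; congr (_ * _); apply: circle_int_eq => t _.
by rewrite fg // cabs_polar ?divr_ge0 //; lra.
Qed.

Lemma taylor_zero : taylor (fun=> 0 : R[i]) = fun=> 0.
Proof.
apply/funext => n; rewrite /taylor (_ : fcp _ n = 0) ?mul0r //.
rewrite -[RHS](@circle_int_cst R 0); apply: circle_int_eq => t _.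
by rewrite mul0r.
Qed.

Definition shiftn k c n : R[i] := if (n < k)%N then 0 else c (n - k)%N.

Lemma taylor_mulX1 g : diff_disc g -> taylor (fun z => z * g z) = shiftn 1 (taylor g).
Proof.
move=> gd; have h0 : 0 <= 1 / 2 :> R by rewrite divr_ge0.
have h1 : 1 / 2 < 1 :> R by lra.
have h2 : 0 < 1 / 2 :> R by rewrite divr_gt0.
have ig := cint_circle gd h0 h1.
apply/funext => -[|n]; rewrite /shiftn /=.
  rewrite /taylor (_ : fcp _ 0 = 0) ?mul0r //.
  (* The constant term is a multiple of the coefficient of g of index -1, which vanishes. *)
  transitivity ((1 / 2)%:C * fcm (fun t => g ((1 / 2)%:C * cis t)) 1).
    rewrite /fcm -(circle_intZ _ (cint_fcm 1 ig)); apply: circle_int_eq => t _.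
    by rewrite mul0r cis0 conjc1 [1%:R * t]mul1r mulr1; ring.
  by rewrite (fcm_circle0 gd h2 h1) // mulr0.
rewrite subn1 /= /taylor.
have -> : fcp (fun t => (1 / 2)%:C * cis t * g ((1 / 2)%:C * cis t)) n.+1 =
   (1 / 2)%:C * fcp (fun t => g ((1 / 2)%:C * cis t)) n.
  rewrite /fcp -(circle_intZ _ (cint_fcp n ig)); apply: circle_int_eq => t _.
  have -> : n.+1%:R * t = n%:R * t + t by rewrite -[n.+1%:R]natr1 mulrDl mul1r.
  rewrite cisD conjM.
  have := cis_conj_mul t; set x := cis t; set y := (x^*)%C; set v := (cis (n%:R * t))^*%C => xy.
  by rewrite -[RHS]mulr1 -xy; ring.
have hk : (1 / 2)%:C * (2 ^+ n.+1)%:C = (2 ^+ n)%:C :> R[i].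
  by rewrite -rmorphM /= exprS; congr (_ %:C); field.
by rewrite -hk; move: (fcp _ _) => F; ring.
Qed.

Lemma hardy2_mulX k g : H2 g -> H2 (fun z => z ^+ k * g z) /\
  taylor (fun z => z ^+ k * g z) = shiftn k (taylor g).
Proof.
move=> hg; elim: k => [|k [IH IHt]].
  have -> : (fun z => z ^+ 0 * g z) = g by apply/funext => z; rewrite expr0 mul1r.
  by split => //; apply/funext => n; rewrite /shiftn subn0.
have -> : (fun z => z ^+ k.+1 * g z) = (fun z => z * (z ^+ k * g z)).
  by apply/funext => z; rewrite exprS mulrA.
split.
  apply: (hardy2_mul (M := 1)) IH; last by move=> z; exact: ltW.
  by move=> z _; exists 1; exact: cdiff_id.
rewrite taylor_mulX1 ?IHt; last exact: hardy2_diff.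
apply/funext => -[|n]; rewrite /shiftn //=.
by rewrite subn1 /= ltnS subSS.
Qed.

Definition dropn k c n : R[i] := c (n + k)%N.

Lemma sum2_dropn k c N : sum2 (dropn k c) N <= sum2 c (k + N).
Proof.
rewrite /sum2 big_split_ord /= -[leLHS]add0r; apply: lerD.
  by apply: sumr_ge0 => i _; exact: sqr_ge0.
by apply: ler_sum => i _; rewrite /dropn addnC.
Qed.

Lemma l2_dropn k c : l2seq c -> l2seq (dropn k c).
Proof. by move=> [C cC]; exists C => N; apply: le_trans (sum2_dropn k c N) _; exact: cC. Qed.

Lemma psum_shiftn k c d N : psum (fun n => shiftn k c n * ((d n)^*)%C) (k + N) =
  psum (fun n => c n * ((dropn k d n)^*)%C) N.
Proof.
elim: N => [|N IH].
  rewrite addn0 /psum big_ord0 big1 // => i _; by rewrite /shiftn ltn_ord mul0r.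
by rewrite addnS !psumS IH /shiftn ltnNge leq_addr /= addKn /dropn addnC.
Qed.

Lemma l2_shiftn k c : l2seq c -> l2seq (shiftn k c).
Proof.
move=> [C cC]; exists C => N; rewrite -/(sum2 _ N).
apply: le_trans (sum2_le _ (leq_addl k N)) _.
have -> : sum2 (shiftn k c) (k + N) = sum2 c N; last exact: cC.
elim: N => [|N IH].
  by rewrite addn0 /sum2 big_ord0 big1 // => i _; rewrite /shiftn ltn_ord cabs0 expr0n.
rewrite addnS /sum2 big_ord_recr [RHS]big_ord_recr -/(sum2 _ _) IH.
by rewrite /= /shiftn ltnNge leq_addr /= addKn.
Qed.

Lemma sip_shiftn k c d : l2seq c -> l2seq d -> sip (shiftn k c) d = sip c (dropn k d).
Proof.
move=> lc ld; symmetry; apply: csum_unique.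
apply/(@ccvgP R _ _ eventually_filter) => e e0.
have /(@ccvgP R _ _ eventually_filter) /(_ e e0) [n0 _ hn] := sip_cvg (l2_shiftn k lc) ld.
exists n0 => // N /= n0N; rewrite -psum_shiftn; apply: hn => /=.
exact: leq_trans n0N (leq_addl _ _).
Qed.

Lemma n2_shiftn k c : l2seq c -> n2 (shiftn k c) = n2 c.
Proof.
move=> lc; have lk := l2_shiftn k lc.
have := sip_self lk; rewrite sip_shiftn //.
have -> : dropn k (shiftn k c) = c.
  by apply/funext => n; rewrite /dropn /shiftn ltnNge leq_addl /= addnK.
by rewrite sip_self // => /(congr1 (@complex.Re R)).
Qed.

Definition headn k c n : R[i] := if (n < k)%N then c n else 0.

Lemma l2_headn k c : l2 (headn k c) (sum2 c k).
Proof.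
move=> N; have -> : \sum_(n < N) cabs (headn k c n) ^+ 2 = sum2 c (minn N k).
  elim: N => [|N IH]; first by rewrite min0n /sum2 !big_ord0.
  rewrite big_ord_recr IH /= /headn; case: ltnP => Nk.
    by rewrite (minn_idPl Nk) /sum2 big_ord_recr.
  by rewrite cabs0 expr0n addr0 (minn_idPr (leqW Nk)).
by apply: sum2_le; exact: geq_minr.
Qed.

Lemma toeplitz_shift_bound (a : R[i] -> R[i]) (M : R) h g p k : diff_disc a -> bounded_disc a M ->
  H2 h -> is_coanalytic_toeplitz (a : R[i]^o -> R[i]^o) h g -> H2 p ->
  cabs (sip (taylor (fun z => z ^+ k * g z)) (taylor p)) ^+ 2 <=
  n2 (taylor h) * (2 * n2 (taylor (fun z => a z * p z)) + 2 * (M ^+ 2 * sum2 (taylor p) k)).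
Proof.
move=> ad aM hh /(coanalytic_toeplitzP _ ad aM hh) [hg tg] hp.
have lp := hardy2_l2seq hp; have ld := l2_dropn k lp.
have [hd td] := l2seq_pser ld.
have [_ ->] := hardy2_mulX k hg; rewrite (sip_shiftn k (hardy2_l2seq hg) lp) -td -tg //.
have had := hardy2_mul ad aM hd.
apply: le_trans (sip_cs (hardy2_l2seq hh) (hardy2_l2seq had)) _.
(* The shift is an isometry, so the norm may be computed after multiplication by z^k, which turns
   the dropped part of p into p minus its head. *)
rewrite ler_wpM2l ?(n2_ge0 (hardy2_l2seq hh)) // -(n2_shiftn k (hardy2_l2seq had)).
have [_ <-] := hardy2_mulX k had.
have lhd : l2seq (headn k (taylor p)) by eexists; exact: l2_headn.
have [hs ts] := l2seq_pser lhd.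
have has := hardy2_mul ad aM hs; have hap := hardy2_mul ad aM hp.
have -> : taylor (fun z => z ^+ k * (a z * pser (dropn k (taylor p)) z)) =
   addZ (taylor (fun z => a z * p z)) (-1) (taylor (fun z => a z * pser (headn k (taylor p)) z)).
  have [hE <-] := hardy2_addZ (-1) hap has; apply: taylor_eq => z z1.
  have [h1 t1] := hardy2_mulX k hd; have [h2 t2] := hardy2_addZ (-1) hp hs.
  have -> : z ^+ k * (a z * pser (dropn k (taylor p)) z) = a z * (z ^+ k * pser (dropn k (taylor p)) z) by ring.
  have -> : a z * p z + -1 * (a z * pser (headn k (taylor p)) z) = a z * (p z + -1 * pser (headn k (taylor p)) z) by ring.
  congr (_ * _); rewrite (hardy2_pser h1 z1) (hardy2_pser h2 z1) t1 t2 td ts; congr (pser _ z).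
  apply/funext => n; rewrite /shiftn /addZ /headn /dropn; case: ltnP => nk.
    by rewrite mulN1r subrr.
  by rewrite mulr0 addr0 subnK.
apply: n2_le; move=> N; have := l2_addZ_le (-1) (l2_n2 (hardy2_l2seq hap)) (l2_n2 (hardy2_l2seq has)) N.
move=> /le_trans; apply; rewrite lerD2l ler_pM2l // cabsN cabs1 expr1n mul1r.
apply: le_trans (n2_mul ad aM hs) _; rewrite ler_wpM2l ?sqr_ge0 // ts.
by apply: n2_le; exact: l2_headn.
Qed.

Lemma rcp_gt0 k : 0 < rcp R k.
Proof. by rewrite /rcp invr_gt0. Qed.

(** The majorant is a multiple of 1 / ((k + 1) (k + 2)), written so that sums telescope. The sixth
    power of 1 + (c / 6) sqrt k is below e^{c sqrt k} and supplies the required (k + 1)^3. *)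
Lemma root_exp_decay (c : R) : 0 < c -> exists2 W : R, 0 <= W & forall k : nat,
  k.+1%:R * expR (- (c * Num.sqrt k%:R)) <= W * (rcp R k - rcp R k.+1).
Proof.
move=> c0; pose m := Num.min 1 (c / 6).
have m0 : 0 < m by rewrite lt_min ltr01 divr_gt0.
have m1 : m <= 1 by rewrite ge_min lexx.
have m6 : m <= c / 6 by rewrite ge_min lexx orbT.
clearbody m; exists (2 / m ^+ 6) => [|k]; first by rewrite divr_ge0 // exprn_ge0 // ltW.
pose q : R := Num.sqrt k%:R.
have q0 : 0 <= q by exact: sqrtr_ge0.
have qq : q ^+ 2 = k%:R by rewrite sqr_sqrtr.
pose y : R := k.+1%:R; have y1 : 1 <= y by rewrite ler1n.
have yE : y = 1 + q ^+ 2 by rewrite qq /y -natr1 addrC.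
have rk : rcp R k - rcp R k.+1 = (y * (y + 1))^-1.
  rewrite /rcp -[k.+2%:R]natr1 -/y; field; rewrite !gt_eqF //; lra.
rewrite rk -/y -/q; have e1 : m ^+ 6 * y ^+ 3 <= expR (c * q).
  have -> : c * q = 6%:R * (c / 6 * q) by field.
  rewrite expRM_natl; apply: (@le_trans _ _ ((m * (1 + q)) ^+ 6)).
    rewrite exprMn ler_wpM2l ?exprn_ge0 ?(ltW m0) //.
    have -> : (1 + q) ^+ 6 = ((1 + q) ^+ 2) ^+ 3 by rewrite -exprM.
    by rewrite ler_pXn2r ?nnegrE ?sqr_ge0 //; rewrite yE; clearbody q; lra.
  rewrite ler_pXn2r ?nnegrE ?expR_ge0 ?mulr_ge0 ?(ltW m0) ?addr_ge0 //.
  apply: le_trans (expR_ge1Dx _); have := ler_wpM2r q0 m6; lra.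
have e0 : 0 < m ^+ 6 * y ^+ 3 by rewrite mulr_gt0 ?exprn_gt0 //; lra.
rewrite expRN; apply: (@le_trans _ _ (y / (m ^+ 6 * y ^+ 3))).
  by rewrite ler_wpM2l ?lef_pV2 ?posrE ?expR_gt0 //; lra.
have -> : y / (m ^+ 6 * y ^+ 3) = 2 / m ^+ 6 * (y * (2 * y))^-1.
  by field; rewrite !gt_eqF //; lra.
rewrite ler_wpM2l //; first by rewrite divr_ge0 // exprn_ge0 // ltW.
by rewrite lef_pV2 ?posrE ?mulr_gt0 ?ler_pM2l //; lra.
Qed.

Lemma sum_rcp m n : (m <= n)%N -> \sum_(m <= k < n) (rcp R k - rcp R k.+1) = rcp R m - rcp R n.
Proof.
move=> mn; rewrite -[LHS]opprK -sumrN (eq_bigr (fun k => rcp R k.+1 - rcp R k)).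
  by rewrite telescope_sumr // opprB.
by move=> k _; rewrite opprB.
Qed.

End MultiplierSufficiency.

(** * Multiplication by psi preserves the range *)

Section Sufficiency.
Variable R : realType.
Local Notation H2 f := (hardy2 (f : R[i]^o -> R[i]^o)).
Implicit Types (f g p h : R[i] -> R[i]) (c d : nat -> R[i]) (z : R[i]).

Lemma rcp_small (e : R) : 0 < e -> exists N : nat, forall j, (N <= j)%N -> rcp R j <= e.
Proof.
move=> e0; have /cvgrPdist_lt /(_ _ e0) [N _ hN] := @cvg_harmonic R.
exists N => j /hN /=; rewrite sub0r normrN ger0_norm; first exact: ltW.
by rewrite invr_ge0.
Qed.

Section Bound.
Variables (a psi g h : R[i] -> R[i]) (M B K W c C : R).
Hypotheses (ad : diff_disc a) (aM : bounded_disc a M).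
Hypotheses (pd : diff_disc psi) (pB : bounded_disc psi B).
Hypotheses (hh : H2 h) (hg : H2 g) (tg : is_coanalytic_toeplitz (a : R[i]^o -> R[i]^o) h g).
Hypotheses (c0 : 0 < c) (C0 : 0 <= C) (W0 : 0 <= W) (K0 : 0 <= K).
Hypothesis psiK : forall k : nat, cabs (taylor psi k) <= K * expR (- (c * Num.sqrt k%:R)).
Hypothesis hC : forall p n, H2 p ->
  cabs (taylor p n) ^+ 2 <= C * expR (c * Num.sqrt n%:R) * n2 (taylor (fun z => a z * p z)).
Hypothesis hW : forall k : nat,
  k.+1%:R * expR (- (c / 2 * Num.sqrt k%:R)) <= W * (rcp R k - rcp R k.+1).

Let A p := n2 (taylor (fun z => a z * p z)).
Let Y := Num.sqrt (2 * n2 (taylor h) * (1 + M ^+ 2 * C)).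

Let A0 p : H2 p -> 0 <= A p.
Proof. by move=> hp; apply: n2_ge0; apply: hardy2_l2seq; exact: hardy2_mul ad aM hp. Qed.

(** The growth of squared coefficients summed over the head of p. The square root halves the
    exponent to (c / 2) sqrt k, so that half of the decay of psi is left over for summation. *)
Lemma shift_coef_bound p k : H2 p ->
  cabs (sip (taylor (fun z => z ^+ k * g z)) (taylor p)) <=
  Num.sqrt (A p) * (Y * (k.+1%:R * expR (c / 2 * Num.sqrt k%:R))).
Proof.
move=> hp; have a0 := A0 hp.
have h0 : 0 <= n2 (taylor h) by apply: n2_ge0; exact: hardy2_l2seq.
have m0 : 0 <= M ^+ 2 * C by rewrite mulr_ge0 ?sqr_ge0.
set q := expR (c / 2 * _); have q1 : 1 <= q.
  by rewrite -expR0 ler_expR mulr_ge0 ?sqrtr_ge0 // divr_ge0 // ltW.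
have k1 : 1 <= k.+1%:R :> R by rewrite ler1n.
have k0 : 0 <= k%:R :> R by [].
have kk : k.+1%:R = 1 + k%:R :> R by rewrite -natr1 addrC.
rewrite -(@ler_pXn2r _ 2) ?nnegrE ?cabs_ge0 //; last first.
  by rewrite !mulr_ge0 ?sqrtr_ge0 //; lra.
apply: le_trans (toeplitz_shift_bound k ad aM hh tg hp) _; rewrite -/(A p).
have s2 : sum2 (taylor p) k <= k%:R * (C * q ^+ 2 * A p).
  rewrite (_ : k%:R * _ = \sum_(i < k) (C * q ^+ 2 * A p)); last by rewrite sumr_const card_ord mulr_natl.
  apply: ler_sum => i _; apply: le_trans (hC i hp) _; apply: (ler_wpM2r a0); apply: (ler_wpM2l C0).
  rewrite /q -expRM_natl ler_expR.
  have -> : 2%:R * (c / 2 * Num.sqrt k%:R) = c * Num.sqrt k%:R by field.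
  by rewrite ler_pM2l // ler_sqrt // ler_nat ltnW.
have Y2 : Y ^+ 2 = 2 * n2 (taylor h) * (1 + M ^+ 2 * C) by rewrite sqr_sqrtr // !mulr_ge0 //; lra.
rewrite !exprMn (sqr_sqrtr a0) Y2.
have -> : A p * (2 * n2 (taylor h) * (1 + M ^+ 2 * C) * (k.+1%:R ^+ 2 * q ^+ 2)) =
  n2 (taylor h) * (2 * A p * ((1 + M ^+ 2 * C) * (k.+1%:R ^+ 2 * q ^+ 2))) by ring.
rewrite ler_wpM2l //.
apply: (@le_trans _ _ (2 * A p + 2 * (M ^+ 2 * (k%:R * (C * q ^+ 2 * A p))))).
  by rewrite lerD2l ler_pM2l // ler_wpM2l ?sqr_ge0.
rewrite (_ : _ + _ = 2 * A p * (1 + M ^+ 2 * C * (k%:R * q ^+ 2))); last by ring.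
apply: ler_wpM2l; first exact: (mulr_ge0 (ler0n R 2) a0).
have q2 : 1 <= q ^+ 2 by rewrite exprn_ege1.
have x1 : k%:R * q ^+ 2 <= k.+1%:R ^+ 2 * q ^+ 2.
  rewrite ler_wpM2r ?sqr_ge0 // kk; have := sqr_ge0 (k%:R : R); lra.
have x2 : 1 <= k.+1%:R ^+ 2 * q ^+ 2 :> R by rewrite mulr_ege1 // exprn_ege1.
by rewrite mulrDl mul1r lerD // ler_wpM2l.
Qed.

Let poly N z := psum (fun k => taylor psi k * z ^+ k) N.

Lemma polyS N z : poly N.+1 z = poly N z + taylor psi N * z ^+ N.
Proof. exact: psumS. Qed.

Lemma poly_mul_bound p N : H2 p -> H2 (fun z => poly N z * g z) /\
  cabs (sip (taylor (fun z => poly N z * g z)) (taylor p)) <=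
  Num.sqrt (A p) * (Y * K * W) * \sum_(0 <= k < N) (rcp R k - rcp R k.+1).
Proof.
move=> hp; have lp := hardy2_l2seq hp; elim: N => [|N [IH1 IH2]].
  have -> : (fun z => poly 0 z * g z) = (fun=> 0).
    by apply/funext => z; rewrite /poly /psum big_ord0 mul0r.
  split; first exact: hardy2_cst.
  rewrite big_geq // mulr0 (_ : sip _ _ = 0) ?cabs0 //.
  rewrite taylor_zero; apply: csum_unique; rewrite (_ : psum _ = fun=> 0); first exact: cvg_cst.
  by apply/funext => n; rewrite /psum big1 // => i _; rewrite mul0r.
have [hx tx] := hardy2_mulX N hg.
have [h1 t1] := hardy2_addZ (taylor psi N) IH1 hx.
have E : (fun z => poly N.+1 z * g z) = (fun z => poly N z * g z + taylor psi N * (z ^+ N * g z)).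
  by apply/funext => z; rewrite polyS; ring.
rewrite E; split => //; rewrite t1 sip_addZl //; [|exact: hardy2_l2seq|exact: hardy2_l2seq].
apply: le_trans (cabsD _ _) _; rewrite big_nat_recr //= mulrDr; apply: lerD => //.
rewrite cabsM; apply: le_trans (ler_pM (cabs_ge0 _) (cabs_ge0 _) (psiK N) (shift_coef_bound N hp)) _.
set q := expR (c / 2 * Num.sqrt N%:R).
have -> : expR (- (c * Num.sqrt N%:R)) = expR (- (c / 2 * Num.sqrt N%:R)) ^+ 2.
  by rewrite -expRM_natl; congr expR; field.
rewrite expRN -/q; have q0 : 0 < q by exact: expR_gt0.
have -> : K * q^-1 ^+ 2 * (Num.sqrt (A p) * (Y * (N.+1%:R * q))) =
   Num.sqrt (A p) * Y * K * (N.+1%:R * q^-1) by field; rewrite gt_eqF.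
have := hW N; rewrite expRN -/q => hWN.
apply: (@le_trans _ _ (Num.sqrt (A p) * Y * K * (W * (rcp R N - rcp R N.+1)))).
  by rewrite ler_wpM2l // !mulr_ge0 ?sqrtr_ge0.
by rewrite le_eqVlt; apply/orP; left; apply/eqP; ring.
Qed.

Lemma poly_remainder N : bounded_disc (fun z => psi z - poly N z) (K * W * rcp R N).
Proof.
move=> z z1; have hp := hardy_infty_hardy2 pd pB.
have [C' /l2_bounded cC] := hardy2_l2 hp.
have := geo_cvg (pser_geo cC z1); rewrite -/(pser _ z) -(hardy2_pser hp z1) => cv.
apply: (ccvg_bound cv (n0 := N)) => n Nn; apply: le_trans (psum_diff _ Nn) _.
apply: (@le_trans _ _ (\sum_(N <= k < n) K * W * (rcp R k - rcp R k.+1))); last first.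
  rewrite -mulr_sumr sum_rcp // ler_wpM2l ?mulr_ge0 // lerBlDr lerDl.
  exact: ltW (rcp_gt0 _ _).
apply: ler_sum => k _; rewrite cabsM cabsX; apply: (@le_trans _ _ (cabs (taylor psi k))).
  by rewrite ler_piMr ?cabs_ge0 // exprn_ile1 ?cabs_ge0 // ltW.
apply: le_trans (psiK k) _; rewrite -mulrA ler_wpM2l //; apply: le_trans (hW k).
apply: (@le_trans _ _ (expR (- (c / 2 * Num.sqrt k%:R)))).
  rewrite ler_expR lerN2 ler_wpM2r ?sqrtr_ge0 //; have := c0; lra.
by rewrite ler_peMl ?expR_ge0 // ler1n.
Qed.

(** The partial sums of psi satisfy the bound uniformly in N and converge to psi uniformly on the
    disc, so the pairing with p passes to the limit. *)
Lemma multiplier_bound p : H2 p ->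
  cabs (sip (taylor (fun z => psi z * g z)) (taylor p)) <= Num.sqrt (A p) * (Y * K * W).
Proof.
move=> hp; have lp := hardy2_l2seq hp; have a0 := A0 hp.
have hpg := hardy2_mul pd pB hg.
have Y0 : 0 <= Y by exact: sqrtr_ge0.
have n1 : 0 <= n2 (taylor g) by apply: n2_ge0; exact: hardy2_l2seq.
have n0 : 0 <= n2 (taylor p) by exact: n2_ge0.
pose X := K * W * Num.sqrt (n2 (taylor g) * n2 (taylor p)).
have X0 : 0 <= X by rewrite !mulr_ge0 ?sqrtr_ge0.
apply/ler_addgt0Pr => e e0.
have eX : 0 < e / (X + 1) by rewrite divr_gt0 // ltr_wpDl.
have [N /(_ N (leqnn _)) hN] := rcp_small eX.
have [hs bs] := poly_mul_bound N hp.
have [hr tr] := hardy2_addZ (-1) hpg hs.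
have E : (fun z => psi z * g z + -1 * (poly N z * g z)) = (fun z => (psi z - poly N z) * g z).
  by apply/funext => z; ring.
have rd : diff_disc (fun z => psi z - poly N z).
  have -> : (fun z => psi z - poly N z) = (fun z => psi z + (-1) * poly N z).
    by apply/funext => z; rewrite mulN1r.
  move=> z z1; have [d hd] := pd z1.
  have [d' hd'] : exists d' : R[i], cdiff (poly N) z d'.
    elim: N {hN hs bs hr tr E} => [|N [d' IH]].
      exists 0; apply: cdiff_ext (cdiff_cst 0 z); exists 1 => // w _.
      by rewrite /poly /psum big_ord0.
    have [x hx] : exists x : R[i], cdiff (fun z => z ^+ N) z x.
      elim: N {IH d'} => [|N [x IH]]; first by exists 0; exact: cdiff_cst.
      eexists; apply: cdiff_ext (cdiffM (cdiff_id z) IH); exists 1 => // w _.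
      by rewrite exprS.
    eexists; apply: cdiff_ext (cdiffD IH (cdiffM (cdiff_cst (taylor psi N) z) hx)).
    by exists 1 => // w _; rewrite polyS.
  by eexists; exact: cdiffD hd (cdiffM (cdiff_cst (-1) z) hd').
have -> : sip (taylor (fun z => psi z * g z)) (taylor p) =
   sip (taylor (fun z => (psi z - poly N z) * g z)) (taylor p) +
   sip (taylor (fun z => poly N z * g z)) (taylor p).
  rewrite -E tr sip_addZl //; [|exact: hardy2_l2seq|exact: hardy2_l2seq]; ring.
apply: le_trans (cabsD _ _) _; rewrite addrC; apply: lerD.
  apply: le_trans bs _; rewrite sum_rcp // ler_piMr ?mulr_ge0 ?sqrtr_ge0 //.
  rewrite lerBlDr -[leLHS]addr0; apply: lerD; last exact: ltW (rcp_gt0 _ _).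
  by rewrite /rcp invr1.
have hr' : H2 (fun z => (psi z - poly N z) * g z) by rewrite -E.
have := sip_cs (hardy2_l2seq hr') lp; have := n2_mul rd (@poly_remainder N) hg.
set x := K * W * rcp R N; have r0 := rcp_gt0 R N.
have x0 : 0 <= x by rewrite !mulr_ge0 // ltW.
move=> h1 h2.
have h3 : cabs (sip (taylor (fun z => (psi z - poly N z) * g z)) (taylor p)) ^+ 2 <=
   (X * rcp R N) ^+ 2.
  apply: le_trans h2 _; apply: (@le_trans _ _ (x ^+ 2 * n2 (taylor g) * n2 (taylor p))).
    by rewrite ler_wpM2r.
  rewrite /X /x !exprMn (sqr_sqrtr (mulr_ge0 n1 n0)) le_eqVlt; apply/orP; left; apply/eqP; ring.
move: h3; rewrite ler_pXn2r ?nnegrE ?cabs_ge0 ?mulr_ge0 ?(ltW r0) // => h3.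
apply: le_trans h3 _; apply: (@le_trans _ _ (X * (e / (X + 1)))); first by rewrite ler_wpM2l.
by rewrite mulrA ler_pdivrMr ?ltr_wpDl // mulrDr mulr1 [e * X]mulrC lerDl (ltW e0).
Qed.

End Bound.

(** The functional to represent sends a p to <p, g>. Its graph is used, so that neither injectivity
    of p -> a p nor a closed domain has to be discussed; the bound controls both. *)
Lemma range_of_bound (a g : R[i] -> R[i]) (M X : R) : diff_disc a -> bounded_disc a M -> H2 g ->
  (forall p, H2 p -> cabs (sip (taylor g) (taylor p)) <=
     Num.sqrt (n2 (taylor (fun z => a z * p z))) * X) ->
  range_space (a : R[i]^o -> R[i]^o) (g : R[i]^o -> R[i]^o).
Proof.
move=> ad aM hg hX.
pose Gam (x : nat -> R[i]) (l : R[i]) := exists p : R[i] -> R[i], [/\ H2 p, x = taylor (fun z => a z * p z) &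
  l = sip (taylor p) (taylor g)].
have lg := hardy2_l2seq hg.
have [f [lf fE]] : exists f : nat -> R[i], l2seq f /\ forall x l, Gam x l -> sip x f = l.
  apply: (@riesz_graph _ Gam (X ^+ 2)).
  - exists (taylor (fun z => a z * 0)), (sip (taylor (fun=> 0)) (taylor g)), (fun=> 0).
    by split => //; exact: hardy2_cst.
  - by move=> x l [p [hp -> _]]; apply: hardy2_l2seq; exact: hardy2_mul ad aM hp.
  - move=> x l tau y m [p [hp -> ->]] [q [hq -> ->]]; exists (fun z => p z + tau * q z).
    have [h1 t1] := hardy2_addZ tau hp hq.
    have [_ t2] := hardy2_addZ tau (hardy2_mul ad aM hp) (hardy2_mul ad aM hq).
    split; [by []| |by rewrite t1 sip_addZl //; exact: hardy2_l2seq].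
    by rewrite -t2; apply: taylor_eq => z _; ring.
  - move=> x l [p [hp -> ->]].
    have n0 : 0 <= n2 (taylor (fun z => a z * p z)).
      by apply: n2_ge0; apply: hardy2_l2seq; exact: hardy2_mul ad aM hp.
    have lp := hardy2_l2seq hp.
    rewrite (sip_conj lg lp) cabs_conj -[n2 _]sqr_sqrtr // -exprMn mulrC.
    have h := hX p hp.
    by rewrite ler_pXn2r ?nnegrE ?cabs_ge0 // (le_trans _ h) ?cabs_ge0.
have [hF tF] := l2seq_pser lf.
exists (pser f); [exact: hF|]; apply/(coanalytic_toeplitzP _ ad aM hF); split => // p hp.
have lap := hardy2_l2seq (hardy2_mul ad aM hp); have lp := hardy2_l2seq hp.
rewrite tF (sip_conj lap lf) (fE _ (sip (taylor p) (taylor g))); last by exists p.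
by rewrite -(sip_conj lp lg).
Qed.

Theorem root_exp_multiplier (a psi : R[i] -> R[i]) :
  root_exp_class (psi : R[i]^o -> R[i]^o) -> hardy_infty_nonzero (a : R[i]^o -> R[i]^o) ->
  multipliers (a : R[i]^o -> R[i]^o) (psi : R[i]^o -> R[i]^o).
Proof.
move=> [/hardy_inftyP [pd [B pB]] [c c0 [K psiK]]] [/hardy_inftyP [ad [M aM]] [z0 /discE z01 az0]].
split; first exact/analytic_discP.
move=> g [h hh tg]; have hp := hardy_infty_hardy2 pd pB.
have pK (k : nat) : cabs (taylor psi k) <= K * expR (- (c * Num.sqrt k%:R)).
  by have := psiK k; rewrite fourier_taylor // cabsE lecR.
have K0 : 0 <= K.
  have := pK 0%N; rewrite sqrtr0 mulr0 oppr0 expR0 mulr1; apply: le_trans; exact: cabs_ge0.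
have [ua bua] := brep_exists (hardy_infty_hardy2 ad aM).
have [C C0 hC] := taylor_growth ad aM z01 az0 bua c0.
have c2 : 0 < c / 2 by rewrite divr_gt0.
have [W W0 hW] := root_exp_decay c2.
have [hg _] := (coanalytic_toeplitzP _ ad aM hh).1 tg.
apply: (range_of_bound ad aM (hardy2_mul pd pB hg)).
exact: (multiplier_bound ad aM pd pB hh hg tg c0 C0 W0 K0 pK hC hW).
Qed.

End Sufficiency.

(** * Necessity of root-exponential decay *)

Section CauchyKernelPowers.
Variable R : realType.
Local Notation H2 f := (hardy2 (f : R[i]^o -> R[i]^o)).
Implicit Types (f g : R[i] -> R[i]) (c d : nat -> R[i]) (z eta : R[i]).

Lemma pser_addZ c d (K K' : R) tau z : cbounded c K -> cbounded d K' -> cabs z < 1 ->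
  pser (addZ c tau d) z = pser c z + tau * pser d z.
Proof.
move=> cK dK z1; apply: csum_unique; apply/(@ccvgP R _ _ eventually_filter) => r r0.
have T0 : 0 < cabs tau + 1 by rewrite ltr_wpDl ?cabs_ge0.
have r2 : 0 < r / 2 / (cabs tau + 1) by rewrite !divr_gt0.
have r2' : 0 < r / 2 by rewrite divr_gt0.
have /(@ccvgP R _ _ eventually_filter) /(_ _ r2') h1 := geo_cvg (pser_geo cK z1).
have /(@ccvgP R _ _ eventually_filter) /(_ _ r2) h2 := geo_cvg (pser_geo dK z1).
apply: filterS2 h1 h2 => N h1 h2.
have -> : psum (fun n => addZ c tau d n * z ^+ n) N =
   psum (fun n => c n * z ^+ n) N + tau * psum (fun n => d n * z ^+ n) N.
  rewrite /psum mulr_sumr -big_split /=; apply: eq_bigr => n _; rewrite /addZ; ring.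
have key (a b p q t : R[i]) : a + t * b - (p + t * q) = (a - p) + t * (b - q) by ring.
rewrite key; apply: le_lt_trans (cabsD _ _) _; rewrite cabsM.
have : cabs tau * cabs (pser d z - psum (fun n => d n * z ^+ n) N) <= r / 2.
  move: h2; rewrite ltr_pdivlMr // => h2; apply: le_trans (ltW h2).
  by rewrite mulrC ler_wpM2l ?cabs_ge0 // lerDl.
rewrite -/(pser c z) in h1; lra.
Qed.

Lemma taylor_one : taylor (fun=> 1 : R[i]) = fun n => (n == 0%N)%:R.
Proof.
apply: (@taylor_unique _ _ 1) => [k|w w1].
  by case: k => [|k]; rewrite ?cabs1 //= cabs0.
symmetry; apply: csum_unique; apply/(@ccvgP R _ _ eventually_filter) => x x0.
exists 1%N => // -[//|m] _; rewrite /psum big_ord_recl expr0 mulr1 big1 ?addr0 ?subrr ?cabs0 //.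
by move=> i _; rewrite mul0r.
Qed.

(** The Cauchy kernel 1 / (1 - eta z), see [cker_inv]; as a power series its coefficients are known
    at once. *)
Definition cker eta z : R[i] := pser (fun n => eta ^+ n) z.

Section Kernel.
Variable eta : R[i].
Hypothesis eta1 : cabs eta < 1.

Let e0 : 0 <= cabs eta. Proof. exact: cabs_ge0. Qed.

Lemma cker_bounded : cbounded (fun n => eta ^+ n) 1.
Proof. by move=> n; rewrite cabsX exprn_ile1 // ltW. Qed.

Lemma cker_diff : diff_disc (cker eta).
Proof. exact: pser_diff_disc cker_bounded. Qed.

Lemma cker_eq z : cabs z < 1 -> cker eta z = 1 + eta * (z * cker eta z).
Proof.
move=> z1; have l2e : l2 (fun n => eta ^+ n) (1 / (1 - cabs eta ^+ 2)).
  have x1 : cabs eta ^+ 2 < 1 by rewrite expr_lt1.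
  move=> N; have := geo_sum_le 0 N (sqr_ge0 (cabs eta)) x1; rewrite big_mkord expr0 => h.
  by apply: le_trans h; apply: ler_sum => n _; rewrite cabsX -!exprM mulnC.
have le_ : l2seq (fun n => eta ^+ n) by eexists; exact: l2e.
have [hv tv] := l2seq_pser le_; have [hx tx] := hardy2_mulX 1 hv.
have [h1 t1] := hardy2_addZ eta (hardy2_cst 1) hx.
have -> : 1 + eta * (z * cker eta z) = (fun z => 1 + eta * (z ^+ 1 * pser (fun n => eta ^+ n) z)) z by [].
rewrite (hardy2_pser h1 z1) t1 tx tv; congr (pser _ z); apply/funext => n.
rewrite taylor_one; case: n => [|n]; rewrite /addZ /shiftn /=; first by rewrite mulr0 addr0 expr0.
by rewrite subn1 add0r exprS.
Qed.

Lemma cker_inv z : cabs z < 1 -> cker eta z * (1 - eta * z) = 1.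
Proof. by move=> z1; rewrite mulrBr mulr1 {1}cker_eq //; ring. Qed.

Lemma cker_le z : cabs z < 1 -> cabs (cker eta z) <= 1 / (1 - cabs eta).
Proof.
move=> z1; have := congr1 (@cabs R) (cker_inv z1); rewrite cabsM cabs1 => h.
have d : 1 - cabs eta <= cabs (1 - eta * z).
  have := cabsD (1 - eta * z) (eta * z); rewrite subrK cabs1 cabsM.
  have : cabs eta * cabs z <= cabs eta by rewrite ler_piMr // ltW.
  lra.
by rewrite ler_pdivlMr ?subr_gt0 // -[leRHS]h ler_wpM2l ?cabs_ge0.
Qed.

(** Twice the kernel minus 1 is (1 + eta z) / (1 - eta z), whose real part is (1 - |eta z|^2) / |1 -
    eta z|^2. *)
Lemma cker_Re z : cabs z < 1 -> 0 <= 2 * complex.Re (cker eta z) - 1.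
Proof.
move=> z1; have i := cker_inv z1; set v := cker eta z in i *.
have vE : v = (cabs v ^+ 2)%:C * ((1 - eta * z)^*)%C.
  rewrite -mul_conj_cabs -mulrA -conjM i; by rewrite conjc1 mulr1.
have i2 : cabs v ^+ 2 * cabs (1 - eta * z) ^+ 2 = 1 by rewrite -exprMn -cabsM i cabs1 expr1n.
have -> : complex.Re v = cabs v ^+ 2 * complex.Re (1 - eta * z).
  by rewrite {1}vE Re_realM Re_conj.
have ez : cabs (eta * z) ^+ 2 <= 1.
  by rewrite cabsM exprn_ile1 ?mulr_ge0 ?cabs_ge0 // mulr_ile1 ?cabs_ge0 // ltW.
have dE : cabs (1 - eta * z) ^+ 2 = 2 * complex.Re (1 - eta * z) - 1 + cabs (eta * z) ^+ 2.
  by rewrite !cabs_sqr ReD ImD ReN ImN /=; ring.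
have := mulr_ge0 (sqr_ge0 (cabs v)) (_ : 0 <= 1 - cabs (eta * z) ^+ 2).
rewrite subr_ge0 => /(_ ez); rewrite dE in i2; move: i2.
move: (cabs v ^+ 2) (complex.Re _) (cabs _ ^+ 2) => A B C; lra.
Qed.

Lemma cker_le2 z : cabs z < 1 -> cabs (2 * cker eta z - 1) <= 2 / (1 - cabs eta).
Proof.
move=> z1; have i := cker_inv z1.
have -> : 2 * cker eta z - 1 = cker eta z * (1 + eta * z) by rewrite -{2}i; ring.
rewrite cabsM mulrC; apply: (@le_trans _ _ (2 * (1 / (1 - cabs eta)))); last by rewrite mulrA mulr1.
apply: ler_pM; rewrite ?cabs_ge0 ?cker_le //.
apply: le_trans (cabsD _ _) _; rewrite cabs1 cabsM.
have : cabs eta * cabs z <= 1 by rewrite mulr_ile1 ?cabs_ge0 // ltW.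
lra.
Qed.

Lemma diff_discX f n : diff_disc f -> diff_disc (fun z => f z ^+ n).
Proof.
move=> fd z z1; have [d hd] := fd z z1; elim: n => [|n [d' IH]].
  by exists 0; exact: cdiff_cst.
eexists; apply: cdiff_ext (cdiffM hd IH); exists 1 => // w _.
by rewrite exprS.
Qed.

Lemma bounded_discX f (M : R) n : bounded_disc f M -> bounded_disc (fun z => f z ^+ n) (M ^+ n).
Proof.
move=> fM z z1; rewrite cabsX; have := bounded_ge0 fM.
by move=> M0; apply: lerXn2r; rewrite ?nnegrE ?cabs_ge0 ?fM.
Qed.

(** Pascal's rule, from v^{j+1} = v^j + eta z v^{j+1}. For j = 0 the truncated predecessor gives the
    right coefficients, 1 at n = 0 and 0 elsewhere. *)
Lemma cker_pow j : H2 (fun z => cker eta z ^+ j) /\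
  forall n, taylor (fun z => cker eta z ^+ j) n = ('C((n + j).-1, n))%:R * eta ^+ n.
Proof.
have hv k : H2 (fun z => cker eta z ^+ k).
  by apply: hardy_infty_hardy2 (diff_discX k cker_diff) (bounded_discX k cker_le).
split=> //; elim: j => [|j IH] n.
  have -> : (fun z => cker eta z ^+ 0) = fun=> 1 by [].
  rewrite taylor_one; case: n => [|n]; first by rewrite bin0 mul1r expr0.
  by rewrite addn0 /= bin_small ?mul0r.
have [hx tx] := hardy2_mulX 1 (hv j.+1); have [h1 t1] := hardy2_addZ eta (hv j) hx.
have E : taylor (fun z => cker eta z ^+ j.+1) =
    addZ (taylor (fun z => cker eta z ^+ j)) eta (shiftn 1 (taylor (fun z => cker eta z ^+ j.+1))).
  rewrite -tx -t1; apply: taylor_eq => z z1.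
  by rewrite [in LHS]exprS {1}cker_eq // !exprS; ring.
elim: n => [|n IHn]; rewrite E /addZ IH /shiftn /=.
  by rewrite !bin0 mulr0 addr0.
rewrite subn1 /= IHn !addnS /= binS natrD exprS; ring.
Qed.

End Kernel.
End CauchyKernelPowers.

(** * A polynomial in the Cauchy kernel that grows like the exponential of a pole *)

Section ExponentialSurrogate.
Variable R : realType.
Local Notation H2 f := (hardy2 (f : R[i]^o -> R[i]^o)).
Implicit Types (z eta : R[i]) (eps : R).

Lemma hardy2_sum (f : nat -> R[i] -> R[i]) (al : nat -> R[i]) (K : nat) : (forall j, H2 (f j)) ->
  H2 (fun z => \sum_(j < K) al j * f j z) /\
  forall n, taylor (fun z => \sum_(j < K) al j * f j z) n = \sum_(j < K) al j * taylor (f j) n.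
Proof.
move=> hf; elim: K => [|K [IH IHt]].
  have -> : (fun z => \sum_(j < 0) al j * f j z) = fun=> 0 by apply/funext => z; rewrite big_ord0.
  split; first exact: hardy2_cst.
  by move=> n; rewrite big_ord0 taylor_zero.
have [h1 t1] := hardy2_addZ (al K) IH (hf K).
have -> : (fun z => \sum_(j < K.+1) al j * f j z) = (fun z => \sum_(j < K) al j * f j z + al K * f K z).
  by apply/funext => z; rewrite big_ord_recr.
by split => // n; rewrite t1 /addZ IHt big_ord_recr.
Qed.

(* With [q = eps * (2 * cker eta - 1)] this is [(1 + q / N) ^+ N]: a substitute
   for [cexp q] whose Taylor coefficients are finite sums. *)
Definition expk eps (N : nat) eta z : R[i] :=
  ((1 - eps / N%:R)%:C + (2 * eps / N%:R)%:C * cker eta z) ^+ N.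

Definition expk_coef eps (N n : nat) : R := \sum_(j < N.+1)
  'C(N, j)%:R * (1 - eps / N%:R) ^+ (N - j) * (2 * eps / N%:R) ^+ j * 'C((n + j).-1, n)%:R.

Lemma expk_taylor eps N eta : cabs eta < 1 -> H2 (expk eps N eta) /\
  forall n, taylor (expk eps N eta) n = (expk_coef eps N n)%:C * eta ^+ n.
Proof.
move=> e1; have hv j : H2 (fun z => cker eta z ^+ j) by have [] := cker_pow e1 j.
pose al j : R[i] := ('C(N, j)%:R * (1 - eps / N%:R) ^+ (N - j) * (2 * eps / N%:R) ^+ j)%:C.
have [h1 t1] := hardy2_sum al N.+1 hv.
have E : expk eps N eta = (fun z => \sum_(j < N.+1) al j * cker eta z ^+ j).
  apply/funext => z; rewrite /expk exprDn; apply: eq_bigr => j _.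
  rewrite /al exprMn -mulr_natl; move: (1 - eps / N%:R) (2 * eps / N%:R) => A B.
  by rewrite !rmorphM rmorph_nat !rmorphXn; ring.
rewrite E; split => // n; rewrite t1 /expk_coef rmorph_sum mulr_suml; apply: eq_bigr => j _.
have [_ ->] := cker_pow e1 j.
by rewrite [in RHS]rmorphM /= rmorph_nat mulrA.
Qed.

Section Coefficients.
Variables (eps : R) (N : nat).
Hypotheses (eps0 : 0 < eps) (eps2 : eps <= 1 / 2) (N0 : (0 < N)%N).

Let A0 : 0 <= 1 - eps / N%:R.
Proof.
have n1 : 1 <= N%:R :> R by rewrite ler1n.
rewrite subr_ge0 ler_pdivrMr ?mul1r; last by rewrite ltr0n.
by have := eps2; lra.
Qed.

Let term_ge0 n j : 0 <=
  'C(N, j)%:R * (1 - eps / N%:R) ^+ (N - j) * (2 * eps / N%:R) ^+ j * 'C((n + j).-1, n)%:R :> R.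
Proof. by rewrite !mulr_ge0 ?exprn_ge0 ?divr_ge0 ?mulr_ge0 ?(ltW eps0). Qed.

Lemma expk_coef_ge0 n : 0 <= expk_coef eps N n.
Proof. by apply: sumr_ge0 => j _; exact: term_ge0. Qed.

(** The lower bound on N makes the increment x = q / N satisfy |x|^2 <= 1 / N, so that |1 + x|^2 <=
    e^{2 Re x + 1 / N}. The N-th power accounts for the extra 1 in the exponent. *)
Lemma expk_bound eta z : cabs eta < 1 -> cabs z < 1 -> (2 * eps / (1 - cabs eta)) ^+ 2 <= N%:R ->
  cabs (expk eps N eta z) ^+ 2 <= expR (1 + 2 * (eps * (2 * complex.Re (cker eta z) - 1))).
Proof.
move=> e1 z1 hN; set v := cker eta z; have n0 : 0 < N%:R :> R by rewrite ltr0n.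
have nn : N%:R != 0 :> R by rewrite gt_eqF.
pose x : R[i] := (eps / N%:R)%:C * (2 * v - 1).
have -> : expk eps N eta z = (1 + x) ^+ N.
  rewrite /expk /x -/v; congr (_ ^+ _).
  rewrite -mulrA; move: (eps / N%:R) => y.
  by rewrite rmorphB rmorph1 rmorphM rmorph_nat; ring.
have Rx : complex.Re x = eps / N%:R * (2 * complex.Re v - 1).
  rewrite Re_realM ReD ReN (_ : 2 = (2 : R)%:C) ?Re_realM //; last by rewrite rmorph_nat.
have cx : cabs x ^+ 2 <= N%:R^-1.
  rewrite cabsM cabs_real ger0_norm ?divr_ge0 ?(ltW eps0) //.
  rewrite -(@ler_pM2l _ (N%:R ^+ 2)) ?exprn_gt0 // -exprMn mulrA mulrCA mulfV // mulr1.
  rewrite (_ : N%:R ^+ 2 / N%:R = N%:R); last by field.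
  apply: le_trans hN.
  rewrite ler_pXn2r ?nnegrE ?mulr_ge0 ?cabs_ge0 ?(ltW eps0) //; last first.
    by rewrite invr_ge0 subr_ge0 ltW.
  by rewrite [2 * eps]mulrC -mulrA ler_wpM2l ?(ltW eps0) ?cker_le2.
have h1 : cabs (1 + x) ^+ 2 <= expR (2 * complex.Re x + N%:R^-1).
  apply: le_trans (expR_ge1Dx _); move: cx; rewrite !cabs_sqr ReD ImD /=; lra.
rewrite cabsX -exprM mulnC exprM.
apply: (@le_trans _ _ (expR (2 * complex.Re x + N%:R^-1) ^+ N)).
  by rewrite ler_pXn2r ?nnegrE ?sqr_ge0 ?expR_ge0.
rewrite -expRM_natl ler_expR Rx le_eqVlt; apply/orP; left; apply/eqP; by field.
Qed.

Lemma ffact_lower m k : (m ^ k <= (m + k) ^_ k)%N.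
Proof.
elim: k => [|k IH]; first by rewrite expn0 ffactn0.
by rewrite addnS ffactnS expnS /= leq_mul // leqW // leq_addr.
Qed.

Lemma fact_upper m k : (k <= m)%N -> (k`! <= m ^ k)%N.
Proof.
elim: k => [|k IH] km; first by rewrite expn0.
by rewrite factS expnS leq_mul // IH // ltnW.
Qed.

(** All terms are nonnegative; only j = i + 1 = J is kept. From 2 J^2 <= N and eps <= 1 / 2 follow
    C(N, J) J! >= N^J / 2 and (1 - eps / N)^{N - J} >= 1 / 2, the origin of the 4. The last binomial
    is at least n^i / i!, which loses one factor n, and J! i! <= J^{2J}. *)
Lemma expk_coef_term n i : (0 < n)%N -> (2 * i.+1 ^ 2 <= N)%N ->
  (2 * eps * n%:R / i.+1%:R ^+ 2) ^+ i.+1 / (4 * n%:R) <= expk_coef eps N n.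
Proof.
move=> n0 hJ; set J := i.+1 in hJ *.
have JN : (J <= N)%N.
  by apply: leq_trans hJ; rewrite -mulnn mulnA mulnC leq_pmulr // muln_gt0.
have N0' : 0 < N%:R :> R by rewrite ltr0n.
have n0' : 0 < n%:R :> R by rewrite ltr0n.
have J0 : 0 < J%:R :> R by rewrite ltr0n.
apply: (@le_trans _ _ ('C(N, J)%:R * (1 - eps / N%:R) ^+ (N - J) * (2 * eps / N%:R) ^+ J * 'C((n + J).-1, n)%:R)); last first.
  rewrite /expk_coef (bigD1 (Ordinal (_ : (J < N.+1)%N))) //= lerDl.
  by apply: sumr_ge0 => j _; exact: term_ge0.
have b1 : 1 / 2 <= (1 - eps / N%:R) ^+ (N - J).
  have A1 : 1 - eps / N%:R <= 1 by rewrite gerBl divr_ge0 // ltW.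
  apply: (@le_trans _ _ ((1 - eps / N%:R) ^+ N)); last by rewrite ler_wiXn2l // leq_subr.
  apply: le_trans (bernoulli N A0 A1).
  have -> : N%:R * (1 - (1 - eps / N%:R)) = eps by field; rewrite gt_eqF.
  by have := eps2; lra.
have b2 : 1 / 2 <= 'C(N, J)%:R * J`!%:R / N%:R ^+ J :> R.
  rewrite -natrM bin_ffact.
  have h1 : (N - J)%:R ^+ J <= (N ^_ J)%:R :> R.
    by rewrite -natrX ler_nat; have := ffact_lower (N - J) J; rewrite subnK.
  apply: (@le_trans _ _ (((N - J)%:R / N%:R) ^+ J)); last first.
    by rewrite expr_div_n ler_pM2r ?invr_gt0 ?exprn_gt0.
  have y1 : (N - J)%:R / N%:R <= 1 :> R by rewrite ler_pdivrMr // mul1r ler_nat leq_subr.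
  have y0 : 0 <= (N - J)%:R / N%:R :> R by rewrite divr_ge0.
  apply: le_trans (bernoulli J y0 y1); rewrite natrB //.
  have -> : J%:R * (1 - (N%:R - J%:R) / N%:R) = J%:R ^+ 2 / N%:R :> R by field; rewrite gt_eqF.
  have : J%:R ^+ 2 / N%:R <= 1 / 2 :> R.
    rewrite ler_pdivrMr // mulrC mulrA ler_pdivlMr // mulr1 mulrC.
    by rewrite -natrX -natrM ler_nat.
  lra.
have b3 : n%:R ^+ i <= 'C((n + J).-1, n)%:R * i`!%:R :> R.
  rewrite /J addnS /= -natrX -natrM ler_nat.
  have -> : 'C(n + i, n) = 'C(n + i, i) by rewrite -[RHS]bin_sub ?leq_addl // addnK.
  by rewrite bin_ffact; exact: ffact_lower.
have f1 : 0 < J`!%:R :> R by rewrite ltr0n fact_gt0.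
have f2 : 0 < i`!%:R :> R by rewrite ltr0n fact_gt0.
have f12 : J`!%:R * i`!%:R <= (J%:R ^+ 2) ^+ J :> R.
  rewrite -exprM mulnC mulnC mul2n -addnn exprD; apply: ler_pM => //.
    by rewrite -natrX ler_nat fact_upper.
  rewrite exprS -[i`!%:R]mul1r; apply: ler_pM => //; first by rewrite ler1n.
  by rewrite -natrX ler_nat fact_upper // leqnSn.
have lo : (1 / 2) * (1 / 2) * (2 * eps) ^+ J * n%:R ^+ i <=
   ('C(N, J)%:R * J`!%:R / N%:R ^+ J) * (1 - eps / N%:R) ^+ (N - J) * (2 * eps) ^+ J * ('C((n + J).-1, n)%:R * i`!%:R).
  apply: ler_pM => //; rewrite ?exprn_ge0 ?mulr_ge0 ?exprn_ge0 ?mulr_ge0 ?(ltW eps0) //.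
  rewrite ler_wpM2r ?exprn_ge0 ?mulr_ge0 ?(ltW eps0) //.
  by apply: ler_pM.
have E : ('C(N, J)%:R * J`!%:R / N%:R ^+ J) * (1 - eps / N%:R) ^+ (N - J) * (2 * eps) ^+ J * ('C((n + J).-1, n)%:R * i`!%:R) =
  ('C(N, J)%:R * (1 - eps / N%:R) ^+ (N - J) * (2 * eps / N%:R) ^+ J * 'C((n + J).-1, n)%:R) * (J`!%:R * i`!%:R).
  rewrite [(2 * eps / N%:R) ^+ J]expr_div_n; ring.
rewrite E in lo.
rewrite -(ler_pM2r (_ : 0 < J`!%:R * i`!%:R)) ?mulr_gt0 //; apply: le_trans lo.
have -> : (1 / 2) * (1 / 2) * (2 * eps) ^+ J * n%:R ^+ i =
   (2 * eps * n%:R / J%:R ^+ 2) ^+ J / (4 * n%:R) * (J%:R ^+ 2) ^+ J.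
  rewrite expr_div_n [(2 * eps * n%:R) ^+ J]exprMn [n%:R ^+ J]exprS.
  have zJ : (J%:R ^+ 2) ^+ J != 0 :> R by rewrite gt_eqF // !exprn_gt0.
  move: ((2 * eps) ^+ J) (n%:R ^+ i) ((J%:R ^+ 2) ^+ J) zJ => x y w zw; field.
  by rewrite zw gt_eqF.
rewrite ler_wpM2l // divr_ge0 ?mulr_ge0 ?exprn_ge0 //.
by rewrite divr_ge0 ?sqr_ge0 // !mulr_ge0 // ltW.
Qed.

End Coefficients.

Lemma expR1_le4 : expR 1 <= 4 :> R.
Proof.
have : expR (- (1 / 2)) >= 1 / 2 :> R by have := expR_ge1Dx (- (1 / 2) : R); lra.
rewrite expRN; have e0 : 0 < expR (1 / 2) :> R by exact: expR_gt0.
rewrite -[X in _ <= X]div1r ler_pdivlMr // => h.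
have -> : expR 1 = expR (1 / 2) ^+ 2 :> R by rewrite -expRM_natl; congr expR; field.
have h2 : expR (1 / 2) <= 2 :> R by move: h; lra.
by rewrite (_ : 4 = 2 ^+ 2) ?ler_pXn2r ?nnegrE ?(ltW e0) // -natrX.
Qed.

(** With s^2 = eps n / 2 and J the integer part of s, the base 2 eps n / J^2 of [expk_coef_term] is
    at least 4 > e, so its J-th power exceeds e^{s - 1}. For s < 1 the term J = 1 is used, whence
    the factor eps. *)
Lemma expk_coef_growth eps n : 0 < eps -> eps <= 1 / 2 -> (0 < n)%N ->
  exists N1 : nat, forall N : nat, (N1 <= N)%N -> (0 < N)%N ->
  eps / (4 * expR 1 * n%:R) * expR (Num.sqrt (eps * n%:R / 2)) <= expk_coef eps N n.
Proof.
move=> e0 e2 n0; set s := Num.sqrt _.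
have n1 : 1 <= n%:R :> R by rewrite ler1n.
have s0 : 0 <= s by exact: sqrtr_ge0.
have ss : s ^+ 2 = eps * n%:R / 2 by rewrite sqr_sqrtr // divr_ge0 // mulr_ge0 // ltW.
have E0 : 0 < expR 1 :> R by exact: expR_gt0.
have np : 0 < n%:R :> R by rewrite ltr0n.
have [s1|s1] := ltP s 1.
  exists 2%N => N N2 N0; apply: le_trans (@expk_coef_term eps N e0 e2 N0 n 0 n0 _); last by rewrite exp1n.
  rewrite expr1 expr1n divr1.
  have -> : 2 * eps * n%:R / (4 * n%:R) = eps / 2 by field; rewrite gt_eqF.
  apply: (@le_trans _ _ (eps / (4 * expR 1 * n%:R) * expR 1)).
    rewrite ler_wpM2l ?ler_expR ?(ltW s1) // divr_ge0 ?(ltW e0) //.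
  have -> : eps / (4 * expR 1 * n%:R) * expR 1 = eps / 4 / n%:R by field; rewrite !gt_eqF.
  rewrite ler_pdivrMr //; apply: (@le_trans _ _ (eps / 2 * 1)); first by lra.
  by rewrite ler_wpM2l // divr_ge0 // ltW.
have := truncn_itv s0; move: (Num.truncn s) => J /andP[J1 J2].
have Jp : (0 < J)%N.
  rewrite lt0n; apply/eqP => Jz; move: J2; rewrite Jz => h.
  by move: (lt_le_trans h s1); rewrite ltxx.
exists (2 * J ^ 2)%N => N hN N0; case: J Jp J1 J2 hN => // i _ J1 J2 hN.
apply: le_trans (expk_coef_term e0 e2 N0 n0 hN).
have J0 : 0 < i.+1%:R :> R by rewrite ltr0n.
have q4 : expR 1 <= 2 * eps * n%:R / i.+1%:R ^+ 2.
  apply: le_trans expR1_le4 _; rewrite ler_pdivlMr ?exprn_gt0 //.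
  have : i.+1%:R ^+ 2 <= s ^+ 2 by rewrite ler_pXn2r ?nnegrE.
  rewrite ss; move: (i.+1%:R ^+ 2) => x; lra.
apply: (@le_trans _ _ (expR 1 ^+ i.+1 / (4 * n%:R))); last first.
  apply: ler_wpM2r; first by rewrite invr_ge0 mulr_ge0.
  by rewrite ler_pXn2r ?nnegrE ?(ltW E0) // (le_trans _ q4) // ltW.
have g : expR s <= expR 1 * expR 1 ^+ i.+1.
  rewrite -exprS -expRM_natl mulr1 ler_expR; exact: ltW.
have -> : expR 1 ^+ i.+1 / (4 * n%:R) = 1 / (4 * expR 1 * n%:R) * (expR 1 * expR 1 ^+ i.+1) :> R.
  by field; rewrite !gt_eqF.
apply: ler_pM; rewrite ?expR_ge0 //; first by rewrite divr_ge0 ?(ltW e0) // !mulr_ge0 // ltW.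
by apply: ler_wpM2r; [rewrite invr_ge0 !mulr_ge0 // ltW|lra].
Qed.

End ExponentialSurrogate.

(** * A bounded symbol that detects insufficient decay *)

Section Necessity.
Variable R : realType.
Local Notation H2 f := (hardy2 (f : R[i]^o -> R[i]^o)).
Implicit Types (f g p h phi : R[i] -> R[i]) (z : R[i]).

Lemma csum_head (u : nat -> R[i]) : (forall n, u n.+1 = 0) -> csum u = u 0%N.
Proof.
move=> u0; apply: csum_unique; apply/(@ccvgP R _ _ eventually_filter) => x x0.
exists 1%N => // -[//|m] _; rewrite /psum big_ord_recl big1 ?addr0 ?subrr ?cabs0 //.
by move=> i _; rewrite u0.
Qed.

Lemma hardy2_at0 g : H2 g -> g 0 = taylor g 0.
Proof.
move=> hg; rewrite (hardy2_pser hg) ?cabs0 // /pser csum_head ?expr0 ?mulr1 // => n.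
by rewrite expr0n mulr0.
Qed.

Lemma taylor_cst (b : R[i]) : taylor (fun=> b) = fun n => b * (n == 0%N)%:R.
Proof.
have [_ ] := hardy2_addZ b (hardy2_cst (0 : R[i])) (hardy2_cst 1).
have -> : (fun z : R[i] => 0 + b * 1) = fun=> b by apply/funext => z; rewrite add0r mulr1.
by move=> ->; apply/funext => n; rewrite /addZ taylor_zero taylor_one add0r.
Qed.

Lemma sip_cst (b : R[i]) g : H2 g -> sip (taylor (fun=> b)) (taylor g) = b * ((g 0)^*)%C.
Proof.
move=> hg; rewrite /sip csum_head ?taylor_cst => [|n]; first by rewrite mulr1 -hardy2_at0.
by rewrite mulr0 mul0r.
Qed.

(** The preimage is the constant 1 / conj(a(0)), since pairing a constant with a h sees only a(0)
    h(0). *)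
Lemma one_in_range (a : R[i] -> R[i]) (M : R) : diff_disc a -> bounded_disc a M -> a 0 != 0 ->
  range_space (a : R[i]^o -> R[i]^o) (fun=> 1).
Proof.
move=> ad aM a0; have hb := hardy2_cst (((a 0)^*)%C^-1 : R[i]).
exists (fun=> ((a 0)^*)%C^-1) => //; apply/(coanalytic_toeplitzP _ ad aM hb).
split; first exact: hardy2_cst.
move=> h hh; rewrite !sip_cst //; last exact: hardy2_mul ad aM hh.
by rewrite conjM mulrA mulVf // -cabs_eq0 cabs_conj cabs_eq0.
Qed.

Lemma multiplier_hardy2 phi :
  multipliers ((fun=> 1) : R[i]^o -> R[i]^o) (phi : R[i]^o -> R[i]^o) -> H2 phi.
Proof.
move=> [_ H]; have d1 := @diff_disc_cst R 1.
have b1 : bounded_disc (fun=> 1 : R[i]) 1 by move=> z _; rewrite cabs1.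
have [f hf tf] := H _ (one_in_range d1 b1 (oner_neq0 _)).
have [hg _] := (coanalytic_toeplitzP _ d1 b1 hf).1 tf.
by move: hg; congr (H2 _); apply/funext => z; rewrite mulr1.
Qed.

Lemma multiplier_pairing (a phi : R[i] -> R[i]) (M : R) : diff_disc a -> bounded_disc a M -> a 0 != 0 ->
  multipliers (a : R[i]^o -> R[i]^o) (phi : R[i]^o -> R[i]^o) ->
  exists2 f, H2 f & forall p, H2 p ->
    sip (taylor f) (taylor (fun z => a z * p z)) = sip (taylor phi) (taylor p).
Proof.
move=> ad aM a0 [_ H]; have [f hf tf] := H _ (one_in_range ad aM a0).
have [_ tE] := (coanalytic_toeplitzP _ ad aM hf).1 tf.
exists f; [exact: hf|move=> p hp].
by rewrite (tE p hp) (@taylor_eq _ (fun z => phi z * 1) phi (fun z _ => mulr1 (phi z))).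
Qed.

Section Product.
Variables (eta : nat -> R[i]) (NN : nat -> nat).
Hypothesis eta1 : forall k, cabs (eta k) < 1.

(** The successive values of eps: summable, and at most 1 / 2 as the lower bound on the coefficients
    requires. *)
Definition weps (k : nat) : R := (1 / 2) ^+ k.+1.

Lemma weps_gt0 k : 0 < weps k.
Proof. by rewrite exprn_gt0 // divr_gt0. Qed.

Lemma weps_le k : weps k <= 1 / 2.
Proof. by rewrite /weps exprS ler_piMr ?divr_ge0 // exprn_ile1 ?divr_ge0 //; lra. Qed.

(** Taylor coefficients of q_k = eps_k (1 + eta_k z) / (1 - eta_k z), in the form eps_k (2 [cker] -
    1). *)
Definition pole_coef k n : R[i] := - (weps k)%:C * (n == 0%N)%:R + (2 * weps k)%:C * eta k ^+ n.

Definition pole_sum K n : R[i] := psum (fun k => pole_coef k n) K.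

Definition pole_series n : R[i] := csum (fun k => pole_coef k n).

Lemma pole_geo n : geo_dominated (fun k => pole_coef k n) (3 / 2) (1 / 2).
Proof.
split; [by rewrite divr_ge0|lra|move=> k].
have -> : 3 / 2 * (1 / 2) ^+ k = weps k + 2 * weps k by rewrite /weps exprS; field.
apply: le_trans (cabsD _ _) _; have e0 := ltW (weps_gt0 k).
rewrite !cabsM cabsN !cabs_real !ger0_norm ?mulr_ge0 //; apply: lerD.
  by case: n => [|n] /=; rewrite ?cabs1 ?cabs0 ?mulr1 ?mulr0.
by rewrite ler_piMr ?mulr_ge0 // cabsX exprn_ile1 ?cabs_ge0 // ltW.
Qed.

Lemma pole_bounded k : cbounded (pole_coef k) (3 / 2).
Proof.
move=> n; have [_ _ h] := pole_geo n; apply: le_trans (h k) _.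
by rewrite ler_piMr ?divr_ge0 // exprn_ile1 ?divr_ge0 //; lra.
Qed.

Lemma pole_sum_bounded K : cbounded (pole_sum K) 3.
Proof.
move=> n; have := psum_diff (fun k => pole_coef k n) (leq0n K).
rewrite {2}/psum big_ord0 subr0 => /le_trans; apply; have [h0 h1 h] := pole_geo n.
apply: (@le_trans _ _ (\sum_(0 <= k < K) 3 / 2 * (1 / 2) ^+ k)); first by apply: ler_sum_nat => k _.
have := geo_sum_le 0 K h0 h1; rewrite -mulr_sumr expr0.
have -> : 1 / (1 - 1 / 2) = 2 :> R by field.
move: (\sum_(_ <= _ < _) _) => x; lra.
Qed.

Lemma pole_series_bounded : cbounded pole_series 3.
Proof.
move=> n; have := geo_csum_le (pole_geo n).
by have -> : 3 / 2 / (1 - 1 / 2) = 3 :> R by field.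
Qed.

Lemma pole_tail K : cbounded (fun n => pole_series n - pole_sum K n) (3 * (1 / 2) ^+ K).
Proof.
move=> n; have := geo_tail K (pole_geo n).
by have -> : 3 / 2 * ((1 / 2) ^+ K / (1 - 1 / 2)) = 3 * (1 / 2) ^+ K :> R by field.
Qed.

Lemma Re_pole k z : cabs z < 1 ->
  complex.Re (pser (pole_coef k) z) = weps k * (2 * complex.Re (cker (eta k) z) - 1).
Proof.
move=> z1; pose c n : R[i] := - (weps k)%:C * (n == 0%N)%:R.
have -> : pole_coef k = addZ c (2 * weps k)%:C (fun n => eta k ^+ n) by [].
have cb : cbounded c (weps k).
  move=> n; rewrite /c cabsM cabsN cabs_real ger0_norm ?(ltW (weps_gt0 k)) //.
  by case: n => [|n] /=; rewrite ?cabs1 ?cabs0 ?mulr1 ?mulr0 // (ltW (weps_gt0 k)).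
rewrite (pser_addZ _ cb (cker_bounded (eta1 k)) z1).
have -> : pser c z = - (weps k)%:C.
  by rewrite /pser csum_head ?/c => [|n]; rewrite ?expr0 ?mulr1 //= mulr0 mul0r.
rewrite ReD Re_realM ReN -/(cker _ z) /=; ring.
Qed.

Lemma Re_pole_ge0 k z : cabs z < 1 -> 0 <= complex.Re (pser (pole_coef k) z).
Proof.
by move=> z1; rewrite Re_pole // mulr_ge0 ?(ltW (weps_gt0 k)) // cker_Re.
Qed.

Lemma Re_pole_sum K z : cabs z < 1 ->
  complex.Re (pser (pole_sum K) z) = \sum_(k < K) complex.Re (pser (pole_coef k) z).
Proof.
move=> z1; elim: K => [|K IH].
  rewrite big_ord0 (_ : pser _ z = 0) //; rewrite /pser.
  by rewrite csum_head => [|n]; rewrite /pole_sum /psum big_ord0 mul0r.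
have -> : pole_sum K.+1 = addZ (pole_sum K) 1 (pole_coef K).
  by apply/funext => n; rewrite /pole_sum psumS /addZ mul1r.
by rewrite (pser_addZ _ (pole_sum_bounded K) (pole_bounded K) z1) mul1r ReD IH big_ord_recr.
Qed.

(** Every q_j has nonnegative real part, so dropping the others from a long partial sum only lowers
    it; the tail of the series is at most e. *)
Lemma Re_pole_series k z : cabs z < 1 ->
  complex.Re (pser (pole_coef k) z) <= complex.Re (pser pole_series z).
Proof.
move=> z1; apply/ler_addgt0Pr => e e0.
have d0 : 0 < 1 - cabs z by rewrite subr_gt0.
have h0 : 0 <= 1 / 2 :> R by rewrite divr_ge0.
have h1 : 1 / 2 < 1 :> R by lra.
have k0 : 0 <= 3 / (1 - cabs z) by rewrite divr_ge0 // ltW.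
have [K hK] := geo_small h0 h1 k0 e0.
pose m := (K + k.+1)%N; have := hK m (leq_addr _ _) => hm.
have -> : pole_series = addZ (pole_sum m) 1 (fun n => pole_series n - pole_sum m n).
  by apply/funext => n; rewrite /addZ mul1r addrC subrK.
rewrite (pser_addZ _ (pole_sum_bounded m) (@pole_tail m) z1) mul1r ReD Re_pole_sum //.
have := geo_csum_le (pser_geo (@pole_tail m) z1); rewrite -/(pser _ z).
set t := pser (fun n => pole_series n - pole_sum m n) z => ht.
have h : - complex.Re t <= e.
  apply: le_trans (ler_norm _) _; rewrite normrN; apply: le_trans (Re_le_cabs _) _.
  apply: le_trans ht _; apply: le_trans (ltW hm); rewrite le_eqVlt; apply/orP; left; apply/eqP.
  by field; rewrite gt_eqF.
clearbody t; have km : (k < m)%N by rewrite /m addnS ltnS leq_addl.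
rewrite (bigD1 (Ordinal km)) // -!addrA lerDl.
apply: addr_ge0; first by apply: sumr_ge0 => i _; exact: Re_pole_ge0.
by rewrite addrC -lerBlDr sub0r.
Qed.

(** The product of all e^{-q_k}. Its modulus is at most that of each single factor, by
    [Re_pole_series]. *)
Definition poleprod z : R[i] := cexp (- pser pole_series z).

Lemma poleprod_diff : diff_disc poleprod.
Proof.
move=> z z1; have h1 := pser_cdiff pole_series_bounded z1.
have h2 := cdiffM (cdiff_cst (-1) z) h1.
eexists; apply: cdiff_ext (cdiff_comp h2 (cdiff_cexp _)); exists 1 => // w _.
by rewrite /poleprod mulN1r.
Qed.

Lemma poleprod_bounded : bounded_disc poleprod 1.
Proof.
move=> z z1; rewrite cabs_cexp -expR0 ler_expR ReN oppr_le0.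
exact: le_trans (Re_pole_ge0 0 z1) (Re_pole_series 0 z1).
Qed.

(** Pointwise, the factor e^{- 2 Re q_k} from the symbol cancels the growth e^{1 + 2 Re q_k} of
    [expk_bound]; a bound e on the squared modulus remains, the same for all k. *)
Lemma poleprod_expk k : (0 < NN k)%N -> (2 * weps k / (1 - cabs (eta k))) ^+ 2 <= (NN k)%:R ->
  n2 (taylor (fun z => poleprod z * expk (weps k) (NN k) (eta k) z)) <= expR 1.
Proof.
move=> N0 hN; have [he _] := expk_taylor (weps k) (NN k) (eta1 k).
have hd := hardy2_diff he.
have pd : diff_disc (fun z => poleprod z * expk (weps k) (NN k) (eta k) z).
  move=> z z1; have [d h1] := poleprod_diff z1; have [d' h2] := hd z z1.
  by eexists; exact: cdiffM h1 h2.
have pb : bounded_disc (fun z => poleprod z * expk (weps k) (NN k) (eta k) z) (Num.sqrt (expR 1)).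
  move=> z z1; rewrite -(@ler_pXn2r _ 2) ?nnegrE ?cabs_ge0 ?sqrtr_ge0 //.
  rewrite sqr_sqrtr ?expR_ge0 // cabsM exprMn cabs_cexp.
  have := expk_bound (weps_gt0 k) N0 (eta1 k) z1 hN => h.
  apply: le_trans (ler_wpM2l (sqr_ge0 _) h) _.
  rewrite -expRM_natl -expRD ler_expR ReN.
  have := Re_pole_series k z1; rewrite Re_pole //.
  move: (weps k * (2 * complex.Re (cker (eta k) z) - 1)) (complex.Re (pser pole_series z)) => x y xy.
  by move: xy; lra.
have := n2_mul pd pb (hardy2_cst 1); rewrite (sqr_sqrtr (expR_ge0 1)).
have -> : n2 (taylor (fun=> 1 : R[i])) = 1.
  have := sip_self (hardy2_l2seq (hardy2_cst (1 : R[i]))).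
  by rewrite sip_cst ?conjc1 ?mulr1 => [/(congr1 (@complex.Re R)) /= <-|]; last exact: hardy2_cst.
rewrite mulr1 (@taylor_eq _ _ (fun z => poleprod z * expk (weps k) (NN k) (eta k) z)) // => z _.
by rewrite mulr1.
Qed.

End Product.

(* Over the circle of [eta] of fixed modulus the pairing is a power series, so
   its supremum dominates each of its terms. *)
Lemma pairing_unbounded phi eps (X : R) : H2 phi -> 0 < eps -> eps <= 1 / 2 -> 0 < X ->
  (forall c K : R, 0 < c -> exists n : nat, K * expR (- (c * Num.sqrt n%:R)) < cabs (taylor phi n)) ->
  exists p : R[i] * nat, [/\ cabs p.1 < 1, (0 < p.2)%N, (2 * eps / (1 - cabs p.1)) ^+ 2 <= p.2%:R &
    X < cabs (sip (taylor phi) (taylor (expk eps p.2 p.1)))].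
Proof.
move=> hphi e0 e2 X0 big.
pose kap := Num.sqrt (eps / 2); have kap0 : 0 < kap by rewrite sqrtr_gt0 divr_gt0.
have k2 : 0 < kap / 2 by rewrite divr_gt0.
have [W W0 hW] := root_exp_decay k2.
have E0 : 0 < expR 1 :> R by exact: expR_gt0.
(* The first summand excludes m = 0. In the second, 4 e / eps undoes the constant of
   [expk_coef_growth], W + 1 its division by m, and the other factor 2 the loss r^{2m} >= 1 / 2. *)
pose K := cabs (taylor phi 0) + 8 * expR 1 * (W + 1) * X / eps.
have Ks : 8 * expR 1 * (W + 1) * X / eps <= K by rewrite lerDr cabs_ge0.
have Ks0 : 0 <= 8 * expR 1 * (W + 1) * X / eps.
  by rewrite divr_ge0 ?(ltW e0) // !mulr_ge0 ?(ltW E0) ?(ltW X0) // addr_ge0.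
have [m hm] := big (kap / 2) K k2.
have m0 : (0 < m)%N.
  case: m hm => // ; rewrite sqrtr0 mulr0 oppr0 expR0 mulr1 /K.
  by rewrite -ltrBrDl subrr ltNge Ks0.
have [N1 hN1] := expk_coef_growth e0 e2 m0.
(* By Bernoulli's inequality, r^{2m} >= 1 / 2 for this radius. *)
pose r : R := 1 - (8 * m.+1%:R)^-1.
have s0 : 0 < (8 * m.+1%:R)^-1 :> R by rewrite invr_gt0 mulr_gt0.
have s1 : (8 * m.+1%:R)^-1 <= 1 / 8 :> R.
  by rewrite div1r lef_pV2 ?posrE ?mulr_gt0 // ler_peMr // ler1n.
have r0 : 0 < r by rewrite /r; move: s1; set s := _^-1; lra.
have r1 : r < 1 by rewrite /r gtrBl.
have r2 : 1 / 2 <= r ^+ (2 * m).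
  apply: le_trans (bernoulli (2 * m) (ltW r0) (ltW r1)).
  have -> : (2 * m)%:R * (1 - r) = 1 / 4 - 1 / (4 * m.+1%:R).
    by rewrite /r natrM -[m.+1%:R]natr1; field; rewrite natr1 pnatr_eq0.
  have : 0 < 1 / (4 * m.+1%:R) :> R by rewrite divr_gt0 // mulr_gt0.
  set y := 1 / (4 * _); lra.
pose y := (2 * eps / (1 - r ^+ 2)) ^+ 2.
(* Large enough both for the growth of the m-th coefficient and for the condition on N in the
   conclusion. *)
pose N := (N1 + (Num.truncn y).+1)%N.
have N0 : (0 < N)%N by rewrite /N addnS.
have yN : y <= N%:R.
  apply: (@le_trans _ _ (Num.truncn y).+1%:R); last by rewrite ler_nat leq_addl.
  by apply: ltW; apply: real_truncnS_gt; exact: num_real.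
apply: contrapT => no.
(* The modulus r^2 is split in two: one factor r enters the coefficients [d], the other places the
   evaluation point r e^{it} inside the disc. The conjugate compensates the conjugate linearity of
   the pairing. *)
pose et t : R[i] := (r ^+ 2)%:C * (cis t)^*%C.
have et1 t : cabs (et t) = r ^+ 2.
  by rewrite /et cabsM cabs_real cabs_conj cabs_cis mulr1 ger0_norm // sqr_ge0.
have rr1 : r ^+ 2 < 1 by rewrite expr_lt1 // ltW.
have bd t : cabs (sip (taylor phi) (taylor (expk eps N (et t)))) <= X.
  rewrite leNgt; apply/negP => h; apply: no; exists (et t, N) => /=.
  by rewrite et1.
have cr : cabs (r%:C : R[i]) < 1 by rewrite cabs_real ger0_norm // ltW.
have [hr tr] := expk_taylor eps N cr.
have [C1 /l2_bounded b1] := hardy2_l2 hphi; have [C2 /l2_bounded b2] := hardy2_l2 hr.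
pose d n := taylor phi n * taylor (expk eps N r%:C) n.
have db : cbounded d ((C1 + 1) * (C2 + 1)).
  by move=> n; rewrite /d cabsM; apply: ler_pM; rewrite ?cabs_ge0.
have sE t : sip (taylor phi) (taylor (expk eps N (et t))) = pser d (r%:C * cis t).
  have ett : cabs (et t) < 1 by rewrite et1.
  have [_ te] := expk_taylor eps N ett.
  congr csum; apply/funext => n; rewrite te /d tr conjM conjc_real /et.
  rewrite conjX conjM conjcK conjc_real rmorphXn /= -mulrA; congr (_ * _).
  by rewrite -mulrA; congr (_ * _); rewrite !exprMn; ring.
have := fcp_pser m db (ltW r0) r1; rewrite /fcp => fE.
have ic := cint_circle (pser_diff_disc db) (ltW r0) r1.
have := circle_int_bound (cint_fcp m ic) (M := X); rewrite fE => /(_ (fun t _ =>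
  ltac:(by rewrite cabsM cabs_conj cabs_cis mulr1 -sE))).
have b0 := expk_coef_ge0 e0 e2 N0 m.
have -> : cabs (d m * (r ^+ m)%:C) = cabs (taylor phi m) * expk_coef eps N m * r ^+ (2 * m).
  rewrite /d tr; move: (taylor phi m) b0 => x; move: (expk_coef eps N m) => b b0.
  rewrite !cabsM cabsX !cabs_real (ger0_norm (ltW r0)) (ger0_norm (exprn_ge0 _ (ltW r0))).
  by rewrite (ger0_norm b0) mul2n -addnn exprD; ring.
rewrite leNgt => /negP; apply.
have := hN1 N (leq_addr _ _) N0.
have -> : Num.sqrt (eps * m%:R / 2) = kap * Num.sqrt m%:R.
  by rewrite /kap -sqrtrM ?divr_ge0 ?(ltW e0) //; congr Num.sqrt; ring.
have := hW m; move: hm; rewrite !expRN; set q := expR (kap / 2 * _).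
have q0 : 0 < q by exact: expR_gt0.
have -> : expR (kap * Num.sqrt m%:R) = q ^+ 2.
  by rewrite /q -expRM_natl; congr expR; field.
have mp : 0 < m%:R :> R by rewrite ltr0n.
move=> h1 h2 h3.
have h4 : m%:R / q <= W + 1.
  apply: (@le_trans _ _ (m.+1%:R / q)); first by rewrite ler_pM2r ?invr_gt0 // ler_nat.
  apply: le_trans h2 _; apply: (@le_trans _ _ (W * 1)); last by lra.
  rewrite ler_wpM2l //; have := rcp_gt0 R m.+1.
  have : rcp R m <= 1 by rewrite /rcp invf_le1 // ler1n.
  lra.
have b1' : 0 < eps / (4 * expR 1 * m%:R) * q ^+ 2 by rewrite mulr_gt0 ?exprn_gt0 // divr_gt0 // !mulr_gt0.
have h5 : K / q * (eps / (4 * expR 1 * m%:R) * q ^+ 2) < cabs (taylor phi m) * expk_coef eps N m.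
  apply: (@lt_le_trans _ _ (cabs (taylor phi m) * (eps / (4 * expR 1 * m%:R) * q ^+ 2))).
    by rewrite ltr_pM2r.
  by rewrite ler_wpM2l ?cabs_ge0.
have h6 : 2 * X <= K / q * (eps / (4 * expR 1 * m%:R) * q ^+ 2).
  have W1 : 0 < W + 1 by rewrite ltr_wpDl.
  apply: (@le_trans _ _ (8 * expR 1 * (W + 1) * X / eps / q * (eps / (4 * expR 1 * m%:R) * q ^+ 2))); last first.
    by rewrite ler_pM2r // ler_pM2r ?invr_gt0.
  have -> : 8 * expR 1 * (W + 1) * X / eps / q * (eps / (4 * expR 1 * m%:R) * q ^+ 2) =
    2 * X * ((W + 1) * (m%:R / q)^-1).
    by rewrite invf_div; field; rewrite !gt_eqF.
  rewrite ler_peMr ?mulr_ge0 ?(ltW X0) // ler_pdivlMr ?divr_gt0 //.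
  by rewrite mul1r.
have h7 := le_lt_trans h6 h5.
have p0 : 0 < cabs (taylor phi m) * expk_coef eps N m.
  by apply: lt_trans h7; rewrite mulr_gt0.
apply: lt_le_trans (ler_wpM2l (ltW p0) r2); move: h7.
move: (cabs _ * _) => v; clear; lra.
Qed.

Theorem multiplier_root_exp phi :
  (forall a : R[i] -> R[i], hardy_infty_nonzero (a : R[i]^o -> R[i]^o) ->
     multipliers (a : R[i]^o -> R[i]^o) (phi : R[i]^o -> R[i]^o)) ->
  root_exp_class (phi : R[i]^o -> R[i]^o).
Proof.
move=> H.
have nz (a : R[i] -> R[i]) M : diff_disc a -> bounded_disc a M -> a 0 != 0 ->
    hardy_infty_nonzero (a : R[i]^o -> R[i]^o).
  move=> ad aM a0; split; first by apply/hardy_inftyP; split => //; exists M.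
  by exists 0 => //; apply/discE; rewrite cabs0.
have hphi : H2 phi.
  apply: multiplier_hardy2; apply: H; apply: (nz _ 1) => [||]; last exact: oner_neq0.
    exact: diff_disc_cst.
  by move=> z _; rewrite cabs1.
have [c [K [c0 hK]]] : exists c K : R, 0 < c /\
    forall n : nat, cabs (taylor phi n) <= K * expR (- (c * Num.sqrt n%:R)).
  apply: contrapT => no.
  have big (c K : R) : 0 < c -> exists n : nat, K * expR (- (c * Num.sqrt n%:R)) < cabs (taylor phi n).
    move=> c0; apply: contrapT => h; apply: no; exists c, K; split => // n.
    by rewrite leNgt; apply/negP => h2; apply: h; exists n.
  (* These choices depend on phi only, so they precede the symbol a and the function f obtained from
     it. *)
  have ex (k : nat) := pairing_unbounded hphi (weps_gt0 k) (weps_le k) (ltr0Sn R k) big.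
  have [P hP] := choice ex.
  pose eta k := (P k).1; pose NN k := (P k).2.
  have eta1 k : cabs (eta k) < 1 by have [] := hP k.
  pose a := poleprod eta.
  have ad : diff_disc a := poleprod_diff eta1.
  have aM : bounded_disc a 1 := poleprod_bounded eta1.
  have a0 : a 0 != 0 by exact: cexp_neq0.
  have [f hf fE] := multiplier_pairing ad aM a0 (H _ (nz _ _ ad aM a0)).
  have lf := hardy2_l2seq hf; have n0 := n2_ge0 lf.
  pose X := n2 (taylor f) * expR 1.
  have X0 : 0 <= X by rewrite mulr_ge0 ?expR_ge0.
  (* The pairing exceeds k + 1 > X, and so does its square, while Cauchy-Schwarz bounds the square
     by X. *)
  pose k := Num.truncn X.
  have [_ Nk hN hX] := hP k.
  have [he _] := expk_taylor (weps k) (NN k) (eta1 k).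
  have hae := hardy2_mul ad aM he.
  have : cabs (sip (taylor phi) (taylor (expk (weps k) (NN k) (eta k)))) ^+ 2 <= X.
    rewrite -fE //; apply: le_trans (sip_cs lf (hardy2_l2seq hae)) _.
    by rewrite ler_wpM2l // poleprod_expk.
  apply/negP; rewrite -ltNge; apply: (@lt_le_trans _ _ k.+1%:R).
    by apply: real_truncnS_gt; exact: num_real.
  apply: (@le_trans _ _ (k.+1%:R ^+ 2)); first by rewrite expr2 ler_peMl // ler1n.
  by rewrite ler_pXn2r ?nnegrE ?cabs_ge0 // ltW.
have K0 : 0 <= K.
  have := hK 0%N; rewrite sqrtr0 mulr0 oppr0 expR0 mulr1; apply: le_trans; exact: cabs_ge0.
have [W W0 hW] := root_exp_decay c0.
have phid := hardy2_diff hphi.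
split; last first.
  by exists c => //; exists K => n; rewrite fourier_taylor // cabsE lecR.
(* Boundedness of phi is a consequence of the decay, which makes the coefficients absolutely
   summable. *)
apply/hardy_inftyP; split => //; exists (K * W) => z z1.
have [C' /l2_bounded cC] := hardy2_l2 hphi.
have := geo_cvg (pser_geo cC z1); rewrite -/(pser _ z) -(hardy2_pser hphi z1) => cv.
rewrite -[phi z]subr0; apply: (ccvg_bound cv (n0 := 0%N)) => n _; rewrite subr0.
have := psum_diff (fun k => taylor phi k * z ^+ k) (leq0n n).
rewrite {2}/psum big_ord0 subr0 => /le_trans; apply.
apply: (@le_trans _ _ (\sum_(0 <= k < n) K * W * (rcp R k - rcp R k.+1))); last first.
  rewrite -mulr_sumr sum_rcp // -[leRHS]mulr1 ler_wpM2l ?mulr_ge0 // lerBlDr -[leLHS]addr0.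
  by apply: lerD; [rewrite /rcp invr1|exact: ltW (rcp_gt0 _ _)].
apply: ler_sum => k _; rewrite cabsM cabsX; apply: (@le_trans _ _ (cabs (taylor phi k))).
  by rewrite ler_piMr ?cabs_ge0 // exprn_ile1 ?cabs_ge0 // ltW.
apply: le_trans (hK k) _; rewrite -mulrA ler_wpM2l //; apply: le_trans (hW k).
by rewrite ler_peMl ?expR_ge0 // ler1n.
Qed.

End Necessity.

Theorem theorem1p7 (R : realType) :
  \bigcap_(a in @hardy_infty_nonzero R) multipliers a = @root_exp_class R.
Proof.
apply/seteqP; split=> psi h.
  by apply: multiplier_root_exp => a ha; exact: h.
by move=> a ha; exact: root_exp_multiplier.
Qed.
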